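(* Consider the Markov jump linear system $x(k+1)=A(\vartheta(k))x(k)+B(\vartheta(k))v(k)$, $z(k)=C(\vartheta(k))x(k)+D(\vartheta(k))v(k)$, $k\in\mathbb{N}$, with $C(\ell)^TD(\ell)=0$ for $\mu$-almost every $\ell$, and let $\mathfrak{L}$ be its input-to-output operator. Given any $\gamma>0$, the following are equivalent: (i) The system is internally stable and $\|\mathfrak{L}\|_{\infty}<\sqrt{\gamma}$. (ii) There exists a unique stabilizing solution $\bar{P}\in\mathcal{H}_{\infty}^{n+}$ to the coupled algebraic Riccati equations $$\bar{P}(\ell)=\Psi_{1}(\bar{P})(\ell)-\Psi_{2}(\bar{P})(\ell)[-\Psi_{3}^{\gamma}(\bar{P})(\ell)]^{-1}\Psi_{2}(\bar{P})(\ell)^{T}\quad \mu\text{-a.e.}$$ such that $\Psi_{3}^{\gamma}(\bar{P})(\ell)\gg0$ $\mu$-a.e. (iii) There exists $\hat{P}\in\mathcal{H}_{\infty}^{n+*}$ satisfying $$\hat{P}(\ell)-\Psi_{1}(\hat{P})(\ell)-\Psi_{2}(\hat{P})(\ell)\Psi_{3}^{\gamma}(\hat{P})(\ell)^{-1}\Psi_{2}(\hat{P})(\ell)^{T}\gg 0\quad \mu\text{-a.e.}$$ such that $\Psi_{3}^{\gamma}(\hat{P})(\ell)\gg 0$ $\mu$-a.e. Moreover, if (i)–(iii) hold, then $\hat{P}-\bar{P}\in\mathcal{H}_{\infty}^{n+*}$.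
   Context: $\Theta$ is a Borel subset of a separable complete metric space, $\mathcal{B}(\Theta)$ its Borel $\sigma$-algebra, $\mu$ a $\sigma$-finite measure on it; all relations between functions on $\Theta$ hold $\mu$-a.e. Matrices carry the spectral norm. $\mathcal{H}^{n\times m}_{\infty}$: measurable $P:\Theta\to\mathbb{R}^{n\times m}$ with $\operatorname{ess\,sup}_\ell\|P(\ell)\|<\infty$; $\mathcal{SH}^n_\infty$: symmetric-valued elements of $\mathcal{H}^{n\times n}_\infty$; $\mathcal{H}^{n+}_\infty$: those with $P(\ell)\ge0$ a.e.; ''$P(\ell)\gg0$ $\mu$-a.e.'' means there is $\xi>0$ with $P(\ell)\ge\xi I$ $\mu$-a.e.; $\mathcal{H}^{n+*}_\infty=\{P\in\mathcal{SH}^n_\infty: P(\ell)\gg0\ \mu\text{-a.e.}\}$. Markov chain: $\{\vartheta(k)\}_{k\in\mathbb{N}}$ takes values in $\Theta$, with initial distribution having density $\nu_0$ with respect to $\mu$, and stochastic kernel $\mathbb{G}(\ell,\Lambda)=\int_\Lambda g(\ell,t)\mu(dt)$. Standing assumptions: $\nu_0(\ell)>0$ $\mu$-a.e. and $\int_\Theta g(t,\ell)\mu(dt)>0$ $\mu$-a.e. $\mathfrak{F}_k=\sigma(\vartheta(0),\dots,\vartheta(k))$, $\vartheta_0=\vartheta(0)$. System: $A\in\mathcal{H}^{n\times n}_\infty$, $B\in\mathcal{H}^{n\times r}_\infty$, $C\in\mathcal{H}^{r\times n}_\infty$, $D\in\mathcal{H}^{r\times r}_\infty$; $x(0)=x_0\in\mathbb{R}^n$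 deterministic. $(A|\mathbb{G})$ denotes $x(k+1)=A(\vartheta(k))x(k)$; it is exponentially mean-square stable (EMSS) if there are $\beta>0$, $\alpha\in(0,1)$ such that for any initial conditions $(x_0,\vartheta_0)$, $\mathbf{E}\{\|x(k)\|^2\}\le\beta\alpha^k\|x_0\|^2$ for all $k\in\mathbb{N}$. The system is internally stable if $(A|\mathbb{G})$ is EMSS. $l^2(\mathbb{N};\mathbb{R}^r)$ is the Hilbert space of random sequences $v$ with $v(k)$ $\mathbb{R}^r$-valued and $\mathfrak{F}_k$-measurable and $\|v\|^2=\sum_{k}\mathbf{E}\|v(k)\|^2<\infty$. When the system is internally stable, $\mathfrak{L}$ maps $v\in l^2(\mathbb{N};\mathbb{R}^r)$ to the output $z$ with $x(0)=0$, and $\|\mathfrak{L}\|_\infty=\inf\{\sqrt\gamma:\gamma>0,\ \|\mathfrak{L}(v)\|^2-\gamma\|v\|^2<0 \text{ for any }\vartheta_0\text{ and any nonzero } v\in l^2(\mathbb{N};\mathbb{R}^r)\}$. Operators, for $P\in\mathcal{SH}^n_\infty$: $\mathcal{E}(P)(\ell)=\int_\Theta g(\ell,t)P(t)\mu(dt)$; $\Psi_1(P)(\ell)=A(\ell)^T\mathcal{E}(P)(\ell)A(\ell)+C(\ell)^TC(\ell)$; $\Psi_2(P)(\ell)=A(\ell)^T\mathcal{E}(P)(\ell)B(\ell)$; $\Psi_3^\gamma(P)(\ell)=\gamma I-B(\ell)^T\mathcal{E}(P)(\ell)B(\ell)-D(\ell)^TD(\ell)$. A solution $\bar P$ of the coupled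 Riccati equations is stabilizing if the autonomous system with coefficient $A+B\,\Psi_3^\gamma(\bar P)^{-1}\Psi_2(\bar P)^T$ (pointwise in $\ell$), driven by the same Markov chain, is EMSS. *)

(* Defs.v *)
From HB Require Import structures.
From mathcomp Require Import all_boot all_order all_algebra.
From mathcomp Require Import all_classical all_reals all_analysis.
From mathcomp Require Import ess_sup_inf.

Set Implicit Arguments.
Unset Strict Implicit.
Unset Printing Implicit Defensive.

Import Order.TTheory GRing.Theory Num.Theory.
Import numFieldNormedType.Exports.

Local Open Scope classical_set_scope.
Local Open Scope ring_scope.

#[short(type="completeMetricType")]
HB.structure Definition CompleteMetric (R : numDomainType) :=
  { X of CompletePseudoMetric R X & Metric R X }.

Definition separable (X : topologicalType) :=
  exists2 S : set X, countable S & dense S.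

(* [borel_subset t0] is [Theta] with the sigma-algebra generated by the open sets
   of its subspace topology. A [measurableType] has to be pointed, so the type
   carries a point [t0] of [Theta]. *)
Definition pointed_subset (X : topologicalType) (Theta : set X) (t0 : Theta) :
  Type := Theta.

HB.instance Definition _ (X : topologicalType) (Theta : set X) (t0 : Theta) :=
  Choice.copy (pointed_subset t0) Theta.
HB.instance Definition _ (X : topologicalType) (Theta : set X) (t0 : Theta) :=
  isPointed.Build (pointed_subset t0) t0.

Definition relatively_open (X : topologicalType) (Theta : set X) (t0 : Theta) :
  set (set (pointed_subset t0)) := @open Theta.

Arguments relatively_open {X Theta} t0 _.

Notation borel_subset t0 := (g_sigma_algebraType (relatively_open t0)).

Section Matrices.
Context {R : realType}.

Definition enorm n (x : 'cV[R]_n) : R := Num.sqrt (\sum_i x i 0 ^+ 2).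

Definition spectral_norm n m (M : 'M[R]_(n, m)) : R :=
  sup [set enorm (M *m x) | x in [set x : 'cV[R]_m | enorm x <= 1]].

Definition psdmx n (M : 'M[R]_n) : Prop :=
  M^T = M /\ forall x : 'cV[R]_n, 0 <= (x^T *m M *m x) 0 0.

End Matrices.

Section FunctionSpaces.
Context {R : realType} {d : measure_display} {T : measurableType d}.
Variable mu : {measure set T -> \bar R}.

Definition measurable_mx d' (S : measurableType d') n m
    (P : S -> 'M[R]_(n, m)) : Prop :=
  forall i j, measurable_fun [set: S] (fun s => P s i j).

Definition Hinf n m (P : T -> 'M[R]_(n, m)) : Prop :=
  measurable_mx P /\ (ess_sup mu (fun l => (spectral_norm (P l))%:E) < +oo)%E.

Definition SHinf n (P : T -> 'M[R]_n) : Prop :=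
  Hinf P /\ {ae mu, forall l, (P l)^T = P l}.

Definition Hinf_plus n (P : T -> 'M[R]_n) : Prop :=
  SHinf P /\ {ae mu, forall l, psdmx (P l)}.

(* [P(l) >> 0] mu-a.e. *)
Definition ae_unif_pos n (P : T -> 'M[R]_n) : Prop :=
  exists2 xi : R, 0 < xi & {ae mu, forall l, psdmx (P l - xi%:M)}.

Definition Hinf_plus_star n (P : T -> 'M[R]_n) : Prop :=
  SHinf P /\ ae_unif_pos P.

End FunctionSpaces.

Section MarkovChain.
Context {R : realType} {d : measure_display} {T : measurableType d}.

(* Initial distributions are only considered when their density is positive
   almost everywhere. *)
Definition initial_density (mu : {measure set T -> \bar R}) (nu : T -> R) :
    Prop :=
  [/\ measurable_fun [set: T] nu,
      {ae mu, forall l, 0 < nu l}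
    & (\int[mu]_l (nu l)%:E = 1)%E].

(* sigma(th 0, ..., th k) *)
Definition history (S : Type) (th : nat -> S -> T) (k : nat) : set (set S) :=
  g_sigma_preimage (fun (i : 'I_k.+1) (w : S) => th i w).

(* The Markov chain with transition kernel [G], for every admissible initial
   distribution: [chain k] is the random variable at time [k], and [law nu] is
   the probability on the sample space under which [chain 0] has density [nu]
   with respect to [mu]. [law nu] is irrelevant when [nu] is not an initial
   density. The field [chain_step] says that [G (chain k) L] is a version of the
   conditional probability of [chain k.+1 \in L] given [history chain k]. *)
Record markov_chain (mu : {measure set T -> \bar R}) (G : R.-pker T ~> T)
    (d' : measure_display) (Omega : measurableType d') := MarkovChain {
  chain : nat -> Omega -> T ;
  law : (T -> R) -> probability Omega R ;
  chain_measurable : forall k, measurable_fun [set: Omega] (chain k) ;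
  chain_init : forall nu, initial_density mu nu ->
    forall L, measurable L ->
    law nu (chain 0%N @^-1` L) = (\int[mu]_(l in L) (nu l)%:E)%E ;
  chain_step : forall nu, initial_density mu nu ->
    forall k L F, measurable L -> history chain k F ->
    law nu (F `&` chain k.+1 @^-1` L)
      = (\int[law nu]_(w in F) G (chain k w) L)%E }.

End MarkovChain.

Section System.
Context {R : realType} {d : measure_display} {T : measurableType d}.
Context {mu : {measure set T -> \bar R}} {G : R.-pker T ~> T}.
Context {d' : measure_display} {Omega : measurableType d'}.
Variable M : markov_chain mu G Omega.
Context {n r : nat}.

Fixpoint state (A : T -> 'M[R]_n) (B : T -> 'M[R]_(n, r)) (x0 : 'cV[R]_n)
    (v : nat -> Omega -> 'cV[R]_r) (k : nat) (w : Omega) : 'cV[R]_n :=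
  if k is k'.+1 then
    A (chain M k' w) *m state A B x0 v k' w + B (chain M k' w) *m v k' w
  else x0.

Fixpoint autonomous_state (A : T -> 'M[R]_n) (x0 : 'cV[R]_n) (k : nat)
    (w : Omega) : 'cV[R]_n :=
  if k is k'.+1 then A (chain M k' w) *m autonomous_state A x0 k' w else x0.

(* The constants are uniform in the deterministic [x0] and in the distribution
   of the initial value of the chain. *)
Definition EMSS (A : T -> 'M[R]_n) : Prop :=
  exists beta alpha : R, [/\ 0 < beta, 0 < alpha < 1 &
    forall nu, initial_density mu nu -> forall (x0 : 'cV[R]_n) (k : nat),
      ('E_(law M nu)[(fun w => enorm (autonomous_state A x0 k w) ^+ 2)%R]
         <= (beta * alpha ^+ k * enorm x0 ^+ 2)%:E)%E].

Definition l2_sqnorm (nu : T -> R) m (v : nat -> Omega -> 'cV[R]_m) : \bar R :=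
  (\sum_(0 <= k <oo) 'E_(law M nu)[(fun w => enorm (v k w) ^+ 2)%R])%E.

Definition l2_seq (nu : T -> R) m (v : nat -> Omega -> 'cV[R]_m) : Prop :=
  (forall k, @measurable_mx R _ (g_sigma_algebraType (history (chain M) k))
     m 1 (v k)) /\ (l2_sqnorm nu v < +oo)%E.

(* Output of the system started at [x(0) = 0]. *)
Definition io_operator (A : T -> 'M[R]_n) (B : T -> 'M[R]_(n, r))
    (C : T -> 'M[R]_(r, n)) (D : T -> 'M[R]_r)
    (v : nat -> Omega -> 'cV[R]_r) (k : nat) (w : Omega) : 'cV[R]_r :=
  C (chain M k w) *m state A B 0 v k w + D (chain M k w) *m v k w.

(* A sequence [v] is nonzero as an element of l^2 iff its norm is nonzero. *)
Definition io_norm (A : T -> 'M[R]_n) (B : T -> 'M[R]_(n, r))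
    (C : T -> 'M[R]_(r, n)) (D : T -> 'M[R]_r) : \bar R :=
  ereal_inf [set (Num.sqrt gamma)%:E | gamma in [set gamma : R | 0 < gamma /\
    forall nu, initial_density mu nu ->
    forall v, l2_seq nu v -> l2_sqnorm nu v != 0%E ->
      (l2_sqnorm nu (io_operator A B C D v) - gamma%:E * l2_sqnorm nu v < 0)%E]].

End System.

Section Riccati.
Context {R : realType} {d : measure_display} {T : measurableType d}.
Variables (mu : {measure set T -> \bar R}) (g : T -> T -> R).
Context {n r : nat}.
Variables (A : T -> 'M[R]_n) (B : T -> 'M[R]_(n, r)).
Variables (C : T -> 'M[R]_(r, n)) (D : T -> 'M[R]_r).
Implicit Type P : T -> 'M[R]_n.

Definition Eop P (l : T) : 'M[R]_n :=
  \matrix_(i, j) \int[mu]_t (g l t * P t i j).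

Definition Psi1 P (l : T) : 'M[R]_n :=
  (A l)^T *m Eop P l *m A l + (C l)^T *m C l.

Definition Psi2 P (l : T) : 'M[R]_(n, r) := (A l)^T *m Eop P l *m B l.

Definition Psi3 (gamma : R) P (l : T) : 'M[R]_r :=
  gamma%:M - (B l)^T *m Eop P l *m B l - (D l)^T *m D l.

Definition riccati_solution (gamma : R) P : Prop :=
  {ae mu, forall l, P l =
     Psi1 P l - Psi2 P l *m invmx (- Psi3 gamma P l) *m (Psi2 P l)^T}.

Definition stabilizing (G : R.-pker T ~> T) (d' : measure_display)
    (Omega : measurableType d') (M : markov_chain mu G Omega) (gamma : R) P :
    Prop :=
  EMSS M (fun l => A l + B l *m (invmx (Psi3 gamma P l) *m (Psi2 P l)^T)).

Definition stabilizing_riccati_solution (G : R.-pker T ~> T)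
    (d' : measure_display) (Omega : measurableType d')
    (M : markov_chain mu G Omega) (gamma : R) P : Prop :=
  [/\ Hinf_plus mu P, riccati_solution gamma P, stabilizing M gamma P
    & ae_unif_pos mu (Psi3 gamma P)].

Definition strict_riccati_solution (gamma : R) P : Prop :=
  [/\ Hinf_plus_star mu P,
      ae_unif_pos mu (fun l => P l - Psi1 P l
        - Psi2 P l *m invmx (Psi3 gamma P l) *m (Psi2 P l)^T)
    & ae_unif_pos mu (Psi3 gamma P)].

End Riccati.

(* Main.v *)
Require Import Defs.
From HB Require Import structures.
From mathcomp Require Import all_boot all_order all_algebra.
From mathcomp Require Import all_classical all_reals all_analysis.
From mathcomp Require Import measurable_realfun ess_sup_inf ring lra.

Set Implicit Arguments.
Unset Strict Implicit.
Unset Printing Implicit Defensive.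

Import Order.TTheory GRing.Theory Num.Theory.
Import numFieldNormedType.Exports.

Local Open Scope classical_set_scope.
Local Open Scope ring_scope.

(** Completing the square, the stage cost plus the expected value of [x^T P x] one
    step later equals [x^T Ric(P) x - (v - F x)^T Psi3(P) (v - F x)], where [F] is
    the gain of [P].  Everything is reduced to the existence of a dissipative [P]:
    for some [eta > 0] and all [x], [v], the left-hand side is at most
    [x^T P x - eta (|x|^2 + |v|^2)].

    - A dissipative [P] is the same as a strict solution of the inequality (iii).
      Telescoping along trajectories gives (i).
    - Given (i), the finite-horizon optimal costs started from [P_0 = 0] with
      [C^T C] replaced by [C^T C + eps I] are the Riccati iterates [P_k].  The norm
      bound keeps [P_k] bounded and [Psi3 P_k >= eta I]; they increase, and their
      limit solves the Riccati equation with the larger weight, hence the strict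
      inequality for the original one.
    - Given a dissipative [Phat], the iterates for the original weight stay below
      [Phat] and converge to a solution [Pbar]; [Phat - Pbar] is a Lyapunov function
      for the closed loop of [Pbar], so [Pbar] is stabilizing.
    - Given a stabilizing [Pbar] with closed-loop Lyapunov function [S],
      [Pbar + k S] is dissipative for small [k > 0].

    Exponential mean-square stability of [A] is equivalent to the existence of a
    Lyapunov function for [P |-> A^T E(P) A], which also gives the comparison
    principle behind uniqueness and the final positivity statement. *)

(** * Quadratic forms *)

Section BilinearForms.
Context {R : realType}.
Implicit Types (n m : nat).

(** The hub is an inequality in [x] and [v] jointly that contains no inverse and is affine in [P]:
    it survives the addition of a multiple of a Lyapunov function, and it telescopes under
    expectations. Matrix inequalities are treated as inequalities of quadratic forms, so that
    monotonicity of the Riccati map is a fact about maxima over [v], and limits are taken with [v]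
    frozen, without continuity of the inverse. The obstacle is the passage between expectations and
    almost everywhere statements. From pointwise to mean, it suffices that the kernel and all laws
    of the chain are absolutely continuous with respect to [mu]. For the return, an inequality in
    mean has to hold for every initial density and every deterministic [x0]: more and more initial
    mass on a bad set gives the inequality for one [x], and rational vectors give one null set for
    all [x]. The weight [eps I] is affordable because stability bounds the energy of the state by
    that of the input, and the gap below [sqrt gamma] leaves room for a small multiple of the
    latter. *)

Definition bf n m (M : 'M[R]_(n, m)) (x : 'cV[R]_n) (y : 'cV[R]_m) : R :=
  (x^T *m M *m y) 0 0.

Definition sqn n (x : 'cV[R]_n) : R := \sum_i x i 0 ^+ 2.

Lemma bfDl n m (M : 'M[R]_(n, m)) x x' y :
  bf M (x + x') y = bf M x y + bf M x' y.
Proof. by rewrite /bf linearD /= !mulmxDl mxE. Qed.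

Lemma bfDr n m (M : 'M[R]_(n, m)) x y y' :
  bf M x (y + y') = bf M x y + bf M x y'.
Proof. by rewrite /bf mulmxDr mxE. Qed.

Lemma bfZl n m (M : 'M[R]_(n, m)) a x y : bf M (a *: x) y = a * bf M x y.
Proof. by rewrite /bf linearZ /= -!scalemxAl mxE. Qed.

Lemma bfZr n m (M : 'M[R]_(n, m)) a x y : bf M x (a *: y) = a * bf M x y.
Proof. by rewrite /bf -!scalemxAr mxE. Qed.

Lemma bfNl n m (M : 'M[R]_(n, m)) x y : bf M (- x) y = - bf M x y.
Proof. by rewrite -scaleN1r bfZl mulN1r. Qed.

Lemma bfNr n m (M : 'M[R]_(n, m)) x y : bf M x (- y) = - bf M x y.
Proof. by rewrite -scaleN1r bfZr mulN1r. Qed.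

Lemma bf_addm n m (M N : 'M[R]_(n, m)) x y :
  bf (M + N) x y = bf M x y + bf N x y.
Proof. by rewrite /bf mulmxDr mulmxDl mxE. Qed.

Lemma bf_oppm n m (M : 'M[R]_(n, m)) x y : bf (- M) x y = - bf M x y.
Proof. by rewrite /bf mulmxN mulNmx mxE. Qed.

Lemma bf_subm n m (M N : 'M[R]_(n, m)) x y :
  bf (M - N) x y = bf M x y - bf N x y.
Proof. by rewrite bf_addm bf_oppm. Qed.

Lemma bf_scalem n m (M : 'M[R]_(n, m)) a x y : bf (a *: M) x y = a * bf M x y.
Proof. by rewrite /bf -scalemxAr -scalemxAl mxE. Qed.

Lemma bf_mulm n m p q (L : 'M[R]_(p, n)) (M : 'M[R]_(p, q)) (N : 'M[R]_(q, m))
  x y : bf (L^T *m M *m N) x y = bf M (L *m x) (N *m y).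
Proof. by rewrite /bf trmx_mul !mulmxA. Qed.

Lemma bf_mulr n m q (M : 'M[R]_(n, q)) (N : 'M[R]_(q, m)) x y :
  bf (M *m N) x y = bf M x (N *m y).
Proof. by rewrite /bf !mulmxA. Qed.

Lemma bf_tr n m (M : 'M[R]_(n, m)) x y : bf M^T y x = bf M x y.
Proof.
rewrite /bf.
have -> : x^T *m M *m y = (y^T *m M^T *m x)^T.
  by rewrite !trmx_mul !trmxK mulmxA.
by rewrite [in RHS]mxE.
Qed.

Lemma bf_sym n (M : 'M[R]_n) x y : M^T = M -> bf M y x = bf M x y.
Proof. by move=> sM; rewrite -[in LHS]sM bf_tr. Qed.

Lemma bf1 n (x : 'cV[R]_n) : bf 1%:M x x = sqn x.
Proof.
rewrite /bf mulmx1 mxE; apply: eq_bigr => i _.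
by rewrite mxE expr2.
Qed.

Lemma bf_scalar n a (x : 'cV[R]_n) : bf a%:M x x = a * sqn x.
Proof. by rewrite -scalemx1 bf_scalem bf1. Qed.

Lemma bf0m n m x y : bf (0 : 'M[R]_(n, m)) x y = 0.
Proof. by rewrite /bf mulmx0 mul0mx mxE. Qed.

Lemma bf_gram n m (M : 'M[R]_(m, n)) x : bf (M^T *m M) x x = sqn (M *m x).
Proof. by rewrite -[M^T *m M]/(M^T *m M) -(mulmx1 M^T) bf_mulm bf1. Qed.

Lemma bfE n m (M : 'M[R]_(n, m)) x y :
  bf M x y = \sum_i \sum_j x i 0 * y j 0 * M i j.
Proof.
rewrite /bf mxE exchange_big /=; apply: eq_bigr => j _.
rewrite mxE big_distrl /=; apply: eq_bigr => i _.
by rewrite mxE mulrAC.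
Qed.

Lemma bf_delta n m (M : 'M[R]_(n, m)) i j :
  bf M (delta_mx i 0) (delta_mx j 0) = M i j.
Proof.
rewrite /bf trmx_delta -rowE -colE.
by rewrite !mxE.
Qed.

Lemma sqn_ge0 n (x : 'cV[R]_n) : 0 <= sqn x.
Proof. by apply: sumr_ge0 => i _; exact: sqr_ge0. Qed.

Lemma sqn0 n : sqn (0 : 'cV[R]_n) = 0.
Proof. by rewrite /sqn big1 // => i _; rewrite mxE expr0n. Qed.

Lemma sqn_delta n (i : 'I_n) : sqn (delta_mx i 0 : 'cV[R]_n) = 1.
Proof. by rewrite -bf1 bf_delta mxE eqxx. Qed.

Lemma sqn_eq0 n (x : 'cV[R]_n) : sqn x = 0 -> x = 0.
Proof.
move=> /eqP; rewrite psumr_eq0; last by move=> i _; exact: sqr_ge0.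
move=> /allP x0; apply/matrixP => i j; rewrite ord1 mxE.
have := x0 i (mem_index_enum i).
by rewrite implyTb sqrf_eq0 => /eqP.
Qed.

Lemma entry_sqn n (x : 'cV[R]_n) i : x i 0 ^+ 2 <= sqn x.
Proof.
by rewrite /sqn (bigD1 i) //= lerDl sumr_ge0 // => j _; exact: sqr_ge0.
Qed.

Lemma enorm_sqr n (x : 'cV[R]_n) : enorm x ^+ 2 = sqn x.
Proof. by rewrite sqr_sqrtr //; exact: sqn_ge0. Qed.

(** Nonnegativity of the form at [sqrt d x - y / sqrt d], expanded. The free [d] decides which of
    the two terms carries the cross term. *)
Lemma young n (M : 'M[R]_n) d x y : psdmx M -> 0 < d ->
  bf M (x + y) (x + y) <= (1 + d) * bf M x x + (1 + d^-1) * bf M y y.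
Proof.
move=> [sM pM] d0.
have /= := pM (Num.sqrt d *: x - (Num.sqrt d)^-1 *: y).
rewrite -/(bf M _ _) !bfDl !bfDr !bfNl !bfNr !bfZl !bfZr.
have s0 : Num.sqrt d != 0 by rewrite gt_eqF // sqrtr_gt0.
have sd : Num.sqrt d * Num.sqrt d = d by rewrite -expr2 sqr_sqrtr // ltW.
rewrite (bf_sym x y sM); set s := Num.sqrt d in s0 sd *.
rewrite -{}sd.
set xx := bf M x x; set xy := bf M x y; set yy := bf M y y.
move=> h; rewrite -subr_ge0; apply: le_trans h _; rewrite le_eqVlt.
by apply/orP; left; apply/eqP; field.
Qed.

Lemma psdmx1 n : psdmx (1%:M : 'M[R]_n).
Proof. by split=> [|x]; [exact: trmx1 | rewrite -/(bf _ x x) bf1 sqn_ge0]. Qed.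

Lemma psdmx_ge0 n (M : 'M[R]_n) x : psdmx M -> 0 <= bf M x x.
Proof. by case=> _; exact. Qed.

Lemma psdmx_sub_le n (M N : 'M[R]_n) x :
  psdmx (M - N) -> bf N x x <= bf M x x.
Proof. by move/(psdmx_ge0 x); rewrite bf_subm subr_ge0. Qed.

Lemma psdmx_subP n (M N : 'M[R]_n) : M^T = M -> N^T = N ->
  (forall x, bf N x x <= bf M x x) -> psdmx (M - N).
Proof.
move=> sM sN MN; split; first by rewrite linearB /= sM sN.
by move=> x; rewrite -/(bf _ x x) bf_subm subr_ge0.
Qed.

Lemma psdmx_subs_le n (M : 'M[R]_n) a x :
  psdmx (M - a%:M) -> a * sqn x <= bf M x x.
Proof. by move/(psdmx_sub_le x); rewrite bf_scalar. Qed.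

Lemma psdmx_subsP n (M : 'M[R]_n) a : M^T = M ->
  (forall x, a * sqn x <= bf M x x) -> psdmx (M - a%:M).
Proof.
by move=> sM aM; apply: psdmx_subP => // [|x]; rewrite ?tr_scalar_mx ?bf_scalar.
Qed.

Lemma psdmx_sym n (M : 'M[R]_n) a : psdmx (M - a%:M) -> M^T = M.
Proof. by case; rewrite linearB /= tr_scalar_mx => /addIr. Qed.

Lemma bf_polar n (M : 'M[R]_n) x y : M^T = M ->
  bf M x y = (bf M (x + y) (x + y) - bf M x x - bf M y y) / 2.
Proof. by move=> sM; rewrite !bfDl !bfDr (bf_sym x y sM); field. Qed.

Lemma bf_inj n (M N : 'M[R]_n) : M^T = M -> N^T = N ->
  (forall x, bf M x x = bf N x x) -> M = N.
Proof.
move=> sM sN MN; apply/matrixP => i j.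
by rewrite -(bf_delta M) -(bf_delta N) (bf_polar _ _ sM) (bf_polar _ _ sN) !MN.
Qed.

(** Testing on [e_i + e_j] and [e_i - e_j] gives [2 |M i j| <= M i i + M j j]. *)
Lemma psdmx_entry n (M : 'M[R]_n) c i j : psdmx M ->
  (forall x, bf M x x <= c * sqn x) -> `|M i j| <= c.
Proof.
move=> [sM pM] Mc.
have /= := pM (delta_mx i 0 + delta_mx j 0).
have /= := pM (delta_mx i 0 - delta_mx j 0).
rewrite -!/(bf M _ _) !bfDl !bfDr !bfNl !bfNr !bf_delta.
have := Mc (delta_mx i 0); have := Mc (delta_mx j 0).
have -> : M j i = M i j by rewrite -{1}sM mxE.
rewrite !bf_delta !sqn_delta => h1 h2 h3 h4.
by rewrite ler_norml; apply/andP; split; lra.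
Qed.

(** A vector [u] in the kernel satisfies [0 = u^T M u >= xi |u|^2]. *)
Lemma pd_unitmx n (M : 'M[R]_n) xi : 0 < xi -> psdmx (M - xi%:M) ->
  M \in unitmx.
Proof.
move=> xi0 Mxi; rewrite -unitmx_tr -row_free_unit -kermx_eq0; apply/eqP.
apply/row_matrixP => i; rewrite row0.
have : row i (kermx M^T) *m M^T = 0 by rewrite -row_mul mulmx_ker row0.
set u := row i _ => uM.
have : sqn u^T <= 0.
  have := psdmx_subs_le u^T Mxi.
  rewrite /bf trmxK -(psdmx_sym Mxi) uM mul0mx mxE.
  by rewrite pmulr_rle0.
move=> u0; have /sqn_eq0 : sqn u^T = 0.
  by apply/eqP; rewrite eq_le u0 sqn_ge0.
by move/(congr1 trmx); rewrite trmxK trmx0.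
Qed.

(** With [z = M^-1 y], coercivity gives [xi |z|^2 <= z^T y]; expanding [|xi z - y|^2 >= 0] takes the
    place of Cauchy-Schwarz. *)
Lemma sqn_invmx n (M : 'M[R]_n) xi y : 0 < xi -> psdmx (M - xi%:M) ->
  sqn (invmx M *m y) <= xi ^- 2 * sqn y.
Proof.
move=> xi0 Mxi; have uM := pd_unitmx xi0 Mxi.
have := psdmx_subs_le (invmx M *m y) Mxi.
rewrite -bf_mulr mulmxV // => h.
have := sqn_ge0 (xi *: (invmx M *m y) - y).
rewrite -bf1 !bfDl !bfDr !bfNl !bfNr !bfZl !bfZr !bf1.
rewrite (bf_sym (invmx M *m y) y (trmx1 _ _)).
rewrite opprK => h2.
rewrite -(@ler_pM2l _ (xi ^+ 2)) ?exprn_gt0 // mulrA mulfV ?mul1r; last first.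
  by rewrite expf_neq0 // gt_eqF.
set a := sqn (invmx M *m y) in h h2 *; set b := bf _ _ _ in h h2.
have h3 : xi * (xi * a) <= xi * b by rewrite ler_pM2l.
rewrite expr2 -mulrA; lra.
Qed.

Lemma invmx_entry n (M : 'M[R]_n) xi i j : 0 < xi -> psdmx (M - xi%:M) ->
  `|invmx M i j| <= xi^-1.
Proof.
move=> xi0 Mxi; have := sqn_invmx (delta_mx j 0) xi0 Mxi.
rewrite sqn_delta mulr1 => /(le_trans (entry_sqn _ i)).
rewrite -colE mxE -exprVn -real_normK ?num_real //.
by rewrite ler_sqr // ?nnegrE ?invr_ge0 ?ltW.
Qed.

Lemma invmxN n (M : 'M[R]_n) : M \in unitmx -> invmx (- M) = - invmx M.
Proof.
move=> uM; rewrite -[- M]scaleN1r -[- invmx M]scaleN1r invmxZ;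
  first by rewrite invrN invr1.
rewrite unitmxZ //; exact: unitrN1.
Qed.

(** The constant bounds the squared Frobenius norm; [(sum |x_j|)^2 <= m |x|^2] is obtained from
    [pairs]. *)
Lemma sqn_mulmx_le n m (M : 'M[R]_(n, m)) c x : 0 <= c ->
  (forall i j, `|M i j| <= c) -> sqn (M *m x) <= (n%:R * m%:R * c ^+ 2) * sqn x.
Proof.
move=> c0 Mc.
have -> : n%:R * m%:R * c ^+ 2 * sqn x = (c ^+ 2 * (m%:R * sqn x)) *+ n.
  by rewrite -[RHS]mulr_natl; ring.
rewrite -[X in _ *+ X](card_ord n) -sumr_const.
apply: ler_sum => i _; rewrite mxE.
have : `|\sum_j M i j * x j 0| <= \sum_j c * `|x j 0|.
  apply: le_trans (ler_norm_sum _ _ _) _; apply: ler_sum => j _.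
  by rewrite normrM ler_wpM2r.
rewrite -mulr_sumr => h.
rewrite -real_normK ?num_real //.
apply: (@le_trans _ _ ((c * \sum_j `|x j 0|) ^+ 2)).
  by rewrite ler_sqr // nnegrE mulr_ge0 // sumr_ge0.
rewrite exprMn ler_wpM2l ?sqr_ge0 //.
have /eqP <- : \sum_j `|x j 0| ^+ 2 == sqn x.
  by apply/eqP/eq_bigr => j _; rewrite real_normK ?num_real.
have pairs (a b : 'I_m) : `|x a 0| * `|x b 0| <= (`|x a 0| ^+ 2 + `|x b 0| ^+ 2) / 2.
  have := sqr_ge0 (`|x a 0| - `|x b 0|); rewrite sqrrB; lra.
rewrite expr2 big_distrlr /=.
apply: (@le_trans _ _ (\sum_a \sum_b (`|x a 0| ^+ 2 + `|x b 0| ^+ 2) / 2)).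
  by apply: ler_sum => a _; apply: ler_sum => b _.
have inner a : \sum_b (`|x a 0| ^+ 2 + `|x b 0| ^+ 2) / 2 =
    (m%:R * `|x a 0| ^+ 2 + \sum_b `|x b 0| ^+ 2) / 2.
  by rewrite -mulr_suml big_split /= sumr_const card_ord mulr_natl.
rewrite (eq_bigr _ (fun a _ => inner a)) -mulr_suml big_split /=.
rewrite -mulr_sumr sumr_const card_ord -mulr_natl; lra.
Qed.

Lemma sqnD_le n (x y : 'cV[R]_n) : sqn (x + y) <= 2 * sqn x + 2 * sqn y.
Proof.
have := young x y (psdmx1 n) ltr01; rewrite !bf1 invr1; lra.
Qed.

(** Expanding [|x - M x|^2 >= 0] bounds [2 x^T M x] by [|x|^2 + |M x|^2]. *)
Lemma bf_le n (M : 'M[R]_n) c x : 0 <= c ->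
  (forall i j, `|M i j| <= c) -> bf M x x <= ((n%:R * n%:R * c ^+ 2 + 1) / 2) * sqn x.
Proof.
move=> c0 Mc; have h1 := sqn_mulmx_le x c0 Mc.
have -> : bf M x x = bf 1%:M x (M *m x) by rewrite -bf_mulr mul1mx.
have := sqn_ge0 (x - M *m x).
rewrite -bf1 !bfDl !bfDr !bfNl !bfNr !bf1.
rewrite (bf_sym x (M *m x) (trmx1 _ _)).
move: h1; set s := n%:R * _ * _; lra.
Qed.

(** * Completing the square *)

Section Square.
Context (n r : nat) (E Q : 'M[R]_n) (A : 'M[R]_n) (B : 'M[R]_(n, r)).
Context (D : 'M[R]_r) (gamma : R).
Let S := gamma%:M - B^T *m E *m B - D^T *m D.
Let L := A^T *m E *m B.

Lemma bf_Psi3 v :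
  bf S v v = gamma * sqn v - bf E (B *m v) (B *m v) - sqn (D *m v).
Proof. by rewrite !bf_subm bf_scalar bf_mulm bf_gram. Qed.

Lemma complete_square x v : E^T = E -> S \in unitmx ->
  bf E (A *m x + B *m v) (A *m x + B *m v) + bf Q x x + sqn (D *m v)
    - gamma * sqn v
  = bf (A^T *m E *m A + Q + L *m invmx S *m L^T) x x
    - bf S (v - invmx S *m L^T *m x) (v - invmx S *m L^T *m x).
Proof.
move=> sE uS.
have sS : S^T = S.
  by rewrite /S !linearB /= tr_scalar_mx !trmx_mul !trmxK sE mulmxA.
have hS := bf_Psi3; have hL u w : bf L u w = bf E (A *m u) (B *m w).
  exact: bf_mulm.
move: uS sS hS hL; move: S L => S' L' uS sS hS hL.
rewrite -(mulmxA (invmx S') _ x); set y := L'^T *m x.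
(* The maximizer is [S^-1 y] with [y = L^T x]; applying [S] to it returns [y], so every term
   containing it reduces to the form of [L]. *)
have Sy u : bf S' u (invmx S' *m y) = bf L' x u.
  by rewrite -bf_mulr mulmxV // /y -bf_mulr mul1mx bf_tr.
rewrite !bf_addm bf_mulm -(mulmxA L') bf_mulr -mulmxA -/y.
rewrite !bfDl !bfDr !bfNl !bfNr (bf_sym v _ sS) !Sy hS !hL.
rewrite (bf_sym (A *m x) _ sE).
lra.
Qed.

End Square.

End BilinearForms.

(** * Densities and conditional expectations *)

Section DensityTransfer.
Context {R : realType}.
Context {d : measure_display} {T : measurableType d}.

Import HBNNSimple.

(** For a simple [h], the integral depends only on the [f]-masses of the level sets of [h \o Y], and
    these are the quantities on which the two sides of a transfer are assumed to agree. *)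
Lemma weighted_integral_nnsfun d1 (S : measurableType d1)
  (P : {measure set S -> \bar R}) (Y : S -> T) (f : S -> R)
  (h : {nnsfun T >-> R}) :
  measurable_fun setT Y -> measurable_fun setT f -> (forall x, 0 <= f x) ->
  (\int[P]_x (h (Y x) * f x)%:E =
   \sum_(c \in range h) c%:E * \int[P]_(x in Y @^-1` (h @^-1` [set c])) (f x)%:E)%E.
Proof.
move=> mY mf f0.
have mpre c : measurable (Y @^-1` (h @^-1` [set c])).
  by rewrite -[X in measurable X]setTI; apply: mY => //; exact: measurable_sfunP.
under eq_integral => x _.
  rewrite fimfunE (mulrC _ (f x)) EFinM -fsumEFin // ge0_mule_fsumr; last first.
    by move=> c; exact: nnfun_muleindic_ge0.
  over.
rewrite ge0_integral_fsum //; last 2 first.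
- move=> c; apply: emeasurable_funM; first exact/measurable_EFinP.
  apply/measurable_EFinP; apply: measurable_funM => //.
  apply: (measurableT_comp _ mY); apply: measurable_indic; exact: measurable_sfunP.
- move=> c x _; apply: mule_ge0; first by rewrite lee_fin.
  exact: nnfun_muleindic_ge0.
apply: eq_fsbigr => c; rewrite inE => -[t _ <-].
rewrite [in RHS]integral_mkcond -ge0_integralZl //; last 3 first.
- by apply/(measurable_restrictT _ _).1 => //;
  apply: measurable_funS measurableT _ _ => //; exact/measurable_EFinP.
- by move=> x _; rewrite patchE; case: ifP => // _; rewrite lee_fin.
- by rewrite lee_fin.
apply: eq_integral => x _; rewrite patchE indicE.
have -> : (x \in Y @^-1` (h @^-1` [set h t])) = (Y x \in h @^-1` [set h t]).
  by apply/idP/idP; rewrite !inE.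
by case: ifP => _; rewrite /= -!EFinM ?mulr1 ?mulr0 ?mule0 // mulrC.
Qed.

(* The common shape of all uses of a density or of a conditional probability. *)
Lemma weighted_integral_transfer d1 (S1 : measurableType d1)
  d2 (S2 : measurableType d2) (P1 : {measure set S1 -> \bar R})
  (P2 : {measure set S2 -> \bar R}) (Y1 : S1 -> T) (Y2 : S2 -> T)
  (f1 : S1 -> R) (f2 : S2 -> R) (h : T -> R) :
  measurable_fun setT Y1 -> measurable_fun setT f1 -> (forall x, 0 <= f1 x) ->
  measurable_fun setT Y2 -> measurable_fun setT f2 -> (forall x, 0 <= f2 x) ->
  measurable_fun setT h -> (forall x, 0 <= h x) ->
  (forall L, measurable L -> (\int[P1]_(x in Y1 @^-1` L) (f1 x)%:E =
                              \int[P2]_(x in Y2 @^-1` L) (f2 x)%:E)%E) ->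
  (\int[P1]_x (h (Y1 x) * f1 x)%:E = \int[P2]_x (h (Y2 x) * f2 x)%:E)%E.
Proof.
move=> mY1 mf1 f10 mY2 mf2 f20 mh h0 E.
have meh : measurable_fun setT (EFin \o h) by exact/measurable_EFinP.
pose hn := nnsfun_approx measurableT meh.
have lim d0 (S : measurableType d0) (P : {measure set S -> \bar R})
    (Y : S -> T) (f : S -> R) :
    measurable_fun setT Y -> measurable_fun setT f -> (forall x, 0 <= f x) ->
    (\int[P]_x (hn n (Y x) * f x)%:E @[n --> \oo] -->
     \int[P]_x (h (Y x) * f x)%:E)%E.
  move=> mY mf f0.
  have -> : (\int[P]_x (h (Y x) * f x)%:E =
             \int[P]_x limn (fun n => (hn n (Y x) * f x)%:E))%E.
    apply: eq_integral => x _; apply/esym/cvg_lim => //.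
    rewrite EFinM; under eq_fun do rewrite EFinM.
    apply: cvgeZr => //.
    have := @cvg_nnsfun_approx _ _ _ _ measurableT _ meh _ (Y x) I.
    by apply=> t _; rewrite lee_fin.
  apply: cvg_monotone_convergence => //.
  - move=> n; apply/measurable_EFinP; apply: measurable_funM => //.
    exact: (measurableT_comp _ mY).
  - by move=> n x _; rewrite lee_fin mulr_ge0.
  - move=> x _ m n mn; rewrite lee_fin ler_wpM2r //.
    exact/lefP/nd_nnsfun_approx.
apply: (cvg_unique _ (lim _ _ P1 _ _ mY1 mf1 f10)) => //.
apply: cvg_trans (lim _ _ P2 _ _ mY2 mf2 f20).
apply: near_eq_cvg; apply: nearW => n /=.
rewrite !weighted_integral_nnsfun //.
apply: eq_fsbigr => c _; rewrite E //.
Qed.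

End DensityTransfer.

(** * Real-valued integrals under almost everywhere bounds *)

Section RealIntegrals.
Context {R : realType} {d : measure_display} {T : measurableType d}.
Variable mu : {measure set T -> \bar R}.
Implicit Types f g : T -> R.

Lemma integrable_ae_le f g : measurable_fun setT f ->
  {ae mu, forall x, `|f x| <= `|g x|} ->
  mu.-integrable setT (EFin \o g) -> mu.-integrable setT (EFin \o f).
Proof.
move=> mf fg /integrableP[mg gfin]; apply/integrableP; split.
  exact/measurable_EFinP.
apply: le_lt_trans gfin; apply: ae_ge0_le_integral => //.
- by apply: measurableT_comp => //; exact/measurable_EFinP.
- by apply: measurableT_comp.
- by apply: filterS fg => x; rewrite /= lee_fin.
Qed.

Lemma integrable_mul_bounded f g c : measurable_fun setT g ->
  {ae mu, forall x, `|g x| <= c} ->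
  mu.-integrable setT (EFin \o f) ->
  mu.-integrable setT (EFin \o (fun x => f x * g x)).
Proof.
move=> mg gc fi; have mf : measurable_fun setT f.
  by apply/measurable_EFinP; exact: measurable_int fi.
apply: (@integrable_ae_le _ (fun x => c * f x)).
- exact: measurable_funM.
- apply: filterS gc => x gc; rewrite !normrM mulrC ler_wpM2r //.
  by apply: le_trans gc _; exact: ler_norm.
- have := integrableZl measurableT c fi; apply: eq_integrable => // x _ /=.
Qed.

Lemma integrable_addr f g : mu.-integrable setT (EFin \o f) ->
  mu.-integrable setT (EFin \o g) ->
  mu.-integrable setT (EFin \o (fun x => f x + g x)).
Proof.
by move=> fi gi; have := integrableD measurableT fi gi; exact: eq_integrable.
Qed.

Lemma integrable_scaler f c : mu.-integrable setT (EFin \o f) ->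
  mu.-integrable setT (EFin \o (fun x => c * f x)).
Proof.
by move=> fi; have := integrableZl measurableT c fi; exact: eq_integrable.
Qed.

Lemma integrable_sumr (I : Type) (s : seq I) (F : I -> T -> R) :
  (forall i, mu.-integrable setT (EFin \o F i)) ->
  mu.-integrable setT (EFin \o (fun x => \sum_(i <- s) F i x)).
Proof.
move=> Fi; have := @integrable_sum _ _ _ mu setT measurableT I s xpredT
  (fun i => EFin \o F i) (fun i _ => Fi i).
by apply: eq_integrable => // x _ /=; rewrite sumEFin.
Qed.

Lemma Rintegral_sum (I : Type) (s : seq I) (F : I -> T -> R) :
  (forall i, mu.-integrable setT (EFin \o F i)) ->
  \int[mu]_x (\sum_(i <- s) F i x) = \sum_(i <- s) \int[mu]_x F i x.
Proof.
move=> Fi; elim: s => [|i s IH].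
  under eq_Rintegral do rewrite big_nil.
  by rewrite big_nil Rintegral_cst // mul0r.
under eq_Rintegral do rewrite big_cons.
by rewrite big_cons -IH RintegralD //; exact: integrable_sumr.
Qed.

Lemma ae_eq_Rintegral f g : measurable_fun setT f -> measurable_fun setT g ->
  {ae mu, forall x, f x = g x} -> \int[mu]_x f x = \int[mu]_x g x.
Proof.
move=> mf mg fg; congr fine; apply: ae_eq_integral => //.
- exact/measurable_EFinP.
- exact/measurable_EFinP.
- by apply: filterS fg => x fg _; rewrite fg.
Qed.

Lemma Rintegral_ae_ge0 f : measurable_fun setT f ->
  {ae mu, forall x, 0 <= f x} -> 0 <= \int[mu]_x f x.
Proof.
move=> mf f0; rewrite (@ae_eq_Rintegral _ (fun x => `|f x|)) //.
- by apply: Rintegral_ge0.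
- exact: measurableT_comp.
- by apply: filterS f0 => x /ger0_norm.
Qed.

Lemma le_ae_Rintegral f g : mu.-integrable setT (EFin \o f) ->
  mu.-integrable setT (EFin \o g) ->
  {ae mu, forall x, f x <= g x} -> \int[mu]_x f x <= \int[mu]_x g x.
Proof.
move=> fi gi fg; rewrite -subr_ge0 -RintegralB //; apply: Rintegral_ae_ge0.
  by apply: measurable_funB; apply/measurable_EFinP;
    [exact: measurable_int gi|exact: measurable_int fi].
by apply: filterS fg => x; rewrite subr_ge0.
Qed.

Lemma integrable_sqr_mul f g :
  measurable_fun setT f -> measurable_fun setT g ->
  mu.-integrable setT (EFin \o (fun x => f x ^+ 2)) ->
  mu.-integrable setT (EFin \o (fun x => g x ^+ 2)) ->
  mu.-integrable setT (EFin \o (fun x => f x * g x)).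
Proof.
move=> mf mg fi gi.
apply: (@integrable_ae_le _ (fun x => f x ^+ 2 + g x ^+ 2)).
- exact: measurable_funM.
- apply: nearW => x; rewrite [leRHS]ger0_norm ?addr_ge0 ?sqr_ge0 // normrM.
  have := sqr_ge0 (`|f x| - `|g x|).
  rewrite sqrrB !real_normK ?num_real //.
  have := sqr_ge0 (f x); have := sqr_ge0 (g x); lra.
- exact: integrable_addr.
Qed.

Lemma integrable_sqr_add f g :
  measurable_fun setT f -> measurable_fun setT g ->
  mu.-integrable setT (EFin \o (fun x => f x ^+ 2)) ->
  mu.-integrable setT (EFin \o (fun x => g x ^+ 2)) ->
  mu.-integrable setT (EFin \o (fun x => (f x + g x) ^+ 2)).
Proof.
move=> mf mg fi gi.
have := integrable_addr (integrable_addr fi gi)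
  (integrable_scaler 2 (integrable_sqr_mul mf mg fi gi)).
by apply: eq_integrable => // x _ /=; congr EFin; ring.
Qed.

Lemma integrable_sqr_mul_bounded f g c :
  measurable_fun setT f -> measurable_fun setT g ->
  {ae mu, forall x, `|g x| <= c} ->
  mu.-integrable setT (EFin \o (fun x => f x ^+ 2)) ->
  mu.-integrable setT (EFin \o (fun x => (g x * f x) ^+ 2)).
Proof.
move=> mf mg gc fi.
have : mu.-integrable setT (EFin \o (fun x => f x ^+ 2 * g x ^+ 2)).
  apply: (@integrable_mul_bounded _ _ (c ^+ 2)) => //.
    exact: measurable_funX.
  apply: filterS gc => x gc; rewrite normrX ler_sqr ?nnegrE //.
  exact: le_trans gc.
by apply: eq_integrable => // x _ /=; rewrite exprMn mulrC.
Qed.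

End RealIntegrals.

Section FiniteIntegrals.
Context {R : realType} {d : measure_display} {T : measurableType d}.
Variable mu : {measure set T -> \bar R}.
Hypothesis mu_fin : (mu setT < +oo)%E.

Lemma integrable_ae_bounded (f : T -> R) c : measurable_fun setT f ->
  {ae mu, forall x, `|f x| <= c} -> mu.-integrable setT (EFin \o f).
Proof.
move=> mf fc; apply: (@integrable_ae_le _ _ _ _ _ (cst c)) => //.
  apply: filterS fc => x fc /=; apply: le_trans fc _; exact: ler_norm.
apply: measurable_bounded_integrable => //; exact: bounded_cst.
Qed.

End FiniteIntegrals.

Section SignedTransfer.
Context {R : realType}.
Context {d : measure_display} {T : measurableType d}.
Context {d1 : measure_display} {S1 : measurableType d1}.
Context {d2 : measure_display} {S2 : measurableType d2}.
Variables (P1 : {measure set S1 -> \bar R}) (P2 : {measure set S2 -> \bar R}).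
Variables (Y1 : S1 -> T) (Y2 : S2 -> T) (f1 : S1 -> R) (f2 : S2 -> R).
Hypothesis mY1 : measurable_fun setT Y1.
Hypothesis mf1 : measurable_fun setT f1.
Hypothesis f10 : forall x, 0 <= f1 x.
Hypothesis mY2 : measurable_fun setT Y2.
Hypothesis mf2 : measurable_fun setT f2.
Hypothesis f20 : forall x, 0 <= f2 x.
Hypothesis E : forall L, measurable L ->
  (\int[P1]_(x in Y1 @^-1` L) (f1 x)%:E = \int[P2]_(x in Y2 @^-1` L) (f2 x)%:E)%E.

(** For a nonnegative weight [f], the positive and negative parts of [h f] are those of [h] times
    [f], so the two sides agree part by part as extended reals. *)
Lemma signed_integral_transfer (h : T -> R) : measurable_fun setT h ->
  (\int[P1]_x (h (Y1 x) * f1 x)%:E = \int[P2]_x (h (Y2 x) * f2 x)%:E)%E.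
Proof.
move=> mh; rewrite [LHS]integralE [RHS]integralE.
have pos (S : Type) (Y : S -> T) (f : S -> R) : (forall x, 0 <= f x) ->
    ((fun x => (h (Y x) * f x)%:E)^\+ = (fun x => ((h^\+)%R (Y x) * f x)%:E))%E.
  move=> f0; apply/funext => x.
  by rewrite funepos.unlock /funrpos -EFin_max maxr_pMl // mul0r.
have neg (S : Type) (Y : S -> T) (f : S -> R) : (forall x, 0 <= f x) ->
    ((fun x => (h (Y x) * f x)%:E)^\- = (fun x => ((h^\-)%R (Y x) * f x)%:E))%E.
  move=> f0; apply/funext => x.
  by rewrite funeneg.unlock /funrneg -EFinN -EFin_max maxr_pMl // mul0r mulNr.
rewrite !pos // !neg //.
congr (_ - _)%E; apply: weighted_integral_transfer => //.
- exact: measurable_funrpos.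
- exact: measurable_funrneg.
Qed.

End SignedTransfer.

(** * The Markov property for functions *)

Section MarkovChainIntegrals.
Context {R : realType} {d : measure_display} {T : measurableType d}.
Variables (mu : {sigma_finite_measure set T -> \bar R}) (G : R.-pker T ~> T).
Variable (g : T -> T -> R).
Hypothesis g_measurable : measurable_fun setT (fun p : T * T => g p.1 p.2).
Hypothesis g_ge0 : forall l t, 0 <= g l t.
Hypothesis G_density : forall l L, measurable L ->
  G l L = (\int[mu]_(t in L) (g l t)%:E)%E.

Lemma measurable_density l : measurable_fun setT (g l).
Proof. exact: (measurableT_comp g_measurable (pair1_measurable l)). Qed.

Lemma kernel_eintegral l (p : T -> R) : measurable_fun setT p ->
  (\int[G l]_t (p t)%:E = \int[mu]_t (p t * g l t)%:E)%E.
Proof.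
move=> mp; under eq_integral do rewrite -[p _]mulr1.
apply: (@signed_integral_transfer _ _ _ _ _ _ _ (G l) mu id id (cst 1) (g l)) => //.
  exact: measurable_density.
move=> L mL; rewrite /= preimage_id.
by rewrite integral_cst // mul1e G_density.
Qed.

Lemma kernel_integral l (p : T -> R) : measurable_fun setT p ->
  \int[G l]_t p t = \int[mu]_t (g l t * p t).
Proof.
move=> mp; congr fine; rewrite kernel_eintegral //.
by under eq_integral do rewrite mulrC.
Qed.

(** Absolute continuity of [G l] with respect to [mu], at every [l]. It is the reason why [Eop]
    turns an almost everywhere property of [P] into one valid at every point. *)
Lemma kernel_ae l (Q : T -> Prop) : {ae mu, forall t, Q t} -> {ae G l, forall t, Q t}.
Proof.
move=> [N [mN N0 QN]]; exists N; split => //.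
rewrite G_density //; apply: null_set_integral => //.
apply/measurable_EFinP; apply: measurable_funS (measurable_density l) => //.
Qed.

Lemma measurable_kernel_integral (p : T -> R) : measurable_fun setT p ->
  measurable_fun setT (fun l => \int[G l]_t p t).
Proof.
move=> mp; apply: (measurableT_comp (fine_measurable measurableT)).
under eq_fun do rewrite integralE.
by apply: emeasurable_funB; apply: measurable_fun_integral_kernel => //;
  try (by move=> U; exact: measurable_kernel);
  [exact/measurable_funepos/measurable_EFinP|
    exact/measurable_funeneg/measurable_EFinP].
Qed.

Lemma kernel_fin l : (G l setT < +oo)%E.
Proof. by rewrite prob_kernel ltry. Qed.

Lemma kernel_integral_bound (p : T -> R) c l : measurable_fun setT p ->
  {ae mu, forall t, `|p t| <= c} -> `|\int[G l]_t p t| <= c.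
Proof.
move=> mp /(kernel_ae l) pc.
have pi : (G l).-integrable setT (EFin \o p).
  apply: (integrable_ae_bounded _ mp pc); exact: kernel_fin.
apply: le_trans (le_normr_Rintegral measurableT pi) _.
have -> : c = \int[G l]_t c.
  by rewrite Rintegral_cst // prob_kernel /= mulr1.
apply: le_ae_Rintegral => //;
  last by apply: (@integrable_ae_bounded _ _ _ _ _ _ `|c|) => //;
    [exact: kernel_fin|exact: nearW].
have := integrable_abse pi; exact: eq_integrable.
Qed.

Context {d' : measure_display} {Omega : measurableType d'}.
Variable M : markov_chain mu G Omega.
Variable nu : T -> R.
Hypothesis nuP : initial_density mu nu.
Let P := law M nu.
Let th := chain M.

(** The law of [th k] is absolutely continuous with respect to [mu]: by the initial density at time
    0, by the transition density later. *)
Lemma chain_ae k (Q : T -> Prop) : {ae mu, forall t, Q t} ->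
  {ae P, forall w, Q (th k w)}.
Proof.
move=> [N [mN N0 QN]]; exists (th k @^-1` N); split.
- by rewrite -[X in measurable X]setTI; exact: chain_measurable.
- case: k => [|k].
    rewrite /P /th chain_init //; apply: null_set_integral => //.
    apply/measurable_EFinP; apply: measurable_funS measurableT _ _ => //.
    by case: nuP.
  rewrite -[X in P X]setTI /P /th (chain_step nuP) //; last by rewrite -setC0;
    apply: sigma_algebraC; exact: sigma_algebra0.
  apply: integral0_eq => w _; rewrite G_density //.
  apply: null_set_integral => //; apply/measurable_EFinP.
  exact: measurable_funS (measurable_density _).
- by move=> w Qw; apply: QN.
Qed.

Lemma chain0_integral (p : T -> R) : measurable_fun setT p ->
  \int[P]_w p (th 0%N w) = \int[mu]_t (p t * nu t).
Proof.
move=> mp; have [mnu nu0 nu1] := nuP.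
(* [nu] is positive only almost everywhere, while a transfer weight has to be nonnegative
   everywhere: hence the truncation at 0. *)
transitivity (\int[mu]_t (p t * Num.max (nu t) 0)); last first.
  apply: ae_eq_Rintegral.
  - by apply: measurable_funM => //; exact: measurable_maxr.
  - exact: measurable_funM.
  - by apply: filterS nu0 => x /ltW nu0; rewrite (max_idPl _).
congr fine.
under eq_integral do rewrite -[p _]mulr1.
apply: (@signed_integral_transfer _ _ _ _ _ _ _ P mu (th 0%N) id (cst 1)
   (fun t => Num.max (nu t) 0)) => //.
- exact: chain_measurable.
- exact: measurable_maxr.
- by move=> x; rewrite le_max lexx orbT.
move=> L mL; rewrite /= preimage_id.
rewrite integral_cst; last first.
  by rewrite -[X in measurable X]setTI; exact: chain_measurable.
rewrite mul1e; etransitivity; first exact: (chain_init M nuP mL).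
apply: ae_eq_integral => //.
- by apply/measurable_EFinP; apply: measurable_funS measurableT _ _.
- apply/measurable_EFinP; apply: measurable_funS measurableT _ _ => //.
  exact: measurable_maxr.
by apply: filterS nu0 => x /ltW nu0 _; rewrite (max_idPl _).
Qed.

Notation history_type k := (g_sigma_algebraType (history th k)).

Lemma history_sub k (F : set Omega) : history th k F -> d'.-measurable F.
Proof.
apply: smallest_sub => //; first exact: sigma_algebra_measurable.
rewrite -bigcup_mkord_ord => A [i _ [B mB <-]].
by apply: chain_measurable.
Qed.

Lemma measurable_history k (F : set (history_type k)) :
  measurable F -> history th k F.
Proof. by apply: smallest_sub => //; exact: smallest_sigma_algebra. Qed.

Lemma measurable_id_history k :
  measurable_fun setT (id : Omega -> history_type k).
Proof.
move=> _ F hF; rewrite setTI preimage_id.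
by apply: (@history_sub k); exact: measurable_history.
Qed.

Lemma measurable_fun_history k (f : Omega -> R) :
  measurable_fun [set: history_type k] f -> measurable_fun [set: Omega] f.
Proof.
move=> mf _ B mB; apply: (@history_sub k); apply: measurable_history.
exact: mf.
Qed.

Lemma chain_preimage_history k j (B : set T) : (j <= k)%N -> measurable B ->
  history th k (th j @^-1` B).
Proof.
move=> jk mB; apply: sub_sigma_algebra; rewrite -bigcup_mkord_ord.
exists j; first by rewrite /= ltnS.
by exists B => //; rewrite setTI inordK ?ltnS.
Qed.

Lemma measurable_chain_history k :
  measurable_fun [set: history_type k] (th k : history_type k -> T).
Proof.
move=> _ B mB; rewrite setTI; apply: sub_sigma_algebra.
exact: chain_preimage_history.
Qed.

Lemma history_subS k : history th k `<=` history th k.+1.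
Proof.
apply: smallest_sub; first exact: smallest_sigma_algebra.
rewrite -bigcup_mkord_ord => A [i ik [B mB <-]].
rewrite setTI inordK //.
by apply: chain_preimage_history => //; exact: leqW.
Qed.

Lemma measurable_historyS k (f : Omega -> R) :
  measurable_fun [set: history_type k] f ->
  measurable_fun [set: history_type k.+1] f.
Proof.
move=> mf _ B mB; apply: sub_sigma_algebra; apply: history_subS.
by apply: measurable_history; exact: mf.
Qed.

Lemma measurable_chain_density k :
  measurable_fun setT (fun z : Omega * T => g (th k z.1) z.2).
Proof.
apply: (measurableT_comp g_measurable (g := fun z => (th k z.1, z.2))).
apply: measurable_fun_pair; last exact: measurable_snd.
exact: (measurableT_comp (chain_measurable M k) measurable_fst).
Qed.

(* By Tonelli; on the product space the transition density is a real-valued weight,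
   as [weighted_integral_transfer] requires. *)
Lemma history_setI_step k (F : set Omega) (h : T -> R) : d'.-measurable F ->
  measurable_fun setT h -> (forall t, 0 <= h t) ->
  (\int[(P \x mu)]_z (h z.2 * (\1_F z.1 * g (th k z.1) z.2))%:E =
   \int[P]_w ((\1_F w)%:E * \int[G (th k w)]_t (h t)%:E))%E.
Proof.
move=> mF mh h0.
have mthg := measurable_chain_density k.
have m1F : measurable_fun setT (fun z : Omega * T => \1_F z.1 : R).
  by apply: (measurableT_comp (measurable_indic mF)).
etransitivity; first apply: (@fubini_tonelli1 _ _ _ _ _ P mu
  (fun z => (h z.2 * (\1_F z.1 * g (th k z.1) z.2))%:E)).
- apply/measurable_EFinP; apply: measurable_funM; last exact: measurable_funM.
  exact: (measurableT_comp mh).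
- by move=> z; rewrite lee_fin !mulr_ge0.
apply: eq_integral => w _; rewrite /fubini_F /= kernel_eintegral //.
rewrite -ge0_integralZl //.
- by apply: eq_integral => t _; rewrite -EFinM; congr EFin; ring.
- apply/measurable_EFinP; apply: measurable_funM => //; exact: measurable_density.
- by move=> t _; rewrite lee_fin mulr_ge0.
Qed.

(** [chain_step] is the case of an indicator [p]; the transfer between the sample space and the
    product [P \x mu] extends it to nonnegative [p]. *)
Lemma history_step_ge0 k (F : set Omega) (p : T -> R) : history th k F ->
  measurable_fun setT p -> (forall t, 0 <= p t) ->
  (\int[P]_w (p (th k.+1 w) * \1_F w)%:E =
   \int[P]_w ((\1_F w)%:E * \int[G (th k w)]_t (p t)%:E))%E.
Proof.
move=> hF mp p0; have mF := history_sub hF.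
rewrite -history_setI_step //.
apply: (@weighted_integral_transfer _ _ T _ _ _ _ P (P \x mu)%E (th k.+1) snd
  \1_F (fun z => \1_F z.1 * g (th k z.1) z.2)) => //.
- exact: chain_measurable.
- apply: measurable_funM; last exact: measurable_chain_density.
  exact: (measurableT_comp (measurable_indic mF)).
- by move=> z; rewrite mulr_ge0.
move=> L mL.
have mL1 : d'.-measurable (th k.+1 @^-1` L).
  by rewrite -[X in measurable X]setTI; exact: chain_measurable.
rewrite integral_indic //.
etransitivity; first exact: (chain_step nuP mL hF).
rewrite [RHS]integral_mkcond.
transitivity (\int[(P \x mu)]_z (\1_L z.2 * (\1_F z.1 * g (th k z.1) z.2))%:E)%E.
  rewrite (@history_setI_step k F \1_L mF (measurable_indic mL));
    last by move=> t; rewrite indicE.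
  rewrite integral_mkcond; apply: eq_integral => w _.
  rewrite integral_indic // setIT patchE indicE.
  by case: ifP => _; rewrite ?mul1e ?mul0e.
apply: eq_integral => z _; rewrite patchE indicE.
have -> : (z \in snd @^-1` L) = (z.2 \in L) by apply/idP/idP; rewrite !inE.
by case: ifP => _; rewrite ?mul1r ?mul0r.
Qed.

(* [E(x p(th (k+1))) = E(x (G p)(th k))] for [x] measurable at time [k]; adding a
   constant to [p] reduces the weights to nonnegative ones. *)
Lemma history_step_bounded k (p : T -> R) (x : Omega -> R) c :
  measurable_fun setT p -> (forall t, `|p t| <= c) ->
  measurable_fun [set: history_type k] x -> P.-integrable setT (EFin \o x) ->
  \int[P]_w (x w * p (th k.+1 w)) = \int[P]_w (x w * \int[G (th k w)]_t p t).
Proof.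
move=> mp pc mx ix.
have Gi l : (G l).-integrable setT (EFin \o p).
  apply: (integrable_ae_bounded _ mp (nearW _ pc)); exact: kernel_fin.
have mG := measurable_kernel_integral mp.
have mGth : measurable_fun setT (fun w => \int[G (th k w)]_t p t).
  exact: (measurableT_comp mG (chain_measurable M k)).
have mpth : measurable_fun setT (fun w => p (th k.+1 w)).
  exact: (measurableT_comp mp (chain_measurable M k.+1)).
have Gc l : \int[G l]_t (p t + c) = \int[G l]_t p t + c.
  rewrite RintegralD //; last first.
    by apply: (@integrable_ae_bounded _ _ _ _ _ _ `|c|) => //;
      [exact: kernel_fin|exact: nearW].
  by rewrite Rintegral_cst // prob_kernel mulr1.
have pc0 t : 0 <= p t + c by have := pc t; rewrite ler_norml; lra.
have key : \int[P]_w (x w * (p (th k.+1 w) + c)) =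
           \int[P]_w (x w * (\int[G (th k w)]_t p t + c)).
  congr fine.
  (* The transfer goes along [id] into the coarser sigma-algebra of the history, so that agreement
     on history events extends to every [x] measurable at time [k]. *)
  apply: (@signed_integral_transfer _ _ (history_type k) _ _ _ _ P P id id
    (fun w => p (th k.+1 w) + c) (fun w => \int[G (th k w)]_t p t + c)) => //.
  - exact: measurable_id_history.
  - exact: measurable_funD.
  - exact: measurable_id_history.
  - exact: measurable_funD.
  - by move=> w; rewrite -Gc; apply: Rintegral_ge0.
  move=> F hF; rewrite /= preimage_id.
  have {}hF := measurable_history hF.
  have E := @history_step_ge0 k F (fun t => p t + c) hF
    (measurable_funD mp (measurable_cst _)) pc0.
  rewrite integral_mkcond [in RHS]integral_mkcond.
  transitivity (\int[P]_w ((p (th k.+1 w) + c) * \1_F w)%:E)%E.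
    apply: eq_integral => w _; rewrite patchE indicE.
    by case: ifP => _; rewrite ?mulr1 ?mulr0.
  rewrite E; apply: eq_integral => w _; rewrite patchE indicE.
  case: ifP => _; rewrite ?mul1e ?mul0e // -Gc /Rintegral fineK //.
  apply: integrable_fin_num => //; apply: integrable_addr => //.
  by apply: (@integrable_ae_bounded _ _ _ _ _ _ `|c|) => //;
    [exact: kernel_fin|exact: nearW].
have mx' : measurable_fun setT x by apply/measurable_EFinP; exact: measurable_int ix.
have icx := integrable_scaler c ix.
have ip : P.-integrable setT (EFin \o (fun w => x w * p (th k.+1 w))).
  by apply: (integrable_mul_bounded mpth _ ix (c := c)); exact: nearW.
have iG : P.-integrable setT (EFin \o (fun w => x w * \int[G (th k w)]_t p t)).
  apply: (integrable_mul_bounded mGth _ ix (c := c)); apply: nearW => w.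
  by apply: kernel_integral_bound => //; exact: nearW.
move: key; under eq_Rintegral do rewrite mulrDr (mulrC _ c).
under [in RHS]eq_Rintegral do rewrite mulrDr (mulrC _ c).
by rewrite !RintegralD // => /addIr.
Qed.

Lemma history_step k (p : T -> R) (x : Omega -> R) c :
  measurable_fun setT p -> {ae mu, forall t, `|p t| <= c} ->
  measurable_fun [set: history_type k] x -> P.-integrable setT (EFin \o x) ->
  \int[P]_w (x w * p (th k.+1 w)) = \int[P]_w (x w * \int[G (th k w)]_t p t).
Proof.
move=> mp pc mx ix.
(* [p] is only essentially bounded, so it is truncated; [chain_ae] and [kernel_ae] show that neither
   side changes. *)
pose q t := Num.max (- `|c|) (Num.min `|c| (p t)).
have mq : measurable_fun setT q.
  by apply: measurable_maxr => //; exact: measurable_minr.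
have qc t : `|q t| <= `|c|.
  rewrite ler_norml /q le_max lexx /= ge_max ge_min lexx /=.
  by rewrite andbT (@le_trans _ _ 0) // oppr_le0.
have pq : {ae mu, forall t, p t = q t}.
  apply: filterS pc => t pc; rewrite /q.
  have := le_trans pc (ler_norm c); rewrite ler_norml => /andP[h1 h2].
  by rewrite (min_idPr h2) (max_idPr h1).
have mx' : measurable_fun setT x by apply/measurable_EFinP; exact: measurable_int ix.
transitivity (\int[P]_w (x w * q (th k.+1 w))).
  apply: ae_eq_Rintegral.
  - by apply: measurable_funM => //;
    exact: (measurableT_comp mp (chain_measurable M _)).
  - by apply: measurable_funM => //;
    exact: (measurableT_comp mq (chain_measurable M _)).
  - by have := chain_ae k.+1 pq; apply: filterS => w ->.
rewrite (history_step_bounded mq qc mx ix).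
apply: eq_Rintegral => w _; congr (_ * _).
by apply: ae_eq_Rintegral => //; apply: kernel_ae; apply: filterS pq => t ->.
Qed.

End MarkovChainIntegrals.

(** * Essentially bounded matrix functions *)

Section EssentiallyBounded.
Context {R : realType} {d : measure_display} {T : measurableType d}.
Variable mu : {measure set T -> \bar R}.

(** An entrywise form of [Hinf], equivalent by [HinfP]: scalar estimates give its stability under
    matrix algebra and the integrability of each entry. *)
Definition ebmx n m (P : T -> 'M[R]_(n, m)) : Prop :=
  measurable_mx P /\
  exists c, {ae mu, forall l, forall i j, `|P l i j| <= c}.

Lemma ebmx_pos_bound n m (P : T -> 'M[R]_(n, m)) : ebmx P ->
  exists2 c, 0 < c & {ae mu, forall l, forall i j, `|P l i j| <= c}.
Proof.
move=> [_ [c Pc]]; exists (`|c| + 1); first by rewrite ltr_wpDl.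
apply: filterS Pc => l Pc i j; apply: le_trans (Pc i j) _.
by apply: le_trans (ler_norm c) _; rewrite lerDl.
Qed.

Lemma ebmx_entry n m (P : T -> 'M[R]_(n, m)) i j : ebmx P ->
  exists c, {ae mu, forall l, `|P l i j| <= c}.
Proof. by move=> [_ [c Pc]]; exists c; apply: filterS Pc => l. Qed.

Lemma ebmx_cst n m (M : 'M[R]_(n, m)) : ebmx (fun=> M).
Proof.
split=> [i j|]; first exact: measurable_cst.
exists (\sum_i \sum_j `|M i j|); apply: nearW => l i j.
rewrite (bigD1 i) //= (bigD1 j) //= -addrA lerDl addr_ge0 //.
  by apply: sumr_ge0.
by apply: sumr_ge0 => k _; apply: sumr_ge0.
Qed.

Lemma ebmxD n m (P Q : T -> 'M[R]_(n, m)) : ebmx P -> ebmx Q ->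
  ebmx (fun l => P l + Q l).
Proof.
move=> [mP [p Pp]] [mQ [q Qq]]; split=> [i j|].
  by under eq_fun do rewrite mxE; exact: measurable_funD.
exists (p + q); apply: filterS2 Pp Qq => l Pp Qq i j; rewrite mxE.
by apply: le_trans (ler_normD _ _) _; exact: lerD.
Qed.

Lemma ebmxN n m (P : T -> 'M[R]_(n, m)) : ebmx P -> ebmx (fun l => - P l).
Proof.
move=> [mP [p Pp]]; split=> [i j|].
  under eq_fun do rewrite mxE -mulN1r; exact: measurable_funM.
by exists p; apply: filterS Pp => l Pp i j; rewrite mxE normrN.
Qed.

Lemma ebmxB n m (P Q : T -> 'M[R]_(n, m)) : ebmx P -> ebmx Q ->
  ebmx (fun l => P l - Q l).
Proof. by move=> bP bQ; apply: ebmxD => //; exact: ebmxN. Qed.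

Lemma ebmxZ n m (P : T -> 'M[R]_(n, m)) a : ebmx P -> ebmx (fun l => a *: P l).
Proof.
move=> [mP [p Pp]]; split=> [i j|].
  by under eq_fun do rewrite mxE; exact: measurable_funM.
exists (`|a| * p); apply: filterS Pp => l Pp i j; rewrite mxE normrM.
exact: ler_wpM2l.
Qed.

Lemma ebmx_tr n m (P : T -> 'M[R]_(n, m)) : ebmx P -> ebmx (fun l => (P l)^T).
Proof.
move=> [mP [p Pp]]; split=> [i j|]; first by under eq_fun do rewrite mxE; exact: mP.
by exists p; apply: filterS Pp => l Pp i j; rewrite mxE.
Qed.

Lemma ebmxM n m p (P : T -> 'M[R]_(n, m)) (Q : T -> 'M[R]_(m, p)) :
  ebmx P -> ebmx Q -> ebmx (fun l => P l *m Q l).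
Proof.
move=> bP bQ; have [a a0 Pa] := ebmx_pos_bound bP.
have [b b0 Qb] := ebmx_pos_bound bQ; split=> [i j|].
  under eq_fun do rewrite mxE; apply: measurable_sum => k.
  by apply: measurable_funM; [apply bP.1 | apply bQ.1].
exists (\sum_(k < m) a * b); apply: filterS2 Pa Qb => l Pa Qb i j; rewrite mxE.
apply: le_trans (ler_norm_sum _ _ _) _; apply: ler_sum => k _.
by rewrite normrM ler_pM.
Qed.

Lemma measurable_det d' (S : measurableType d') n (P : S -> 'M[R]_n) :
  measurable_mx P -> measurable_fun setT (fun l => \det (P l)).
Proof.
move=> mP; rewrite /determinant; apply: measurable_sum => s.
by apply: measurable_funM => //; apply: measurable_prod => i _.
Qed.

(* [x^-1 = x (x^2)^-1] also holds at the junk value [0^-1 = 0]. *)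
Lemma measurable_invr : measurable_fun [set: R] (fun x : R => x^-1).
Proof.
have -> : (fun x : R => x^-1) = (fun x => x * ((x ^+ 2) `^ (-1))).
  apply/funext => x; have [->|x0] := eqVneq x 0; first by rewrite invr0 mul0r.
  by rewrite powR_inv1 ?sqr_ge0 // expr2 invfM mulrA mulfV // mul1r.
apply: measurable_funM => //.
by apply: (measurableT_comp (measurable_powR (-1))); exact: measurable_funX.
Qed.

Lemma measurable_invmx d' (S : measurableType d') n (P : S -> 'M[R]_n) :
  measurable_mx P -> measurable_mx (fun l => invmx (P l)).
Proof.
move=> mP i j; rewrite /invmx.
(* [invmx] returns its argument on singular matrices, so the formula splits on the vanishing of the
   determinant. *)
have -> : (fun l => (if P l \in unitmx then (\det (P l))^-1 *: \adj (P l)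
             else P l) i j) =
  (fun l => if \det (P l) == 0 then P l i j
            else (\det (P l))^-1 * \adj (P l) i j).
  apply/funext => l; rewrite unitmxE unitfE.
  by case: eqP => //= _; rewrite mxE.
have md := measurable_det mP.
apply: measurable_fun_ifT.
- by apply: measurable_fun_eqr.
- exact: mP.
- apply: measurable_funM; first exact: (measurableT_comp measurable_invr).
  under eq_fun do rewrite mxE /cofactor; apply: measurable_funM => //.
  by apply: measurable_det => a b; under eq_fun do rewrite !mxE; exact: mP.
Qed.

Lemma ebmx_inv n (P : T -> 'M[R]_n) : ebmx P -> ae_unif_pos mu P ->
  ebmx (fun l => invmx (P l)).
Proof.
move=> [mP _] [xi xi0 Pxi]; split; first exact: measurable_invmx.
by exists xi^-1; apply: filterS Pxi => l Pxi i j; exact: invmx_entry.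
Qed.

Lemma enorm_le_entry n (x : 'cV[R]_n) i : `|x i 0| <= enorm x.
Proof.
rewrite -[X in _ <= X]ger0_norm ?sqrtr_ge0 // -ler_sqr ?nnegrE //.
by rewrite !real_normK ?num_real // enorm_sqr entry_sqn.
Qed.

Lemma spectral_norm_has_sup n m (M : 'M[R]_(n, m)) c : 0 <= c ->
  (forall i j, `|M i j| <= c) ->
  forall y, [set enorm (M *m x) | x in [set x : 'cV[R]_m | enorm x <= 1]] y ->
  y <= Num.sqrt (n%:R * m%:R * c ^+ 2).
Proof.
move=> c0 Mc y [x /= x1 <-]; rewrite ler_sqrt; last by rewrite !mulr_ge0.
rewrite -/(sqn _); apply: le_trans (sqn_mulmx_le x c0 Mc) _.
rewrite ler_piMr ?mulr_ge0 // -enorm_sqr expr_le1 ?sqrtr_ge0 //.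
Qed.

Lemma spectral_norm_le n m (M : 'M[R]_(n, m)) c : 0 <= c ->
  (forall i j, `|M i j| <= c) ->
  spectral_norm M <= Num.sqrt (n%:R * m%:R * c ^+ 2).
Proof.
move=> c0 Mc; apply: ge_sup.
  by exists (enorm (M *m 0)); exists 0;
    rewrite //= /enorm -/(sqn _) sqn0 sqrtr0 ler01.
exact: spectral_norm_has_sup.
Qed.

Lemma entry_spectral_norm n m (M : 'M[R]_(n, m)) i j : `|M i j| <= spectral_norm M.
Proof.
have -> : M i j = (M *m (delta_mx j 0 : 'cV[R]_m)) i 0 by rewrite -colE mxE.
apply: le_trans (enorm_le_entry _ _) _; apply: ub_le_sup.
  (* [sup] is meaningful only with an upper bound at hand; the sum of all [|M i j|] dominates each
     entry and so provides one. *)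
  exists (Num.sqrt (n%:R * m%:R * (\sum_i \sum_j `|M i j|) ^+ 2)).
  apply: spectral_norm_has_sup.
    by apply: sumr_ge0 => k _; apply: sumr_ge0.
  move=> i' j'; rewrite (bigD1 i') //= (bigD1 j') //= -addrA lerDl addr_ge0 //.
    by apply: sumr_ge0.
  by apply: sumr_ge0 => k _; apply: sumr_ge0.
by exists (delta_mx j 0 : 'cV[R]_m) => //=; rewrite /enorm -/(sqn _) sqn_delta sqrtr1.
Qed.

Lemma HinfP n m (P : T -> 'M[R]_(n, m)) : Hinf mu P <-> ebmx P.
Proof.
split=> [[mP fin]|bP].
  split=> //.
  have [c Pc] : exists c : R, {ae mu, forall l, spectral_norm (P l) <= c}.
    have := @ess_sup_ge _ _ _ mu (fun l => (spectral_norm (P l))%:E).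
    case: (ess_sup _ _) fin => [c _ h|//|_ h].
      by exists c; apply: filterS h => l; rewrite lee_fin.
    (* An essential supremum equal to [-oo] makes the almost everywhere bound contradictory, so any
       constant serves. *)
    by exists 0; apply: filterS h => l; rewrite leeNy_eq.
  exists c; apply: filterS Pc => l Pc i j.
  exact: le_trans (entry_spectral_norm _ _ _) Pc.
split; first by case: bP.
have [c c0 Pc] := ebmx_pos_bound bP.
apply: (@le_lt_trans _ _ (Num.sqrt (n%:R * m%:R * c ^+ 2))%:E); last exact: ltry.
apply/ess_supP; apply: filterS Pc => l Pc; rewrite lee_fin.
exact: spectral_norm_le (ltW c0) Pc.
Qed.

End EssentiallyBounded.

(** * The conditional expectation operator on matrix functions *)

Section TransitionOperator.
Context {R : realType} {d : measure_display} {T : measurableType d}.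
Variables (mu : {sigma_finite_measure set T -> \bar R}) (G : R.-pker T ~> T).
Variable (g : T -> T -> R).
Hypothesis g_measurable : measurable_fun setT (fun p : T * T => g p.1 p.2).
Hypothesis g_ge0 : forall l t, 0 <= g l t.
Hypothesis G_density : forall l L, measurable L ->
  G l L = (\int[mu]_(t in L) (g l t)%:E)%E.

Lemma EopE n (P : T -> 'M[R]_n) l i j : measurable_mx P ->
  Eop mu g P l i j = \int[G l]_t P t i j.
Proof. by move=> mP; rewrite mxE (kernel_integral g_measurable g_ge0 G_density). Qed.

Lemma kernel_integrable l (p : T -> R) c : measurable_fun setT p ->
  {ae mu, forall t, `|p t| <= c} -> (G l).-integrable setT (EFin \o p).
Proof.
move=> mp /(kernel_ae g_measurable G_density l) pc.
by apply: (integrable_ae_bounded _ mp pc); exact: kernel_fin.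
Qed.

Lemma ebmx_integrable n m (P : T -> 'M[R]_(n, m)) l i j : ebmx mu P ->
  (G l).-integrable setT (EFin \o (fun t => P t i j)).
Proof.
by move=> bP; have [c Pc] := ebmx_entry i j bP; apply: kernel_integrable Pc; case: bP.
Qed.

Lemma ebmx_Eop n (P : T -> 'M[R]_n) : ebmx mu P -> ebmx mu (Eop mu g P).
Proof.
move=> bP; have mP := bP.1; split=> [i j|].
  under eq_fun do rewrite EopE //; exact: measurable_kernel_integral.
have [_ [c Pc]] := bP; exists c; apply: nearW => l i j; rewrite EopE //.
apply: (kernel_integral_bound g_measurable G_density) => //.
by apply: filterS Pc => t.
Qed.

Lemma bf_integrable n (P : T -> 'M[R]_n) l x y : ebmx mu P ->
  (G l).-integrable setT (EFin \o (fun t => bf (P t) x y)).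
Proof.
move=> bP; under eq_fun do rewrite /= bfE.
apply: integrable_sumr => i; apply: integrable_sumr => j.
exact/integrable_scaler/ebmx_integrable.
Qed.

Lemma bf_Eop n (P : T -> 'M[R]_n) l x y : ebmx mu P ->
  bf (Eop mu g P l) x y = \int[G l]_t bf (P t) x y.
Proof.
move=> bP; rewrite bfE; under eq_Rintegral do rewrite bfE.
have ij i j := integrable_scaler (x i 0 * y j 0) (ebmx_integrable l i j bP).
rewrite Rintegral_sum => [|i]; last exact: integrable_sumr.
apply: eq_bigr => i _; rewrite Rintegral_sum //; apply: eq_bigr => j _.
rewrite RintegralZl //; last exact: ebmx_integrable.
by rewrite EopE //; case: bP.
Qed.

Lemma bf_Eop_le n (P Q : T -> 'M[R]_n) l x : ebmx mu P -> ebmx mu Q ->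
  {ae mu, forall t, bf (P t) x x <= bf (Q t) x x} ->
  bf (Eop mu g P l) x x <= bf (Eop mu g Q l) x x.
Proof.
move=> bP bQ PQ; rewrite !bf_Eop //.
apply: le_ae_Rintegral; try exact: bf_integrable.
exact: (kernel_ae g_measurable G_density).
Qed.

Lemma Eop_cst n (M : 'M[R]_n) l : Eop mu g (fun=> M) l = M.
Proof.
apply/matrixP => i j; rewrite EopE; last by move=> a b; exact: measurable_cst.
by rewrite Rintegral_cst // prob_kernel mulr1.
Qed.

Lemma EopD n (P Q : T -> 'M[R]_n) l : ebmx mu P -> ebmx mu Q ->
  Eop mu g (fun t => P t + Q t) l = Eop mu g P l + Eop mu g Q l.
Proof.
move=> bP bQ; apply/matrixP => i j; rewrite (EopE _ _ _ (ebmxD bP bQ).1) mxE.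
rewrite (EopE _ _ _ bP.1) (EopE _ _ _ bQ.1).
rewrite -RintegralD //; try exact: ebmx_integrable.
by apply: eq_Rintegral => t _; rewrite mxE.
Qed.

Lemma EopZ n (P : T -> 'M[R]_n) a l : ebmx mu P ->
  Eop mu g (fun t => a *: P t) l = a *: Eop mu g P l.
Proof.
move=> bP; apply/matrixP => i j; rewrite (EopE _ _ _ (ebmxZ a bP).1) mxE.
rewrite (EopE _ _ _ bP.1) -RintegralZl //; last exact: ebmx_integrable.
by apply: eq_Rintegral => t _; rewrite mxE.
Qed.

Lemma Eop_ae_eq n (P Q : T -> 'M[R]_n) l : measurable_mx P -> measurable_mx Q ->
  {ae mu, forall t, P t = Q t} -> Eop mu g P l = Eop mu g Q l.
Proof.
move=> mP mQ PQ; apply/matrixP => i j; rewrite !EopE //.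
apply: ae_eq_Rintegral => //; apply: (kernel_ae g_measurable G_density).
by apply: filterS PQ => t ->.
Qed.

Lemma Eop_sym n (P : T -> 'M[R]_n) l : ebmx mu P ->
  {ae mu, forall t, (P t)^T = P t} -> (Eop mu g P l)^T = Eop mu g P l.
Proof.
move=> bP sP; have mP := bP.1; have mPt := (ebmx_tr bP).1.
rewrite -[RHS](Eop_ae_eq _ mPt mP sP).
apply/matrixP => i j; rewrite mxE (EopE _ _ _ mP) (EopE _ _ _ mPt).
by apply: eq_Rintegral => t _; rewrite mxE.
Qed.

Lemma Eop_psd n (P : T -> 'M[R]_n) l : ebmx mu P ->
  {ae mu, forall t, psdmx (P t)} -> psdmx (Eop mu g P l).
Proof.
move=> bP pP; split; first by apply: Eop_sym => //; apply: filterS pP => t [].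
move=> x; rewrite -/(bf _ x x).
have -> : 0 = bf (Eop mu g (fun=> 0) l) x x by rewrite Eop_cst bf0m.
apply: bf_Eop_le => //; first exact: ebmx_cst.
by apply: filterS pP => t pP; rewrite bf0m; exact: psdmx_ge0.
Qed.

(** Dominated convergence under the probability [G l], for which constants are integrable; hence
    convergence at every [l]. *)
Lemma Eop_cvg n (Pn : nat -> T -> 'M[R]_n) (P : T -> 'M[R]_n) c l i j :
  (forall k, measurable_mx (Pn k)) -> measurable_mx P ->
  (forall k, {ae mu, forall t, `|Pn k t i j| <= c}) ->
  {ae mu, forall t, Pn k t i j @[k --> \oo] --> P t i j} ->
  Eop mu g (Pn k) l i j @[k --> \oo] --> Eop mu g P l i j.
Proof.
move=> mPn mP Pc PnP; under eq_fun do rewrite EopE //; rewrite EopE //.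
have ic : (G l).-integrable setT (EFin \o cst `|c|).
  by apply: (@kernel_integrable _ _ `|c|) => //; apply: nearW => t /=;
    rewrite normr_id.
have [] := @dominated_convergence _ _ _ (G l) setT measurableT
  (fun k t => (Pn k t i j)%:E) (fun t => (P t i j)%:E) (EFin \o cst `|c|).
- by move=> k; exact/measurable_EFinP/mPn.
- exact/measurable_EFinP/mP.
- apply: (kernel_ae g_measurable G_density); apply: filterS PnP => t PnP _.
  by apply/fine_cvgP; split; first exact: nearW.
- exact: ic.
- apply: (kernel_ae g_measurable G_density).
  have : {ae mu, forall t, forall k, `|Pn k t i j| <= c} by apply/ae_foralln.
  apply: filterS => t tc k _; rewrite lee_fin; apply: le_trans (tc k) _.
  exact: ler_norm.
move=> iP _ h; apply: fine_cvg; rewrite /Rintegral fineK //.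
exact: integrable_fin_num.
Qed.

End TransitionOperator.

(** * Lyapunov and Riccati operators *)

Section RiccatiTheory.
Context {R : realType} {d : measure_display} {T : measurableType d}.
Variables (mu : {sigma_finite_measure set T -> \bar R}) (G : R.-pker T ~> T).
Variable (g : T -> T -> R).
Hypothesis g_measurable : measurable_fun setT (fun p : T * T => g p.1 p.2).
Hypothesis g_ge0 : forall l t, 0 <= g l t.
Hypothesis G_density : forall l L, measurable L ->
  G l L = (\int[mu]_(t in L) (g l t)%:E)%E.
Local Notation E := (Eop mu g).
Let ebE n := @ebmx_Eop _ _ _ _ _ _ g_measurable g_ge0 G_density n.
Let psdE n := @Eop_psd _ _ _ _ _ _ g_measurable g_ge0 G_density n.
Let leE n := @bf_Eop_le _ _ _ _ _ _ g_measurable g_ge0 G_density n.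
Let addE n := @EopD _ _ _ _ _ _ g_measurable g_ge0 G_density n.
Let scaleE n := @EopZ _ _ _ _ _ _ g_measurable g_ge0 G_density n.

Lemma EopB n (P Q : T -> 'M[R]_n) l : ebmx mu P -> ebmx mu Q ->
  E (fun t => P t - Q t) l = E P l - E Q l.
Proof.
move=> bP bQ; rewrite addE //; last exact: ebmxN.
congr (_ + _); rewrite -scaleN1r -scaleE //.
by congr (Eop mu g _ l); apply/funext => t; rewrite scaleN1r.
Qed.

Lemma ae_and (P Q : T -> Prop) : {ae mu, forall l, P l} ->
  {ae mu, forall l, Q l} -> {ae mu, forall l, P l /\ Q l}.
Proof. by move=> hP hQ; apply: filterS2 hP hQ. Qed.

Lemma ebmx_bf_bound n (P : T -> 'M[R]_n) : ebmx mu P ->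
  exists2 c, 0 < c & {ae mu, forall l, forall x, bf (P l) x x <= c * sqn x}.
Proof.
move=> bP; have [c c0 Pc] := ebmx_pos_bound bP.
exists ((n%:R * n%:R * c ^+ 2 + 1) / 2).
  by rewrite divr_gt0 // ltr_wpDl // -natrM mulr_ge0 // sqr_ge0.
by apply: filterS Pc => l Pc x; apply: bf_le (ltW c0) Pc.
Qed.

Lemma ebmx_sqn_bound n m (P : T -> 'M[R]_(n, m)) : ebmx mu P ->
  exists2 c, 0 < c & {ae mu, forall l, forall x, sqn (P l *m x) <= c * sqn x}.
Proof.
move=> bP; have [c c0 Pc] := ebmx_pos_bound bP.
exists (n%:R * m%:R * c ^+ 2 + 1);
  first by rewrite ltr_wpDl // -natrM mulr_ge0 // sqr_ge0.
apply: filterS Pc => l Pc x; apply: le_trans (sqn_mulmx_le x (ltW c0) Pc) _.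
by rewrite ler_wpM2r ?sqn_ge0 // lerDl.
Qed.

(** The coupled Lyapunov inequality [A^T E(S) A <= S - xi I], written with quadratic forms. *)
Definition lyapunov n (A : T -> 'M[R]_n) (S : T -> 'M[R]_n) (xi : R) : Prop :=
  [/\ ebmx mu S, {ae mu, forall l, psdmx (S l)}, 0 < xi &
    {ae mu, forall l, forall x, bf (E S l) (A l *m x) (A l *m x) <=
      bf (S l) x x - xi * sqn x}].

Lemma lyapunov_coercive n (A S : T -> 'M[R]_n) xi : lyapunov A S xi ->
  {ae mu, forall l, forall x, xi * sqn x <= bf (S l) x x}.
Proof.
move=> [bS pS xi0]; apply: filterS => l h x.
have := psdmx_ge0 (A l *m x) (psdE l bS pS); have := h x; lra.
Qed.

Lemma lyapunov_contraction n (A S : T -> 'M[R]_n) xi : lyapunov A S xi ->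
  exists2 q, 0 < q < 1 &
  {ae mu, forall l, forall x, bf (E S l) (A l *m x) (A l *m x) <= q * bf (S l) x x}.
Proof.
move=> [bS pS xi0 h]; have [c c0 Sc] := ebmx_bf_bound bS.
(* Since [S <= c I], the decrease [xi |x|^2] is at least the fraction [xi / (c + xi)] of [x^T S x];
   adding [xi] to [c] keeps [q] positive. *)
pose q := 1 - xi / (c + xi); exists q.
  have cxi : 0 < c + xi by rewrite addr_gt0.
  rewrite /q; have : 0 < xi / (c + xi) < 1.
    by rewrite divr_gt0 //= ltr_pdivrMr // mul1r ltrDr.
  lra.
apply: filterS2 h Sc => l h Sc x; apply: le_trans (h x) _.
have cxi : 0 < c + xi by rewrite addr_gt0.
rewrite mulrBl mul1r lerD2l lerN2 mulrAC ler_pdivrMr // -mulrA.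
apply: ler_wpM2l; first exact: ltW.
apply: le_trans (Sc x) _; rewrite mulrC.
by apply: ler_wpM2l; [exact: sqn_ge0 | rewrite lerDl ltW].
Qed.

(* If [X >= - a S] then [X >= A^T E(X) A >= - a A^T E(S) A >= - a q S]; iterate. *)
Lemma lyapunov_comparison n (A S X : T -> 'M[R]_n) xi : lyapunov A S xi ->
  ebmx mu X ->
  {ae mu, forall l, forall x, bf (E X l) (A l *m x) (A l *m x) <= bf (X l) x x} ->
  {ae mu, forall l, forall x, 0 <= bf (X l) x x}.
Proof.
move=> LS bX TX; have [bS _ xi0 _] := LS; have Sxi := lyapunov_coercive LS.
have [q /andP[q0 q1] Sq] := lyapunov_contraction LS.
have [b b0 Xb] := ebmx_bf_bound (ebmxN bX).
(* [- X <= b I <= (b / xi) S], by coercivity of [S]. *)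
pose a := b / xi; have a0 : 0 < a by rewrite divr_gt0.
have step k : {ae mu, forall l, forall x, - (a * q ^+ k) * bf (S l) x x <= bf (X
  l) x x}.
  elim: k => [|k IH].
    apply: filterS2 Xb Sxi => l Xb Sxi x; rewrite expr0 mulr1.
    have := Xb x; rewrite bf_oppm => h.
    rewrite mulNr lerNl; apply: le_trans h _; rewrite /a mulrAC ler_pdivlMr //.
    rewrite -mulrA ler_wpM2l ?(ltW b0) //; by rewrite mulrC.
  apply: filterS2 TX Sq => l TX Sq x; apply: le_trans (TX x).
  apply: (@le_trans _ _ (- (a * q ^+ k) * bf (E S l) (A l *m x) (A l *m x))).
    rewrite !mulNr lerN2.
    have -> : a * q ^+ k.+1 * bf (S l) x x = a * q ^+ k * (q * bf (S l) x x).
      by rewrite exprSr; ring.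
    by rewrite ler_wpM2l // mulr_ge0 ?ltW // exprn_gt0.
  rewrite -bf_scalem -scaleE //; apply: leE => //; first exact: ebmxZ.
  by apply: filterS IH => t IH; rewrite bf_scalem.
have := (ae_foralln step); apply: filterS => l h x.
have lim : (- (a * q ^+ k) * bf (S l) x x) @[k --> \oo] --> (- (a * 0) * bf (S l)
  x x).
  apply: cvgMr_tmp; apply: cvgN; apply: cvgMl_tmp; apply: cvg_expr.
  by rewrite ger0_norm ?ltW.
have -> : 0 = - (a * 0) * bf (S l) x x by rewrite mulr0 oppr0 mul0r.
by apply: (cvgr_to_le lim); apply: nearW => k; exact: h.
Qed.

(* Young's inequality, with the parameter small enough to keep half of [xi]. *)
Lemma lyapunov_forced n m (A S : T -> 'M[R]_n) (B : T -> 'M[R]_(n, m)) xi :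
  lyapunov A S xi -> ebmx mu B ->
  exists2 c, 0 < c & {ae mu, forall l, forall x u,
    bf (E S l) (A l *m x + B l *m u) (A l *m x + B l *m u) <=
    bf (S l) x x - xi / 2 * sqn x + c * sqn u}.
Proof.
move=> [bS pS xi0 hS] bB.
have [s s0 Ss] := ebmx_bf_bound bS.
have [c c0 SBc] : exists2 c, 0 < c & {ae mu, forall l, forall u,
    bf (E S l) (B l *m u) (B l *m u) <= c * sqn u}.
  have bSB : ebmx mu (fun l => (B l)^T *m E S l *m B l).
    by do 2 apply: ebmxM => //; [exact: ebmx_tr|exact: ebE].
  have [c c0 h] := ebmx_bf_bound bSB; exists c => //.
  by apply: filterS h => l h u; rewrite -bf_mulm.
pose e := xi / (2 * s).
have e0 : 0 < e by rewrite divr_gt0 // mulr_gt0.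
exists ((1 + e^-1) * c); first by rewrite mulr_gt0 // addr_gt0 // invr_gt0.
have h := ae_and hS (ae_and Ss SBc).
apply: filterS h => l [hSl [Ssl SBl]] x u.
apply: le_trans (young _ _ (psdE l bS pS) e0) _.
have k0 : 0 <= 1 + e^-1 by rewrite addr_ge0 // invr_ge0 ltW.
apply: lerD; last by rewrite -mulrA; apply: ler_wpM2l.
have k1 : 0 <= 1 + e by rewrite addr_ge0 // ltW.
apply: le_trans (ler_wpM2l k1 (hSl x)) _.
have es : e * s = xi / 2 by rewrite /e; field; rewrite gt_eqF.
have := ler_wpM2l (ltW e0) (Ssl x); rewrite mulrA es.
have : 0 <= e * xi * sqn x.
  apply: mulr_ge0; last exact: sqn_ge0.
  by apply: mulr_ge0; exact: ltW.
lra.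
Qed.

Lemma cvg_sumr (I : Type) (s : seq I) (u : I -> nat -> R) (a : I -> R) :
  (forall i, u i k @[k --> \oo] --> a i) ->
  \sum_(i <- s) u i k @[k --> \oo] --> \sum_(i <- s) a i.
Proof.
move=> ua; elim: s => [|i s IH].
  by rewrite big_nil; under eq_fun do rewrite big_nil; exact: cvg_cst.
by rewrite big_cons; under eq_fun do rewrite big_cons; exact: cvgD.
Qed.

Lemma cvg_bf n (Mk : nat -> 'M[R]_n) (M : 'M[R]_n) x y :
  (forall i j, Mk k i j @[k --> \oo] --> M i j) ->
  bf (Mk k) x y @[k --> \oo] --> bf M x y.
Proof.
move=> MkM; rewrite bfE; under eq_fun do rewrite bfE.
apply: cvg_sumr => i; apply: cvg_sumr => j.
exact: cvgMl_tmp.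
Qed.

(** Values of the quadratic forms are bounded nondecreasing real sequences, and polarization
    recovers each entry from three of them. *)
Lemma nondecreasing_mx_cvg n (Mk : nat -> 'M[R]_n) c :
  (forall k, (Mk k)^T = Mk k) ->
  (forall k x, bf (Mk k) x x <= bf (Mk k.+1) x x) ->
  (forall k x, bf (Mk k) x x <= c * sqn x) ->
  forall i j, cvgn (fun k => Mk k i j).
Proof.
move=> sM ndM Mc i j.
have cx x : cvgn (fun k => bf (Mk k) x x).
  apply: nondecreasing_is_cvgn; first by apply/nondecreasing_seqP => k.
  by exists (c * sqn x) => _ [k _ <-].
have -> : (fun k => Mk k i j) = (fun k => (bf (Mk k) (delta_mx i 0 + delta_mx j 0)
   (delta_mx i 0 + delta_mx j 0) - bf (Mk k) (delta_mx i 0) (delta_mx i 0)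
    - bf (Mk k) (delta_mx j 0) (delta_mx j 0)) / 2).
  by apply/funext => k; rewrite -bf_delta (bf_polar _ _ (sM k)).
by apply: is_cvgMr_tmp; apply: is_cvgB => //; apply: is_cvgB.
Qed.

Lemma nondecreasing_ebmx_cvg n (Pk : nat -> T -> 'M[R]_n) c :
  (forall k, measurable_mx (Pk k)) ->
  (forall k, {ae mu, forall l, psdmx (Pk k l)}) ->
  (forall k, {ae mu, forall l, forall x, bf (Pk k l) x x <= bf (Pk k.+1 l) x x}) ->
  (forall k, {ae mu, forall l, forall x, bf (Pk k l) x x <= c * sqn x}) ->
  exists P : T -> 'M[R]_n, [/\ ebmx mu P, {ae mu, forall l, psdmx (P l)},
    {ae mu, forall l, forall k x, bf (Pk k l) x x <= bf (P l) x x} &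
    {ae mu, forall l, forall i j, Pk k l i j @[k --> \oo] --> P l i j}].
Proof.
move=> mPk /ae_foralln psdPk /ae_foralln ndPk /ae_foralln Pkc.
(* The entries converge only almost everywhere; the upper limit is measurable and defined
   everywhere, and agrees with the limit where that exists. *)
pose P l : 'M[R]_n := \matrix_(i, j) fine (limn_esup (fun k => (Pk k l i j)%:E)).
have PkP : {ae mu, forall l, forall i j, Pk k l i j @[k --> \oo] --> P l i j}.
  apply: filterS3 psdPk ndPk Pkc => l psdPk ndPk Pkc i j.
  have := @nondecreasing_mx_cvg _ (fun k => Pk k l) c (fun k =>
    (psdPk k).1) ndPk Pkc i j.
  move=> cv; rewrite mxE.
  suff : (Pk k l i j)%:E @[k --> \oo] --> (limn (fun k => Pk k l i j))%:E.
    by move=> /cvg_limn_einf_sup[_ ->].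
  by apply/fine_cvgP; split; first exact: nearW.
have mP : measurable_mx P.
  move=> i j; under eq_fun do rewrite mxE.
  apply: (measurableT_comp (fine_measurable measurableT)).
  by apply: measurable_fun_limn_esup => k; exact/measurable_EFinP/mPk.
have bfP : {ae mu, forall l, forall x y, bf (Pk k l) x y @[k --> \oo] --> bf (P
  l) x y}.
  by apply: filterS PkP => l PkP x y; exact: cvg_bf.
have PkleP : {ae mu, forall l, forall k x, bf (Pk k l) x x <= bf (P l) x x}.
  apply: filterS2 bfP ndPk => l bfP ndPk k x.
  apply: (cvgr_to_ge (bfP x x)); exists k => // m /= km.
  by have /nondecreasing_seqP := (fun k => ndPk k x); apply.
have psdP : {ae mu, forall l, psdmx (P l)}.
  apply: filterS3 PkP psdPk PkleP => l PkP psdPk PkleP; split.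
    apply/matrixP => i j; rewrite [LHS]mxE.
    apply: (cvg_unique _ (PkP j i)) => //.
    have -> : (fun k => Pk k l j i) = (fun k => Pk k l i j); last exact: PkP.
    by apply/funext => k; rewrite -[in LHS](psdPk k).1 mxE.
  move=> x; rewrite -/(bf _ x x); apply: le_trans (PkleP 0%N x).
  exact: psdmx_ge0.
exists P; split => //; split => //; exists c.
apply: filterS3 psdP bfP Pkc => l psdP bfP Pkc i j.
apply: psdmx_entry => // x; apply: (cvgr_to_le (bfP x x)).
exact: nearW.
Qed.

(** * The Riccati operator *)

Section WithSystem.
Context (n r : nat) (A : T -> 'M[R]_n) (B : T -> 'M[R]_(n, r)).
Context (D : T -> 'M[R]_r) (gamma : R).
Hypothesis bA : ebmx mu A.
Hypothesis bB : ebmx mu B.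
Hypothesis bD : ebmx mu D.
Local Notation Psi2 := (Psi2 mu g A B).
Local Notation Psi3 := (Psi3 mu g B D gamma).

Definition gain P l : 'M[R]_(r, n) := invmx (Psi3 P l) *m (Psi2 P l)^T.

(** The right-hand side of the Riccati equation, with [C^T C] replaced by a free weight [Q] and the
    two minus signs around [Psi3] cancelled. *)
Definition riccati (Q P : T -> 'M[R]_n) l : 'M[R]_n :=
  (A l)^T *m E P l *m A l + Q l + Psi2 P l *m invmx (Psi3 P l) *m (Psi2 P l)^T.

(** For [Q = C^T C] and [C^T D = 0] this is [|z|^2 - gamma |v|^2]. *)
Definition stage_cost (Q : T -> 'M[R]_n) l x v : R :=
  bf (Q l) x x + sqn (D l *m v) - gamma * sqn v.

Lemma ebmx_Psi2 P : ebmx mu P -> ebmx mu (Psi2 P).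
Proof. by move=> bP; do 2 apply: ebmxM => //; [exact: ebmx_tr|exact: ebE]. Qed.

Lemma ebmx_Psi3 P : ebmx mu P -> ebmx mu (Psi3 P).
Proof.
move=> bP; apply: ebmxB; first apply: ebmxB; first exact: ebmx_cst.
  by do 2 apply: ebmxM => //; [exact: ebmx_tr|exact: ebE].
by apply: ebmxM => //; exact: ebmx_tr.
Qed.

Lemma ebmx_gain P : ebmx mu P -> ae_unif_pos mu (Psi3 P) -> ebmx mu (gain P).
Proof.
move=> bP P3; apply: ebmxM; first by apply: ebmx_inv => //; exact: ebmx_Psi3.
exact/ebmx_tr/ebmx_Psi2.
Qed.

Lemma ebmx_riccati Q P : ebmx mu Q -> ebmx mu P -> ae_unif_pos mu (Psi3 P) ->
  ebmx mu (riccati Q P).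
Proof.
move=> bQ bP P3; apply: ebmxD; first apply: ebmxD => //.
  by do 2 apply: ebmxM => //; [exact: ebmx_tr|exact: ebE].
have bP2 := ebmx_Psi2 bP.
apply: ebmxM; last exact: ebmx_tr.
by apply: ebmxM => //; apply: ebmx_inv => //; exact: ebmx_Psi3.
Qed.

Lemma Psi3_sym P l : (E P l)^T = E P l -> (Psi3 P l)^T = Psi3 P l.
Proof.
by move=> sE; rewrite /Psi3 !linearB /= tr_scalar_mx !trmx_mul !trmxK sE mulmxA.
Qed.

Lemma bf_Psi3E P l v : bf (Psi3 P l) v v =
  gamma * sqn v - bf (E P l) (B l *m v) (B l *m v) - sqn (D l *m v).
Proof. exact: bf_Psi3. Qed.

Lemma riccati_sym Q P l : (Q l)^T = Q l -> (E P l)^T = E P l ->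
  (riccati Q P l)^T = riccati Q P l.
Proof.
move=> sQ sE; rewrite /riccati !linearD /= !trmx_mul !trmxK trmx_inv.
by rewrite Psi3_sym // sE sQ !mulmxA.
Qed.

Lemma riccati_square Q P l xi x v : (E P l)^T = E P l -> 0 < xi ->
  psdmx (Psi3 P l - xi%:M) ->
  bf (E P l) (A l *m x + B l *m v) (A l *m x + B l *m v) + stage_cost Q l x v
  = bf (riccati Q P l) x x - bf (Psi3 P l) (v - gain P l *m x) (v - gain P l *m x).
Proof.
move=> sE xi0 P3; rewrite -complete_square //; last exact: pd_unitmx P3.
by rewrite /stage_cost; lra.
Qed.

Lemma Psi3_ge0 P l xi v : 0 < xi -> psdmx (Psi3 P l - xi%:M) ->
  0 <= bf (Psi3 P l) v v.
Proof.
move=> xi0 /(psdmx_subs_le v); apply: le_trans.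
by rewrite mulr_ge0 ?sqn_ge0 // ltW.
Qed.

(* Hence [x^T riccati(P) x] is the maximum over [v], attained at [v = gain P x]. *)
Lemma riccati_ge Q P l xi x v : (E P l)^T = E P l -> 0 < xi ->
  psdmx (Psi3 P l - xi%:M) ->
  bf (E P l) (A l *m x + B l *m v) (A l *m x + B l *m v) + stage_cost Q l x v
  <= bf (riccati Q P l) x x.
Proof.
by move=> sE xi0 P3; rewrite (riccati_square _ _ _ sE xi0 P3) gerBl (Psi3_ge0 _
  xi0 P3).
Qed.

Lemma riccati_attained Q P l xi x : (E P l)^T = E P l -> 0 < xi ->
  psdmx (Psi3 P l - xi%:M) -> let v := gain P l *m x in
  bf (E P l) (A l *m x + B l *m v) (A l *m x + B l *m v) + stage_cost Q l x v
  = bf (riccati Q P l) x x.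
Proof.
move=> sE xi0 P3 /=; rewrite (riccati_square _ _ _ sE xi0 P3) subrr.
by rewrite -(scale0r 0) bfZl mul0r subr0.
Qed.

(** The maximizing input for [P] is a competitor in the maximum for [P']; no comparison of inverses
    is involved. *)
Lemma riccati_mono Q P P' l xi xi' : (E P l)^T = E P l -> (E P' l)^T = E P' l ->
  0 < xi -> 0 < xi' -> psdmx (Psi3 P l - xi%:M) -> psdmx (Psi3 P' l - xi'%:M) ->
  (forall x, bf (E P l) x x <= bf (E P' l) x x) ->
  forall x, bf (riccati Q P l) x x <= bf (riccati Q P' l) x x.
Proof.
move=> sE sE' xi0 xi'0 P3 P3' PP' x.
rewrite -(riccati_attained _ _ sE xi0 P3).
by apply: le_trans (riccati_ge Q x (gain P l *m x) sE' xi'0 P3'); rewrite lerD2r.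
Qed.

(** The input [v = 0] already gives a nonnegative value. *)
Lemma riccati_psd Q P l xi : psdmx (Q l) -> psdmx (E P l) ->
  0 < xi -> psdmx (Psi3 P l - xi%:M) -> psdmx (riccati Q P l).
Proof.
move=> [sQ pQ] [sE pE] xi0 P3; split; first exact: riccati_sym.
move=> x; rewrite -/(bf _ x x).
apply: le_trans (riccati_ge Q x 0 sE xi0 P3).
rewrite /stage_cost !mulmx0 !sqn0 mulr0 subr0 !addr0.
by rewrite addr_ge0 ?pQ ?pE.
Qed.

Lemma Psi3_anti P P' l xi : (E P l)^T = E P l -> (E P' l)^T = E P' l ->
  (forall x, bf (E P l) x x <= bf (E P' l) x x) ->
  psdmx (Psi3 P' l - xi%:M) -> psdmx (Psi3 P l - xi%:M).
Proof.
move=> sE sE' PP' P3'; apply: psdmx_subsP; first exact: Psi3_sym.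
move=> v; apply: le_trans (psdmx_subs_le v P3') _.
by rewrite !bf_Psi3E lerD2r lerD2l lerN2.
Qed.

(** * Riccati iteration from zero *)

Section Iteration.
Variable Q : T -> 'M[R]_n.
Hypothesis bQ : ebmx mu Q.
Hypothesis psdQ : {ae mu, forall l, psdmx (Q l)}.

Fixpoint riccati_iter k : T -> 'M[R]_n :=
  if k is k'.+1 then riccati Q (riccati_iter k') else fun=> 0.

Variable eta : R.
Hypothesis eta0 : 0 < eta.

(** The bound on [Psi3] is assumed only below [k], so that the lemma can serve inside inductions
    that establish this bound step by step. *)
Lemma riccati_iter_psd k :
  (forall i, (i < k)%N ->
    {ae mu, forall l, psdmx (Psi3 (riccati_iter i) l - eta%:M)}) ->
  ebmx mu (riccati_iter k) /\ {ae mu, forall l, psdmx (riccati_iter k l)}.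
Proof.
elim: k => [_|k IH P3].
  split; first exact: ebmx_cst.
  apply: nearW => l /=; split=> [|x]; first by rewrite trmx0.
  by rewrite -/(bf _ x x) bf0m.
have [bP pP] : ebmx mu (riccati_iter k) /\ {ae mu, forall l, psdmx (riccati_iter
  k l)}.
  by apply: IH => i ik; apply: P3; rewrite ltnS ltnW.
have P3k := P3 k (leqnn _); split.
  by apply: ebmx_riccati => //; exists eta.
apply: filterS2 P3k psdQ => l P3l pQ.
by apply: riccati_psd eta0 P3l => //; exact: psdE.
Qed.

Hypothesis Psi3_iter :
  forall k, {ae mu, forall l, psdmx (Psi3 (riccati_iter k) l - eta%:M)}.

Let bP k : ebmx mu (riccati_iter k).
Proof. by have [] := @riccati_iter_psd k (fun i _ => Psi3_iter i). Qed.

Let psdP k : {ae mu, forall l, psdmx (riccati_iter k l)}.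
Proof. by have [] := @riccati_iter_psd k (fun i _ => Psi3_iter i). Qed.

Let symP k l : (E (riccati_iter k) l)^T = E (riccati_iter k) l.
Proof. by case: (psdE l (bP k) (psdP k)). Qed.

Lemma riccati_iter_nd k :
  {ae mu, forall l, forall x, bf (riccati_iter k l) x x <= bf (riccati_iter k.+1
    l) x x}.
Proof.
elim: k => [|k IH].
  have := psdP 1; apply: filterS => l pP x.
  by rewrite [leLHS]bf0m; exact: psdmx_ge0.
apply: filterS2 (Psi3_iter k) (Psi3_iter k.+1) => l P3 P3' x.
apply: riccati_mono eta0 eta0 P3 P3' _ x => // y.
by apply: leE => //; apply: filterS IH => t.
Qed.

(** From [P_k <= P_(k+1) = Ric(P_k) <= Ric(P)] the limit gives [P <= Ric(P)]. Conversely, with the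
    input frozen at the maximizer for [P], the value computed with [P_k] is at most [P_(k+1) <= P],
    and it converges to the value computed with [P], which is [Ric(P)]. *)
Lemma riccati_iter_limit c :
  (forall k, {ae mu, forall l, forall x, bf (riccati_iter k l) x x <= c * sqn x}) ->
  exists P : T -> 'M[R]_n, [/\ ebmx mu P, {ae mu, forall l, psdmx (P l)},
    forall X : T -> 'M[R]_n,
      (forall k, {ae mu, forall l, forall x, bf (riccati_iter k l) x x <= bf (X
        l) x x}) ->
      {ae mu, forall l, forall x, bf (P l) x x <= bf (X l) x x},
    {ae mu, forall l, psdmx (Psi3 P l - eta%:M)} &
    {ae mu, forall l, P l = riccati Q P l}].
Proof.
move=> Pc.
have [P [bPl psdPl PkP cP]] :=
  nondecreasing_ebmx_cvg (fun k => (bP k).1) psdP riccati_iter_nd Pc.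
have symPl l : (E P l)^T = E P l by case: (psdE l bPl psdPl).
have Elim l x : bf (E (riccati_iter k) l) x x @[k --> \oo] --> bf (E P l) x x.
  apply: cvg_bf => i j; apply: (Eop_cvg g_measurable g_ge0 G_density (c := c)).
  - by move=> k; case: (bP k).
  - by case: bPl.
  - move=> k; apply: filterS2 (psdP k) (Pc k) => l' h1 h2.
    exact: psdmx_entry.
  - by apply: filterS cP => l'.
have lim_le : forall X : T -> 'M[R]_n,
    (forall k, {ae mu, forall l, forall x, bf (riccati_iter k l) x x <= bf (X l)
      x x}) ->
    {ae mu, forall l, forall x, bf (P l) x x <= bf (X l) x x}.
  move=> X /ae_foralln PX; apply: filterS2 PX cP => l PX cP x.
  have cx := @cvg_bf _ (fun k => riccati_iter k l) (P l) x x cP.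
  by apply: (cvgr_to_le cx); apply: nearW => k; exact: PX.
have P3 : {ae mu, forall l, psdmx (Psi3 P l - eta%:M)}.
  have := ae_foralln Psi3_iter; apply: filterS => l P3.
  apply: psdmx_subsP; first exact: Psi3_sym.
  move=> v; rewrite bf_Psi3E.
  suff : bf (E P l) (B l *m v) (B l *m v) <= gamma * sqn v - sqn (D l *m v) - eta
    * sqn v.
    by lra.
  apply: (cvgr_to_le (Elim l (B l *m v))); apply: nearW => k.
  have := psdmx_subs_le v (P3 k); rewrite bf_Psi3E; lra.
exists P; split => //.
have leRic : {ae mu, forall l, forall x, bf (P l) x x <= bf (riccati Q P l) x x}.
  apply: lim_le => k; apply: filterS3 (riccati_iter_nd k) P3 (Psi3_iter k).
  move=> l nd P3l P3k x; apply: le_trans (nd x) _.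
  apply: riccati_mono eta0 eta0 P3k P3l _ x => // y.
  by apply: leE => //; apply: filterS PkP => t.
have h1 := ae_and (ae_and psdPl psdQ) (ae_and P3 leRic).
have h2 := ae_and PkP (ae_foralln Psi3_iter).
apply: filterS2 h1 h2 => l [[psdPll psdQl] [P3l leRicl]] [PkPl P3k].
apply: bf_inj; [by case: psdPll|by apply: riccati_sym => //; case: psdQl|] => x.
apply/eqP; rewrite eq_le leRicl /= -(riccati_attained _ _ (symPl l) eta0 P3l).
set v := gain P l *m x; rewrite -lerBrDr.
apply: (cvgr_to_le (Elim l _)); apply: nearW => k.
rewrite lerBrDr; apply: le_trans (riccati_ge _ _ _ (symP k l) eta0 (P3k k)) _.
exact: (PkPl k.+1).
Qed.

End Iteration.
(** A strict dissipation inequality with storage function [x^T P x]. The [v] part of the margin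
    yields coercivity of [Psi3], the [x] part a Lyapunov inequality for [A]. *)
Definition dissipative (Q P : T -> 'M[R]_n) eta : Prop :=
  [/\ ebmx mu P, {ae mu, forall l, psdmx (P l)}, 0 < eta &
    {ae mu, forall l, forall x v,
      bf (E P l) (A l *m x + B l *m v) (A l *m x + B l *m v) + stage_cost Q l x v
      <= bf (P l) x x - eta * (sqn x + sqn v)}].

(** The change of variables from [(x, v)] to [(x, v - F x)] is boundedly invertible:
    [|v|^2 <= 2 |v - F x|^2 + 2 c |x|^2] leads to the two quotients in the minimum. *)
Lemma sqn_shift_bound (F : T -> 'M[R]_(r, n)) a b : ebmx mu F -> 0 < a -> 0 < b ->
  exists2 eta, 0 < eta & {ae mu, forall l, forall x v,
    eta * (sqn x + sqn v) <= a * sqn x + b * sqn (v - F l *m x)}.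
Proof.
move=> bF a0 b0; have [c c0 Fc] := ebmx_sqn_bound bF.
have c1 : 0 < 1 + 2 * c by rewrite addr_gt0 // mulr_gt0.
exists (Num.min (a / (1 + 2 * c)) (b / 2)).
  by rewrite lt_min !divr_gt0.
apply: filterS Fc => l Fc x v; set eta := Num.min _ _.
have ea : eta * (1 + 2 * c) <= a by rewrite -ler_pdivlMr // ge_min lexx.
have eb : eta * 2 <= b by rewrite -ler_pdivlMr // ge_min lexx orbT.
have e0 : 0 <= eta by rewrite le_min !divr_ge0 // ltW.
have := sqnD_le (v - F l *m x) (F l *m x); rewrite subrK.
have := Fc x; set w := v - _; set y := F l *m x => h1 h2.
have := ler_wpM2l e0 h1; have := ler_wpM2l e0 h2.
have := ler_wpM2r (sqn_ge0 x) ea; have := ler_wpM2r (sqn_ge0 w) eb.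
lra.
Qed.

Lemma strict_dissipative Q P : ebmx mu P -> {ae mu, forall l, psdmx (P l)} ->
  ae_unif_pos mu (fun l => P l - riccati Q P l) -> ae_unif_pos mu (Psi3 P) ->
  exists eta, dissipative Q P eta.
Proof.
move=> bP pP [e e0 He] P3u; have bF := ebmx_gain bP P3u.
have [xi xi0 P3] := P3u.
have [eta eta0 h] := sqn_shift_bound bF e0 xi0.
exists eta; split => //; have h' := ae_and h P3.
apply: filterS2 (He) (h') => l Hl [hl P3l] x v.
have [sE _] := psdE l bP pP.
rewrite (riccati_square _ _ _ sE xi0 P3l).
have := hl x v; have := psdmx_subs_le (v - gain P l *m x) P3l.
have := psdmx_subs_le x Hl; rewrite bf_subm; lra.
Qed.

(** The inequality is evaluated at [x = 0] here, at the maximizing input in [dissipative_strict],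
    and at [v = 0] in [dissipative_lyapunov]. *)
Lemma dissipative_Psi3 Q P eta : {ae mu, forall l, psdmx (Q l)} ->
  dissipative Q P eta -> {ae mu, forall l, psdmx (Psi3 P l - eta%:M)}.
Proof.
move=> pQ [bP pP eta0 h]; apply: filterS2 h pQ => l h pQ.
have [sE _] := psdE l bP pP.
apply: psdmx_subsP; first exact: Psi3_sym.
move=> v; have := h 0 v; rewrite /stage_cost !mulmx0 add0r sqn0 add0r bf_Psi3E.
by rewrite -(scale0r 0) !bfZl !mul0r; lra.
Qed.

Lemma dissipative_strict Q P eta : {ae mu, forall l, psdmx (Q l)} ->
  dissipative Q P eta ->
  {ae mu, forall l, psdmx (P l - riccati Q P l - eta%:M)}.
Proof.
move=> pQ dP; have P3 := dissipative_Psi3 pQ dP; have [bP pP eta0 h] := dP.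
have hh := ae_and h P3.
apply: filterS3 (hh) (pQ) (pP) => l [hl P3l] [sQ _] [sP _].
have [sE _] := psdE l bP pP.
apply: psdmx_subsP; first by rewrite linearB /= sP riccati_sym.
move=> x; rewrite bf_subm -(riccati_attained _ _ sE eta0 P3l).
have := hl x (gain P l *m x).
have : 0 <= eta * sqn (gain P l *m x) by rewrite mulr_ge0 ?sqn_ge0 // ltW.
lra.
Qed.

Lemma dissipative_lyapunov Q P eta : {ae mu, forall l, psdmx (Q l)} ->
  dissipative Q P eta -> lyapunov A P eta.
Proof.
move=> pQ [bP pP eta0 h]; split => //; apply: filterS2 h pQ => l h pQ x.
have := h x 0; rewrite /stage_cost !mulmx0 !sqn0 !addr0 mulr0 subr0.
have := psdmx_ge0 x pQ; lra.
Qed.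

Definition closed_loop P l : 'M[R]_n := A l + B l *m gain P l.

Lemma closed_loopE P l (x : 'cV[R]_n) : closed_loop P l *m x = A l *m x +
  B l *m (gain P l *m x).
Proof. by rewrite mulmxDl -mulmxA. Qed.

(** At the maximizing input for [P], the inequality for [Phat] and the Riccati identity for [P]
    contain the same stage cost, which cancels on subtraction. *)
Lemma dissipative_comparison Q Phat eta P xi : dissipative Q Phat eta ->
  ebmx mu P -> {ae mu, forall l, psdmx (P l)} -> 0 < xi ->
  {ae mu, forall l, psdmx (Psi3 P l - xi%:M)} ->
  {ae mu, forall l, P l = riccati Q P l} ->
  {ae mu, forall l, forall x,
    bf (E (fun t => Phat t - P t) l) (closed_loop P l *m x) (closed_loop P l *m x)
    <= bf (Phat l - P l) x x - eta * sqn x}.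
Proof.
move=> [bH pH eta0 h] bP pP xi0 P3 PR.
apply: filterS3 h P3 PR => l h P3 PR x.
have [sE _] := psdE l bP pP.
rewrite EopB // !bf_subm closed_loopE PR -(riccati_attained _ _ sE xi0 P3).
have := h x (gain P l *m x).
have : 0 <= eta * sqn (gain P l *m x) by rewrite mulr_ge0 ?sqn_ge0 // ltW.
lra.
Qed.

Lemma dissipative_stabilizing Q Phat eta : ebmx mu Q ->
  {ae mu, forall l, psdmx (Q l)} -> dissipative Q Phat eta ->
  exists P S, [/\ ebmx mu P, {ae mu, forall l, psdmx (P l)},
    {ae mu, forall l, psdmx (Psi3 P l - eta%:M)},
    {ae mu, forall l, P l = riccati Q P l} & lyapunov (closed_loop P) S eta].
Proof.
move=> bQ pQ dH; have [bH pH eta0 _] := dH.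
have H3 := dissipative_Psi3 pQ dH; have HR := dissipative_strict pQ dH.
(* The two bounds are proved together: [P_k <= Phat] gives [Psi3 P_k >= Psi3 Phat >= eta I], and
   this allows the monotonicity step [P_(k+1) = Ric(P_k) <= Ric(Phat) <= Phat]. *)
have iter k : (forall i, (i <= k)%N ->
    {ae mu, forall l, psdmx (Psi3 (riccati_iter Q i) l - eta%:M)}) /\
    {ae mu, forall l, forall x, bf (riccati_iter Q k l) x x <= bf (Phat l) x x}.
  elim: k => [|k [IH3 IH]].
    have H0 : {ae mu, forall l, forall x, bf (riccati_iter Q 0 l) x x <= bf (Phat
      l) x x}.
      by apply: filterS (pH) => l pHl x; rewrite [leLHS]bf0m; exact: psdmx_ge0.
    split; last exact: H0.
    move=> i; rewrite leqn0 => /eqP ->.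
    apply: filterS (H3) => l; apply: Psi3_anti.
    - by rewrite /= (Eop_cst g_measurable g_ge0 G_density) trmx0.
    - by case: (psdE l bH pH).
    - by move=> x; apply: leE; [exact: ebmx_cst|exact: bH|apply: filterS H0 => t].
  have IH3' i : (i < k.+1)%N ->
    {ae mu, forall l, psdmx (Psi3 (riccati_iter Q i) l - eta%:M)}.
    by rewrite ltnS; exact: IH3.
  have [bk pk] := riccati_iter_psd bQ pQ eta0 (fun i (ik : (i < k)%N) =>
    IH3 i (ltnW ik)).
  have [bk1 pk1] := riccati_iter_psd bQ pQ eta0 IH3'.
  have le1 : {ae mu, forall l, forall x,
      bf (riccati_iter Q k.+1 l) x x <= bf (Phat l) x x}.
    apply: filterS3 (H3) (HR) (IH3 k (leqnn k)) => l H3l HRl P3l x.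
    apply: (@le_trans _ _ (bf (riccati Q Phat l) x x)).
      apply: (riccati_mono Q _ _ eta0 eta0 P3l H3l _ x).
      - by case: (psdE l bk pk).
      - by case: (psdE l bH pH).
      - by move=> y; apply: leE => //; apply: filterS IH => t.
    have := psdmx_subs_le x HRl; rewrite bf_subm.
    have : 0 <= eta * sqn x by rewrite mulr_ge0 ?sqn_ge0 // ltW.
    lra.
  split; last exact: le1.
  move=> i; rewrite leq_eqVlt => /orP[/eqP ->|]; last exact: IH3'.
  apply: filterS (H3) => l; apply: Psi3_anti.
  - by case: (psdE l bk1 pk1).
  - by case: (psdE l bH pH).
  - by move=> x; apply: leE => //; apply: filterS le1 => t.
have P3 k := (iter k).1 k (leqnn k).
have [c c0 Hc] := ebmx_bf_bound bH.
have Pc k : {ae mu, forall l, forall x, bf (riccati_iter Q k l) x x <= c * sqn x}.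
  apply: filterS2 (iter k).2 Hc => l h1 h2 x; exact: le_trans (h1 x) (h2 x).
have [P [bP pP Pmin PP3 PR]] := riccati_iter_limit bQ pQ eta0 P3 Pc.
exists P, (fun l => Phat l - P l); split => //; split => //.
- exact: ebmxB.
- have PH := Pmin _ (fun k => (iter k).2).
  apply: filterS3 PH (pP) (pH) => l PH [sP _] [sH _].
  exact: psdmx_subP.
- exact: dissipative_comparison dH bP pP eta0 PP3 PR.
Qed.

(** In terms of [w = v - gain P x] the next state is [closed_loop P x + B w]. The completed square
    for [P] leaves [w^T Psi3 w >= eta |w|^2] to spare, while [S] decreases in [x] at a cost
    [c |w|^2]. *)
Lemma stabilizing_dissipative Q P S xi eta : ebmx mu P ->
  {ae mu, forall l, psdmx (P l)} -> 0 < eta ->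
  {ae mu, forall l, psdmx (Psi3 P l - eta%:M)} ->
  {ae mu, forall l, P l = riccati Q P l} -> lyapunov (closed_loop P) S xi ->
  exists Phat e, dissipative Q Phat e.
Proof.
move=> bP pP eta0 P3 PR LS; have [bS pS xi0 _] := LS.
have [c c0 hc] := lyapunov_forced LS bB.
(* With this [k], the cost [k c |w|^2] uses half of the spare [eta |w|^2]. *)
pose k := eta / (2 * c); have k0 : 0 < k by rewrite divr_gt0 // mulr_gt0.
have bF : ebmx mu (gain P) by apply: ebmx_gain => //; exists eta.
have a0 : 0 < k * (xi / 2) by rewrite mulr_gt0 // divr_gt0.
have b0 : 0 < eta / 2 by rewrite divr_gt0.
have [e e0 he] := sqn_shift_bound bF a0 b0.
have bk : ebmx mu (fun l => k *: S l) by exact: ebmxZ.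
exists (fun l => P l + k *: S l), e; split => //.
- exact: ebmxD.
- apply: filterS2 (pP) (pS) => l [sP pP'] [sS pS']; split.
    by rewrite linearD /= linearZ /= sP sS.
  move=> x; rewrite -/(bf _ x x) bf_addm bf_scalem addr_ge0 ?pP' //.
  by rewrite mulr_ge0 ?pS' // ltW.
have h1 := ae_and hc he; have h2 := ae_and P3 PR.
apply: filterS2 (h1) (h2) => l [hcl hel] [P3l PRl] x v.
have [sE _] := psdE l bP pP.
have Sq := riccati_square Q x v sE eta0 P3l; rewrite -PRl in Sq.
rewrite addE // scaleE // !bf_addm !bf_scalem.
set w := v - gain P l *m x in Sq.
have := hcl x w; rewrite closed_loopE -addrA -mulmxDr.
have -> : gain P l *m x + w = v by rewrite addrC subrK.
move=> h.
have := ler_wpM2l (ltW k0) h; have := hel x v; rewrite -/w.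
have := psdmx_subs_le w P3l; rewrite -/w.
have kc : k * c = eta / 2 by rewrite /k; field; rewrite gt_eqF.
have : k * (c * sqn w) = eta / 2 * sqn w by rewrite mulrA kc.
lra.
Qed.

(** The maximizing input for [P'] is suboptimal for [P], so [X = P - P'] satisfies
    [X >= A'^T E(X) A'] with [A'] the closed loop of [P'], and the comparison principle applies. A
    stabilizing solution is thus the smallest one. *)
Lemma stabilizing_maximal Q P P' S xi eta eta' : ebmx mu P -> ebmx mu P' ->
  {ae mu, forall l, psdmx (P l)} -> {ae mu, forall l, psdmx (P' l)} ->
  0 < eta -> 0 < eta' ->
  {ae mu, forall l, psdmx (Psi3 P l - eta%:M)} ->
  {ae mu, forall l, psdmx (Psi3 P' l - eta'%:M)} ->
  {ae mu, forall l, P l = riccati Q P l} ->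
  {ae mu, forall l, P' l = riccati Q P' l} ->
  lyapunov (closed_loop P') S xi ->
  {ae mu, forall l, forall x, bf (P' l) x x <= bf (P l) x x}.
Proof.
move=> bP bP' pP pP' e0 e'0 P3 P3' PR PR' LS.
have : {ae mu, forall l, forall x, 0 <= bf (P l - P' l) x x}.
  apply: lyapunov_comparison LS (ebmxB bP bP') _.
  have h := ae_and P3 P3'; have h' := ae_and PR PR'.
  apply: filterS2 (h) (h') => l [P3l P3l'] [PRl PRl'] x.
  have [sE _] := psdE l bP pP; have [sE' _] := psdE l bP' pP'.
  rewrite EopB // !bf_subm closed_loopE PRl' -(riccati_attained _ _ sE' e'0 P3l').
  rewrite PRl.
  have := riccati_ge Q x (gain P' l *m x) sE e0 P3l; lra.
by apply: filterS => l h x; have := h x; rewrite bf_subm subr_ge0.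
Qed.

(** The comparison inequality is used twice: first with the comparison principle, for
    [Phat - P >= 0]; then, as its left-hand side is now nonnegative, for the lower bound [e I]. *)
Lemma dissipative_gap Q Phat e P S xi eta : dissipative Q Phat e ->
  ebmx mu P -> {ae mu, forall l, psdmx (P l)} -> 0 < eta ->
  {ae mu, forall l, psdmx (Psi3 P l - eta%:M)} ->
  {ae mu, forall l, P l = riccati Q P l} -> lyapunov (closed_loop P) S xi ->
  {ae mu, forall l, psdmx (Phat l - P l - e%:M)}.
Proof.
move=> dH bP pP eta0 P3 PR LS; have [bH pH e0 _] := dH.
have cmp := dissipative_comparison dH bP pP eta0 P3 PR.
have bX := ebmxB bH bP.
have X0 : {ae mu, forall l, forall x, 0 <= bf (Phat l - P l) x x}.
  apply: lyapunov_comparison LS bX _; apply: filterS (cmp) => l h x.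
  apply: le_trans (h x) _; rewrite gerBl.
  by apply: mulr_ge0; [exact: ltW | exact: sqn_ge0].
have pX : {ae mu, forall l, psdmx (Phat l - P l)}.
  by apply: filterS3 (X0) (pH) (pP) => l h [sH _] [sP _]; split=> //;
    rewrite linearB /= sH sP.
apply: filterS2 (cmp) (pX) => l h [sX _]; apply: psdmx_subsP => // x.
have := h x; have := psdmx_ge0 (closed_loop P l *m x) (psdE l bX pX); lra.
Qed.

End WithSystem.

End RiccatiTheory.

(** * Almost everywhere statements from initial densities *)

Section InitialDensities.
Context {R : realType} {d : measure_display} {T : measurableType d}.
Variable mu : {sigma_finite_measure set T -> \bar R}.
Hypothesis mu_neq0 : mu setT != 0%E.

Lemma initial_density_scale (f : T -> R) : measurable_fun setT f ->
  {ae mu, forall t, 0 < f t} -> mu.-integrable setT (EFin \o f) ->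
  let s := \int[mu]_t f t in
  0 < s /\ initial_density mu (fun t => f t / s).
Proof.
move=> mf f0 fi s.
have s0 : 0 <= s by apply: Rintegral_ae_ge0 => //; apply: filterS f0 => t /ltW.
have s_neq0 : s != 0.
  (* A positive function with zero integral would make [mu] the null measure. *)
  apply/eqP => s00; move/eqP: mu_neq0; apply.
  have fi0 : (\int[mu]_t `|(f t)%:E| = 0)%E.
    rewrite -[RHS]/(0%:E) -s00 /s /Rintegral fineK; last exact: integrable_fin_num.
    apply: ae_eq_integral => //.
    - by apply/measurable_EFinP; exact: measurableT_comp.
    - exact/measurable_EFinP.
    - by apply: filterS f0 => t /ltW f0 _; rewrite gee0_abs // lee_fin.
  have mfe : measurable_fun setT (EFin \o f) by exact/measurable_EFinP.
  have ff0 := (ae_eq_integral_abs mu measurableT mfe).1 fi0.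
  apply/(negligibleP mu measurableT).
  have : {ae mu, forall t : T, False}.
    apply: filterS2 f0 ff0 => t f0 /(_ I) [] ff; move: f0; by rewrite ff ltxx.
  by rewrite /almost_everywhere /prop_near1 /=; apply: negligibleS => t _ [].
have sp : 0 < s by rewrite lt_neqAle eq_sym s_neq0.
split=> //; split.
- exact: measurable_funM.
- by apply: filterS f0 => t f0; rewrite divr_gt0.
under eq_integral do rewrite EFinM.
rewrite integralZr //.
have -> : (\int[mu]_x (f x)%:E = s%:E)%E by rewrite fineK //;
  exact: integrable_fin_num.
by rewrite -EFinM divff.
Qed.

(* [sum_i 2^-(i+1) 1_{F_i} / (1 + mu F_i)], normalized, for a cover [F_i] of finite
   measure. *)
Lemma initial_density_exists : exists nu, initial_density mu nu.
Proof.
have [F FT /all_and2 [mF Ffin]] := sigma_finiteT mu.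
pose a i : R := 2 ^- i.+1 / (1 + fine (mu (F i))).
have den i : 1 <= 1 + fine (mu (F i)) by rewrite lerDl fine_ge0.
have den0 i : 0 < 1 + fine (mu (F i)) by exact: lt_le_trans ltr01 (den i).
have a0 i : 0 < a i by rewrite divr_gt0 // invr_gt0 exprn_gt0.
(* The geometric sum, read off from [epsilon_trick] for the zero sequence. *)
have half_sum : (\sum_(0 <= i <oo) (2 ^- i.+1 : R)%:E <= 1)%E.
  have := @epsilon_trick R (fun=> 0%E) 1 xpredT (fun=> lexx _) ler01.
  rewrite [X in (_ <= X + _)%E]eseries0 // add0e; apply: le_trans.
  by apply: lee_nneseries => i _;
    rewrite ?add0e lee_fin ?natrX ?div1r // invr_ge0 exprn_ge0.
pose h i t := (a i * \1_(F i) t)%:E.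
have h0 i t : (0 <= h i t)%E by rewrite lee_fin mulr_ge0 // ltW.
pose fe t := (\sum_(0 <= i <oo) h i t)%E.
have fe1 t : (fe t <= 1)%E.
  apply: le_trans half_sum; apply: lee_nneseries => // i _.
  rewrite lee_fin; apply: (@le_trans _ _ (a i)).
    apply: ler_piMr; first exact: ltW.
    by rewrite indicE; case: (_ \in _).
  by rewrite ler_pdivrMr // ler_peMr // invr_ge0 exprn_ge0.
have fe_fin t : fe t \is a fin_num.
  rewrite ge0_fin_numE; first by apply: le_lt_trans (fe1 t) _; exact: ltry.
  exact: nneseries_ge0.
have fe_gt0 t : (0 < fe t)%E.
  have [i _ Fi] : (\bigcup_i F i) t by rewrite -FT.
  apply: (@lt_le_trans _ _ (h i t)).
    by rewrite lte_fin indicE mem_set // mulr1.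
  rewrite /fe (nneseriesD1 (n := i)) // leeDl //; exact: nneseries_ge0.
have mh i : measurable_fun setT (h i).
  by apply/measurable_EFinP; apply: measurable_funM => //; exact: measurable_indic.
have mfe : measurable_fun setT fe by apply: (@ge0_emeasurable_sum _ _ _ _ h xpredT).
pose f t := fine (fe t).
have fE t : (f t)%:E = fe t by rewrite fineK.
have mf : measurable_fun setT f by exact: (measurableT_comp (fine_measurable
  measurableT)).
have fi : mu.-integrable setT (EFin \o f).
  apply/integrableP; split; first exact/measurable_EFinP.
  have -> : (\int[mu]_x `|(EFin \o f) x| = \int[mu]_x fe x)%E.
    apply: eq_integral => t _; rewrite -[X in `|X|%E]/((f t)%:E) fE gee0_abs //.
    exact: ltW.
  rewrite integral_nneseries //; apply: le_lt_trans (ltry 1).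
  apply: le_trans half_sum; apply: lee_nneseries => [i _ _|i _].
    by apply: integral_ge0 => t _.
  under eq_integral do rewrite /h EFinM.
  rewrite ge0_integralZl //; last 2 first.
  - by apply/measurable_EFinP; exact: measurable_indic.
  - by rewrite lee_fin ltW.
  rewrite integral_indic // setIT -[X in (_ * X <= _)%E]fineK; last first.
    by rewrite ge0_fin_numE; [exact: Ffin|exact: measure_ge0].
  rewrite -EFinM lee_fin /a mulrAC ler_pdivrMr // ler_wpM2l ?invr_ge0 ?exprn_ge0 //.
  by rewrite lerDr.
have f0 : {ae mu, forall t, 0 < f t}.
  by apply: nearW => t; rewrite -lte_fin fE.
have [_ h1] := initial_density_scale mf f0 fi.
by eexists; exact: h1.
Qed.

(* Reweight a fixed density by [1 + s 1_{f < 0}] and let [s] grow. *)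
Lemma ae_ge0_initial_density (f : T -> R) c : measurable_fun setT f ->
  {ae mu, forall t, `|f t| <= c} ->
  (forall nu, initial_density mu nu -> 0 <= \int[mu]_t (f t * nu t)) ->
  {ae mu, forall t, 0 <= f t}.
Proof.
move=> mf fc H; have [nu nuP] := initial_density_exists.
have [mnu nu0 nu1] := nuP.
have nui : mu.-integrable setT (EFin \o nu).
  apply/integrableP; split; first exact/measurable_EFinP.
  have -> : (\int[mu]_x `|(EFin \o nu) x| = \int[mu]_x (nu x)%:E)%E;
    last by rewrite nu1 ltry.
  apply: ae_eq_integral => //.
  - by apply/measurable_EFinP; exact: measurableT_comp.
  - exact/measurable_EFinP.
  - by apply: filterS nu0 => t /ltW nu0 _; rewrite gee0_abs // lee_fin.
pose B := [set t | f t < 0].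
have mB : measurable B.
  have -> : B = setT `&` f @^-1` `]-oo, 0[%classic; last exact: mf.
  by rewrite setTI; apply/seteqP; split=> t; rewrite /B /= in_itv.
have m1 : measurable_fun setT (\1_B : T -> R) by exact: measurable_indic.
have if1 : mu.-integrable setT (EFin \o (fun t => nu t * f t)).
  exact: integrable_mul_bounded fc nui.
have if2 : mu.-integrable setT (EFin \o (fun t => nu t * (- f t * \1_B t))).
  apply: (@integrable_mul_bounded _ _ _ _ _ _ c) => //.
    by apply: measurable_funM => //; exact: measurable_funN.
  apply: filterS fc => t fc; rewrite normrM normrN indicE.
  by case: (_ \in _); rewrite ?normr1 ?mulr1 // normr0 mulr0 (le_trans _ fc).
pose j := \int[mu]_t (nu t * (- f t * \1_B t)).
(* [j] is the mean of the negative part. Testing with the density proportional to [nu (1 + s 1_B)]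
   bounds [s j] by a number independent of [s], which forces [j = 0]. *)
have jle s : 0 <= s -> s * j <= \int[mu]_t (nu t * f t).
  move=> s0; pose w t := nu t * (1 + s * \1_B t).
  have mw : measurable_fun setT w.
    by apply: measurable_funM => //; apply: measurable_funD => //;
      exact: measurable_funM.
  have w1 t : 1 <= 1 + s * \1_B t by rewrite lerDl mulr_ge0.
  have w0 : {ae mu, forall t, 0 < w t}.
    by apply: filterS nu0 => t nu0; rewrite mulr_gt0 // (lt_le_trans ltr01).
  have wi : mu.-integrable setT (EFin \o w).
    apply: (@integrable_mul_bounded _ _ _ _ _ _ (1 + s)) => //.
      by apply: measurable_funD => //; exact: measurable_funM.
    apply: nearW => t; rewrite ger0_norm ?(le_trans ler01) // lerD2l.
    by rewrite ler_piMr // indicE; case: (_ \in _).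
  have [sw0 /H] := initial_density_scale mw w0 wi.
  set sw := \int[mu]_t w t in sw0 *.
  have -> : \int[mu]_t (f t * (w t / sw)) = (\int[mu]_t (nu t * f t) - s * j) / sw.
    rewrite -RintegralZl // -RintegralB //; last exact: integrable_scaler.
    rewrite -RintegralZr //; last first.
      have := integrableB measurableT if1 (integrable_scaler s if2).
      by apply: eq_integrable => // t _ /=; rewrite -EFinB.
    by apply: eq_Rintegral => t _; rewrite /w; ring.
  by rewrite pmulr_lge0 ?invr_gt0 // subr_ge0.
have j0 : 0 <= j.
  apply: Rintegral_ae_ge0.
    apply: measurable_funM => //; apply: measurable_funM => //.
    exact: measurable_funN.
  apply: filterS nu0 => t /ltW nu0; rewrite mulr_ge0 // indicE.
  case: (boolP (t \in B)) => [|_]; last by rewrite mulr0.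
  by rewrite inE /= => /ltW ft; rewrite mulr1 oppr_ge0.
have j00 : j = 0.
  apply/eqP; rewrite eq_le j0 andbT leNgt; apply/negP => jp.
  set I := \int[mu]_t (nu t * f t) in jle.
  have := jle ((`|I| + 1) / j); rewrite mulfVK ?gt_eqF // => h.
  have := h (divr_ge0 (addr_ge0 (normr_ge0 _) ler01) j0).
  have := ler_norm I; lra.
have mj : measurable_fun setT (fun t => nu t * (- f t * \1_B t)).
  by apply: measurable_funM => //; apply: measurable_funM => //;
    exact: measurable_funN.
have j_eq0 : (\int[mu]_t `|(nu t * (- f t * \1_B t))%:E| = 0)%E.
  rewrite -[RHS]/(0%:E) -j00 /j /Rintegral fineK; last exact: integrable_fin_num.
  apply: ae_eq_integral => //.
  - by apply/measurable_EFinP; exact: measurableT_comp.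
  - exact/measurable_EFinP.
  apply: filterS nu0 => t /ltW nu0 _; rewrite gee0_abs // lee_fin mulr_ge0 // indicE.
  case: (boolP (t \in B)) => [|_]; last by rewrite mulr0.
  by rewrite inE /= => /ltW ft; rewrite mulr1 oppr_ge0.
have mje : measurable_fun setT (fun t => (nu t * (- f t * \1_B t))%:E).
  exact/measurable_EFinP.
have h0 := (ae_eq_integral_abs mu measurableT mje).1 j_eq0.
apply: filterS2 nu0 h0 => t nu0 /(_ I) [] h.
rewrite leNgt; apply/negP => ft; move: h.
rewrite indicE mem_set // mulr1 => /eqP; rewrite mulf_eq0 oppr_eq0.
by rewrite gt_eqF //= lt_eqF.
Qed.

End InitialDensities.

(** * Reduction to rational vectors *)

Section RationalDensity.
Context {R : realType}.

Lemma bf_ge0_rat n (M : 'M[R]_n) :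
  (forall q : 'cV[rat]_n, 0 <= bf M (map_mx ratr q) (map_mx ratr q)) ->
  forall x, 0 <= bf M x x.
Proof.
move=> Mq x.
have approx (k : nat) (i : 'I_n) : {q : rat | x i 0 <= ratr q <= x i 0 + k.+1%:R^-1}.
  apply: cid.
  have [|q] := @rat_in_itvoo R (x i 0) (x i 0 + k.+1%:R^-1).
    by rewrite ltrDl invr_gt0.
  by rewrite in_itv /= => /andP[/ltW h1 /ltW h2]; exists q; rewrite h1 h2.
pose q k : 'cV[rat]_n := \col_i sval (approx k i).
have qx i : (map_mx ratr (q k) : 'cV[R]_n) i 0 @[k --> \oo] --> x i 0.
  apply: (@squeeze_cvgr _ _ _ _ (fun=> x i 0) (fun k => x i 0 + k.+1%:R^-1)).
  - by apply: nearW => k; rewrite !mxE; exact: (svalP (approx k i)).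
  - exact: cvg_cst.
  - rewrite -[X in _ --> X]addr0; apply: cvgD; first exact: cvg_cst.
    exact: cvg_harmonic.
have lim : bf M (map_mx ratr (q k)) (map_mx ratr (q k)) @[k --> \oo] --> bf M x x.
  rewrite bfE; under eq_fun do rewrite bfE.
  apply: cvg_sumr => i; apply: cvg_sumr => j.
  by apply: cvgMr_tmp; apply: cvgM.
by apply: (cvgr_to_ge lim); exact: nearW.
Qed.

(** The null set depends on [x]. The countably many rational vectors, enumerated by [unpickle],
    share one, and continuity of the form covers the other vectors. *)
Lemma ae_bf_ge0 {d} {T : measurableType d} (mu : {measure set T -> \bar R})
  n (F : T -> 'M[R]_n) :
  (forall x, {ae mu, forall t, 0 <= bf (F t) x x}) ->
  {ae mu, forall t, forall x, 0 <= bf (F t) x x}.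
Proof.
move=> Fx.
have : {ae mu, forall t, forall k, forall q : 'cV[rat]_n, unpickle k = Some q ->
    0 <= bf (F t) (map_mx ratr q) (map_mx ratr q)}.
  apply/ae_foralln => k; case: (unpickle k) => [q|].
    by apply: filterS (Fx (map_mx ratr q)) => t h _ [<-].
  exact: nearW.
apply: filterS => t h; apply: bf_ge0_rat => q.
by apply: (h (pickle q)); rewrite pickleK.
Qed.

End RationalDensity.

(** * Trajectories *)

Section Processes.
Context {R : realType} {d : measure_display} {T : measurableType d}.
Variables (mu : {sigma_finite_measure set T -> \bar R}) (G : R.-pker T ~> T).
Variable (g : T -> T -> R).
Hypothesis g_measurable : measurable_fun setT (fun p : T * T => g p.1 p.2).
Hypothesis g_ge0 : forall l t, 0 <= g l t.
Hypothesis G_density : forall l L, measurable L ->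
  G l L = (\int[mu]_(t in L) (g l t)%:E)%E.
Context {d' : measure_display} {Omega : measurableType d'}.
Variable M : markov_chain mu G Omega.
Local Notation E := (Eop mu g).
Local Notation th := (chain M).
Notation history_type k := (g_sigma_algebraType (history th k)).

Section FixedLaw.
Variable nu : T -> R.
Hypothesis nuP : initial_density mu nu.
Let P := law M nu.
Let Pfin : (P setT < +oo)%E. Proof. by rewrite probability_setT ltry. Qed.

Let chainP k (Q : T -> Prop) : {ae mu, forall t, Q t} -> {ae P, forall w, Q (th k w)}.
Proof. exact: (chain_ae g_measurable G_density M nuP). Qed.

(** Adaptedness is what [history_step] requires; second moments make quadratic expressions with
    essentially bounded coefficients integrable. *)
Definition sqint k m (x : Omega -> 'cV[R]_m) : Prop :=
  @measurable_mx R _ (history_type k) m 1 x /\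
  forall i, P.-integrable setT (EFin \o (fun w => x w i 0 ^+ 2)).

Lemma sqint_measurable k m (x : Omega -> 'cV[R]_m) i : sqint k x ->
  measurable_fun setT (fun w => x w i 0).
Proof. by move=> [mx _]; exact: (measurable_fun_history (M := M) (mx i 0)). Qed.

Lemma sqint_cst k m (c : 'cV[R]_m) : sqint k (fun=> c).
Proof.
split=> [i j|i]; first exact: measurable_cst.
by apply: (@integrable_ae_bounded _ _ _ _ Pfin _ `|c i 0 ^+ 2|) => //; exact: nearW.
Qed.

Lemma sqintS k m (x : Omega -> 'cV[R]_m) : sqint k x -> sqint k.+1 x.
Proof. by move=> [mx ix]; split=> // i j;
  exact: (measurable_historyS (M := M) (mx i j)). Qed.

Lemma sqintD k m (x y : Omega -> 'cV[R]_m) : sqint k x -> sqint k y ->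
  sqint k (fun w => x w + y w).
Proof.
move=> sx sy; split=> [i j|i].
  by under eq_fun do rewrite mxE; apply: measurable_funD; [exact: sx.1|exact: sy.1].
under [X in EFin \o X]eq_fun do rewrite mxE.
by apply: integrable_sqr_add;
  [exact: sqint_measurable sx|exact: sqint_measurable sy|exact: sx.2|exact: sy.2].
Qed.

Lemma measurable_chain_mx k n m (F : T -> 'M[R]_(n, m)) i j : measurable_mx F ->
  measurable_fun [set: history_type k] (fun w => F (th k w) i j).
Proof.
move=> mF; exact: (measurableT_comp (mF i j) (measurable_chain_history (M := M)
  (k := k))).
Qed.

Lemma sqint_mulmx k n m (F : T -> 'M[R]_(n, m)) (x : Omega -> 'cV[R]_m) :
  ebmx mu F -> sqint k x -> sqint k (fun w => F (th k w) *m x w).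
Proof.
move=> bF sx; have [mF [c Fc]] := bF; split=> [i j|i].
  under eq_fun do rewrite mxE; apply: measurable_sum => a.
  apply: measurable_funM; first exact: measurable_chain_mx.
  exact: sx.1.
have mF' a : measurable_fun setT (fun w => F (th k w) i a).
  exact: (measurableT_comp (mF i a) (chain_measurable M k)).
have msum (s : seq 'I_m) : measurable_fun setT (fun w =>
  \sum_(a <- s) F (th k w) i a * x w a 0).
  by apply: measurable_sum => a; apply: measurable_funM => //;
    exact: sqint_measurable sx.
under [X in EFin \o X]eq_fun do rewrite mxE.
elim: (index_enum _) => [|a s IH].
  under [X in EFin \o X]eq_fun do rewrite big_nil.
  by apply: (@integrable_ae_bounded _ _ _ _ Pfin _ `|0 ^+ 2|) => //; exact: nearW.
under [X in EFin \o X]eq_fun do rewrite big_cons.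
apply: integrable_sqr_add => //.
  by apply: measurable_funM => //; exact: sqint_measurable sx.
apply: (integrable_sqr_mul_bounded (c := c)) => //; last exact: sx.2.
  exact: sqint_measurable sx.
by have := chainP k Fc; apply: filterS => w.
Qed.

Lemma integrable_chain_bf k j n m (F : T -> 'M[R]_(n, m)) x y : ebmx mu F ->
  sqint k x -> sqint k y ->
  P.-integrable setT (EFin \o (fun w => bf (F (th j w)) (x w) (y w))).
Proof.
move=> bF sx sy; have [mF [c Fc]] := bF.
under [X in EFin \o X]eq_fun do rewrite bfE.
apply: integrable_sumr => a; apply: integrable_sumr => b.
apply: (integrable_mul_bounded (c := c)).
- exact: (measurableT_comp (mF a b) (chain_measurable M j)).
- by have := chainP j Fc; apply: filterS => w.
apply: integrable_sqr_mul;
  [exact: sqint_measurable sx|exact: sqint_measurable sy|exact: sx.2|exact: sy.2].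
Qed.

(** The Markov property, applied to each product [x_a x_b]: the vector [x] is known at time [k], one
    step before the argument of [F]. *)
Lemma expectation_step k n (F : T -> 'M[R]_n) x : ebmx mu F -> sqint k x ->
  \int[P]_w bf (F (th k.+1 w)) (x w) (x w) = \int[P]_w bf (E F (th k w)) (x w) (x w).
Proof.
move=> bF sx; have [mF [c Fc]] := bF.
have bEF := ebmx_Eop g_measurable g_ge0 G_density bF.
have xx a b : P.-integrable setT (EFin \o (fun w => x w a 0 * x w b 0)).
  by apply: integrable_sqr_mul;
    [exact: sqint_measurable sx|exact: sqint_measurable sx|exact: sx.2|exact: sx.2].
have Fi (H : T -> 'M[R]_n) j a b : ebmx mu H ->
    P.-integrable setT (EFin \o (fun w => x w a 0 * x w b 0 * H (th j w) a b)).
  move=> [mH [e He]]; apply: (integrable_mul_bounded (c := e)) => //.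
    exact: (measurableT_comp (mH a b) (chain_measurable M j)).
  by have := chainP j He; apply: filterS => w.
under eq_Rintegral do rewrite bfE.
under [RHS]eq_Rintegral do rewrite bfE.
rewrite !Rintegral_sum; try by move=> a; apply: integrable_sumr => b; exact: Fi.
apply: eq_bigr => a _.
rewrite !Rintegral_sum; try by move=> b; exact: Fi.
apply: eq_bigr => b _.
rewrite (history_step g_measurable g_ge0 G_density nuP (c := c) (mF a b)) //.
- by apply: eq_Rintegral => w _; rewrite (EopE g_measurable g_ge0 G_density).
- by apply: filterS Fc => t.
- by apply: measurable_funM; exact: sx.1.
Qed.

Lemma expectation0 n (F : T -> 'M[R]_n) x : ebmx mu F ->
  \int[P]_w bf (F (th 0%N w)) x x = \int[mu]_t (bf (F t) x x * nu t).
Proof.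
move=> [mF _]; apply: (chain0_integral M nuP (p := fun t => bf (F t) x x)).
under eq_fun do rewrite bfE.
by apply: measurable_sum => i; apply: measurable_sum => j; exact: measurable_funM.
Qed.

Section OneStep.
Context (n r : nat) (A : T -> 'M[R]_n) (B : T -> 'M[R]_(n, r)).
Hypothesis bA : ebmx mu A.
Hypothesis bB : ebmx mu B.
Variables (S S' Q1 : T -> 'M[R]_n) (Q2 : T -> 'M[R]_r).
Hypothesis bS : ebmx mu S.
Hypothesis bS' : ebmx mu S'.
Hypothesis bQ1 : ebmx mu Q1.
Hypothesis bQ2 : ebmx mu Q2.
Variables (k : nat) (x : Omega -> 'cV[R]_n) (v : Omega -> 'cV[R]_r).
Hypothesis sx : sqint k x.
Hypothesis sv : sqint k v.
Let next w := A (th k w) *m x w + B (th k w) *m v w.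

(** The state at time [k + 1] is measurable at time [k]. This delay is what lets [expectation_step]
    act along trajectories. *)
Lemma sqint_next : sqint k next.
Proof. by apply: sqintD; exact: sqint_mulmx. Qed.

Let bES : ebmx mu (E S). Proof. exact: (ebmx_Eop g_measurable g_ge0 G_density). Qed.
Let i1 := integrable_chain_bf k bES sqint_next sqint_next.
Let i2 := integrable_chain_bf k bQ1 sx sx.
Let i3 := integrable_chain_bf k bQ2 sv sv.
Let i4 := integrable_chain_bf k bS' sx sx.

Lemma expectation_next :
  \int[P]_w bf (S (th k.+1 w)) (next w) (next w) +
  (\int[P]_w bf (Q1 (th k w)) (x w) (x w) + \int[P]_w bf (Q2 (th k w)) (v w) (v w))
  = \int[P]_w (bf (E S (th k w)) (next w) (next w) +
      (bf (Q1 (th k w)) (x w) (x w) + bf (Q2 (th k w)) (v w) (v w))).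
Proof.
rewrite expectation_step //; last exact: sqint_next.
rewrite [RHS]RintegralD //; last exact: integrable_addr.
by rewrite RintegralD.
Qed.

Lemma expectation_next_le :
  {ae P, forall w, bf (E S (th k w)) (next w) (next w) +
      (bf (Q1 (th k w)) (x w) (x w) + bf (Q2 (th k w)) (v w) (v w))
    <= bf (S' (th k w)) (x w) (x w)} ->
  \int[P]_w bf (S (th k.+1 w)) (next w) (next w) +
  (\int[P]_w bf (Q1 (th k w)) (x w) (x w) + \int[P]_w bf (Q2 (th k w)) (v w) (v w))
  <= \int[P]_w bf (S' (th k w)) (x w) (x w).
Proof.
move=> h; rewrite expectation_next; apply: le_ae_Rintegral => //.
by apply: integrable_addr => //; exact: integrable_addr.
Qed.

Lemma expectation_next_ge :
  {ae P, forall w, bf (S' (th k w)) (x w) (x w) <=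
     bf (E S (th k w)) (next w) (next w) +
      (bf (Q1 (th k w)) (x w) (x w) + bf (Q2 (th k w)) (v w) (v w))} ->
  \int[P]_w bf (S' (th k w)) (x w) (x w) <=
  \int[P]_w bf (S (th k.+1 w)) (next w) (next w) +
  (\int[P]_w bf (Q1 (th k w)) (x w) (x w) + \int[P]_w bf (Q2 (th k w)) (v w) (v w)).
Proof.
move=> h; rewrite expectation_next; apply: le_ae_Rintegral => //.
by apply: integrable_addr => //; exact: integrable_addr.
Qed.

End OneStep.

Section Trajectories.
Context (n r : nat) (A : T -> 'M[R]_n) (B : T -> 'M[R]_(n, r)).
Hypothesis bA : ebmx mu A.
Hypothesis bB : ebmx mu B.
Variables (x0 : 'cV[R]_n) (v : nat -> Omega -> 'cV[R]_r).
Hypothesis sv : forall k, sqint k (v k).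
Local Notation x := (state M A B x0 v).

Lemma sqint_state k : sqint k (x k).
Proof.
elim: k => [|k IH]; first exact: sqint_cst.
by apply: sqintS; exact: sqint_next.
Qed.

(* A quadratic dissipation inequality telescopes along every trajectory. *)
Lemma dissipation_sum (S Q1 : T -> 'M[R]_n) (Q2 : T -> 'M[R]_r) N :
  ebmx mu S -> ebmx mu Q1 -> ebmx mu Q2 ->
  {ae mu, forall l, forall x v,
    bf (E S l) (A l *m x + B l *m v) (A l *m x + B l *m v) +
    (bf (Q1 l) x x + bf (Q2 l) v v) <= bf (S l) x x} ->
  \int[P]_w bf (S (th N w)) (x N w) (x N w) +
  \sum_(k < N) (\int[P]_w bf (Q1 (th k w)) (x k w) (x k w) +
                \int[P]_w bf (Q2 (th k w)) (v k w) (v k w))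
  <= \int[P]_w bf (S (th 0%N w)) x0 x0.
Proof.
move=> bS bQ1 bQ2 h; elim: N => [|N IH]; first by rewrite big_ord0 addr0.
apply: le_trans IH; rewrite big_ord_recr /= addrA addrAC lerD2r.
apply: expectation_next_le => //; first exact: sqint_state.
by have := chainP N h; apply: filterS => w.
Qed.

End Trajectories.

Lemma integrable_sqn k m (x : Omega -> 'cV[R]_m) : sqint k x ->
  P.-integrable setT (EFin \o (fun w => sqn (x w))).
Proof.
move=> sx; have := integrable_chain_bf 0 (ebmx_cst mu 1%:M) sx sx.
by apply: eq_integrable => // w _ /=; rewrite bf1.
Qed.

Lemma expectation_enorm k m (x : Omega -> 'cV[R]_m) : sqint k x ->
  ('E_P[(fun w => enorm (x w) ^+ 2)%R] = (\int[P]_w sqn (x w))%:E)%E.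
Proof.
move=> sx; rewrite unlock fineK; last first.
  exact: (integrable_fin_num measurableT (integrable_sqn sx)).
by apply: eq_integral => w _; rewrite enorm_sqr.
Qed.

Lemma Rintegral_bf_scalar a m (x : Omega -> 'cV[R]_m) k : sqint k x ->
  \int[P]_w bf a%:M (x w) (x w) = a * \int[P]_w sqn (x w).
Proof.
move=> sx; rewrite -RintegralZl //; last exact: integrable_sqn sx.
by apply: eq_Rintegral => w _; rewrite bf_scalar.
Qed.

Lemma Rintegral_probability (c : R) : \int[P]_w c = c.
Proof.
rewrite Rintegral_cst //; transitivity (c * fine 1%E); last by rewrite /= mulr1.
congr (_ * fine _); exact: (probability_setT (law M nu)).
Qed.

Lemma integrable_constant (c : R) : P.-integrable setT (EFin \o (fun=> c)).
Proof.
by apply: (@integrable_ae_bounded _ _ _ _ Pfin _ `|c|) => //; exact: nearW.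
Qed.

Lemma expectation_bf_ge0 k j n (F : T -> 'M[R]_n) x : ebmx mu F -> sqint k x ->
  {ae mu, forall l, psdmx (F l)} -> 0 <= \int[P]_w bf (F (th j w)) (x w) (x w).
Proof.
move=> bF sx pF; apply: Rintegral_ae_ge0.
  by apply/measurable_EFinP; exact: measurable_int (integrable_chain_bf j bF sx sx).
by have := chainP j pF; apply: filterS => w; exact: psdmx_ge0.
Qed.

Lemma expectation_bf_le k j n (F H : T -> 'M[R]_n) x : ebmx mu F -> ebmx mu H ->
  sqint k x -> {ae mu, forall l, forall y, bf (F l) y y <= bf (H l) y y} ->
  \int[P]_w bf (F (th j w)) (x w) (x w) <= \int[P]_w bf (H (th j w)) (x w) (x w).
Proof.
move=> bF bH sx FH; apply: le_ae_Rintegral.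
- by apply: (integrable_chain_bf _ _ sx sx).
- by apply: (integrable_chain_bf _ _ sx sx).
- by have := chainP j FH; apply: filterS => w.
Qed.

End FixedLaw.

(** The return from expectations to pointwise inequalities: for one deterministic [x] by varying the
    initial density, then for all [x] by [ae_bf_ge0]. *)
Lemma law_bf_ge0 n (F : T -> 'M[R]_n) : mu setT != 0%E -> ebmx mu F ->
  (forall nu, initial_density mu nu -> forall x,
    0 <= \int[law M nu]_w bf (F (th 0%N w)) x x) ->
  {ae mu, forall l, forall x, 0 <= bf (F l) x x}.
Proof.
move=> mu0 bF H; apply: ae_bf_ge0 => x.
have [a a0 Fa] := ebmx_bf_bound bF; have [b b0 Fb] := ebmx_bf_bound (ebmxN bF).
have m : measurable_fun setT (fun t => bf (F t) x x).
  under eq_fun do rewrite bfE; apply: measurable_sum => i; apply: measurable_sum => j.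
  by apply: measurable_funM => //; exact: bF.1.
apply: (ae_ge0_initial_density mu0 (c := (a + b) * sqn x)) => //.
  apply: filterS2 Fa Fb => t /(_ x) h1 /(_ x); rewrite bf_oppm => h2.
  have := mulr_ge0 (ltW a0) (sqn_ge0 x); have := mulr_ge0 (ltW b0) (sqn_ge0 x).
  by move=> h3 h4; rewrite ler_norml; apply/andP; split; lra.
by move=> nu nuP; rewrite -(expectation0 nuP) //; exact: H.
Qed.

Lemma autonomous_stateE n (A : T -> 'M[R]_n) r (B : T -> 'M[R]_(n, r)) x0 k w :
  autonomous_state M A x0 k w = state M A B x0 (fun _ _ => 0) k w.
Proof. by elim: k => //= k ->; rewrite mulmx0 addr0. Qed.

Lemma sqint_autonomous nu n (A : T -> 'M[R]_n) x0 k : initial_density mu nu ->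
  ebmx mu A -> sqint nu k (autonomous_state M A x0 k).
Proof.
move=> nuP bA.
have -> : autonomous_state M A x0 k =
    state M A (fun=> (0 : 'M[R]_(n, 0))) x0 (fun _ _ => 0) k.
  by apply/funext => w; exact: autonomous_stateE.
apply: sqint_state => // [|j]; first exact: ebmx_cst.
exact: sqint_cst.
Qed.

Lemma lyapunov_EMSS n (A S : T -> 'M[R]_n) xi : ebmx mu A ->
  lyapunov mu g A S xi -> EMSS M A.
Proof.
move=> bA LS; have [bS pS xi0 _] := LS.
have [q q01 Sq] := lyapunov_contraction LS.
have [c c0 Sc] := ebmx_bf_bound bS.
have Sxi := lyapunov_coercive g_measurable g_ge0 G_density LS.
(* The mean of [x^T S x] contracts by [q] at each step, and [xi I <= S <= c I] converts this into a
   bound on the mean square. *)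
exists (c / xi), q; split => // [|nu nuP x0 k]; first by rewrite divr_gt0.
have sx j := sqint_autonomous x0 j nuP bA.
rewrite (expectation_enorm nuP (sx k)) lee_fin.
have h : \int[law M nu]_w bf (S (th k w)) (autonomous_state M A x0 k w)
    (autonomous_state M A x0 k w) <= q ^+ k * (c * sqn x0).
  elim: k => [|k IH] /=.
    rewrite expr0 mul1r -[leRHS](Rintegral_probability nu).
    apply: le_ae_Rintegral.
    - exact: (integrable_chain_bf nuP 0 bS (sqint_cst nu 0 x0) (sqint_cst nu 0 x0)).
    - exact: integrable_constant.
    - by have := chain_ae g_measurable G_density M nuP 0 Sc; apply: filterS => w.
  apply: (@le_trans _ _ (q * \int[law M nu]_w bf (S (th k w))
      (autonomous_state M A x0 k w) (autonomous_state M A x0 k w))); last first.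
    rewrite exprS -mulrA ler_wpM2l //; by case/andP: q01 => /ltW.
  rewrite (expectation_step nuP bS (x := fun w =>
    A (th k w) *m autonomous_state M A x0 k w)); last first.
    exact: sqint_mulmx.
  have i1 := integrable_chain_bf nuP k bS (sx k) (sx k).
  rewrite -RintegralZl //.
  apply: le_ae_Rintegral.
  - have bES := ebmx_Eop g_measurable g_ge0 G_density bS.
    have s1 := sqint_mulmx nuP bA (sx k).
    exact: (integrable_chain_bf nuP k bES s1 s1).
  - exact: integrable_scaler.
  - by have := chain_ae g_measurable G_density M nuP k Sq; apply: filterS => w.
rewrite mulrAC -mulrA -(ler_pM2l xi0).
have -> : xi * (c / xi * (enorm x0 ^+ 2 * q ^+ k)) = q ^+ k * (c * sqn x0).
  by rewrite enorm_sqr; field; rewrite gt_eqF.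
apply: le_trans h.
rewrite -(Rintegral_bf_scalar nuP xi (sx k)).
apply: (expectation_bf_le nuP k (ebmx_cst mu xi%:M) bS (sx k)).
by apply: filterS Sxi => l h y; rewrite bf_scalar.
Qed.

(** The iterates [T^k(I)] of [T(P) = A^T E(P) A], which represent the mean square of the state [k]
    steps later. *)
Fixpoint Lyapunov_iter n (A : T -> 'M[R]_n) k : T -> 'M[R]_n :=
  if k is k'.+1 then fun l => (A l)^T *m E (Lyapunov_iter A k') l *m A l
  else fun=> 1%:M.

Lemma ebmx_Lyapunov_iter n (A : T -> 'M[R]_n) k : ebmx mu A ->
  ebmx mu (Lyapunov_iter A k) /\ {ae mu, forall l, psdmx (Lyapunov_iter A k l)}.
Proof.
move=> bA; elim: k => [|k [bI pI]] /=.
  by split; [exact: ebmx_cst|apply: nearW => l; exact: psdmx1].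
split.
  by do 2 apply: ebmxM => //;
    [exact: ebmx_tr|exact: (ebmx_Eop g_measurable g_ge0 G_density bI)].
apply: nearW => l; have [sE pE] := Eop_psd g_measurable g_ge0 G_density l bI pI.
split; first by rewrite !trmx_mul trmxK sE mulmxA.
by move=> x; rewrite -/(bf _ x x) bf_mulm; exact: pE.
Qed.

(** Duality: each application of [T] is exchanged for one time step of the state, so the induction
    on [j] has to vary [k]. *)
Lemma Lyapunov_iter_expectation nu n (A : T ->
  'M[R]_n) x0 j k : initial_density mu nu ->
  ebmx mu A ->
  \int[law M nu]_w bf (Lyapunov_iter A j (th k w)) (autonomous_state M A x0 k w)
     (autonomous_state M A x0 k w)
  = \int[law M nu]_w sqn (autonomous_state M A x0 (k + j) w).
Proof.
move=> nuP bA; elim: j k => [|j IH] k.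
  by rewrite addn0; apply: eq_Rintegral => w _; rewrite /= bf1.
rewrite addnS -addSn -IH /=.
have [bI _] := ebmx_Lyapunov_iter j bA.
have sx := sqint_autonomous x0 k nuP bA.
rewrite (expectation_step nuP bI (sqint_mulmx nuP bA sx)).
by apply: eq_Rintegral => w _; rewrite bf_mulm.
Qed.

Lemma Eop_sum n (I : Type) (s : seq I) (F : I -> T -> 'M[R]_n) l :
  (forall i, ebmx mu (F i)) ->
  ebmx mu (fun t => \sum_(i <- s) F i t) /\
  E (fun t => \sum_(i <- s) F i t) l = \sum_(i <- s) E (F i) l.
Proof.
move=> bF; elim: s => [|i s [bs IH]].
  have -> : (fun t => \sum_(i <- [::]) F i t) = (fun=> 0).
    by apply/funext => t; rewrite big_nil.
  by rewrite big_nil (Eop_cst g_measurable g_ge0 G_density); split;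
    first exact: ebmx_cst.
have -> : (fun t => \sum_(j <- i :: s) F j t) = (fun t => F i t +
  \sum_(j <- s) F j t).
  by apply/funext => t; rewrite big_cons.
rewrite big_cons (EopD g_measurable g_ge0 G_density) // IH; split=> //.
exact: ebmxD.
Qed.

Lemma bf_sum n (I : Type) (s : seq I) (F : I -> 'M[R]_n) x y :
  bf (\sum_(i <- s) F i) x y = \sum_(i <- s) bf (F i) x y.
Proof.
by elim: s => [|i s IH]; rewrite ?big_nil ?bf0m // !big_cons bf_addm IH.
Qed.

(* With [T(P) = A^T E(P) A], the sum [I + T(I) + ... + T^(k-1)(I)] is a Lyapunov
   function as soon as [T^k(I) <= I/2]. *)
Lemma EMSS_lyapunov n (A : T -> 'M[R]_n) : mu setT != 0%E -> ebmx mu A -> EMSS M A ->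
  exists S, lyapunov mu g A S (1 / 2).
Proof.
move=> mu0 bA [b [a [b0 /andP[a0 a1] H]]].
have bI k := (ebmx_Lyapunov_iter k bA).1.
have pI k := (ebmx_Lyapunov_iter k bA).2.
have Ik k : {ae mu, forall l, forall x, bf (Lyapunov_iter A k l) x x <= b * a ^+
  k * sqn x}.
  have : {ae mu, forall l, forall x, 0 <= bf ((b * a ^+ k)%:M - Lyapunov_iter A k
    l) x x}.
    apply: law_bf_ge0 => //; first by apply: ebmxB => //; exact: ebmx_cst.
    move=> nu nuP x; have sx := sqint_autonomous x k nuP bA.
    have h := H nu nuP x k; rewrite (expectation_enorm nuP sx) lee_fin enorm_sqr in h.
    have i1 := integrable_chain_bf nuP 0 (bI k) (sqint_cst nu 0 x) (sqint_cst nu 0 x).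
    under eq_Rintegral do rewrite bf_subm.
    rewrite RintegralB //; last first.
      exact: (integrable_chain_bf nuP 0 (ebmx_cst mu (b * a ^+ k)%:M) (sqint_cst
        nu 0 x) (sqint_cst nu 0 x)).
    rewrite Rintegral_probability bf_scalar subr_ge0.
    by rewrite (Lyapunov_iter_expectation x k 0 nuP bA) add0n.
  by apply: filterS => l h x; have := h x; rewrite bf_subm bf_scalar subr_ge0.
have [k kb] : exists k, b * a ^+ k <= 1 / 2.
  have lim : b * a ^+ k @[k --> \oo] --> b * 0.
    by apply: cvgMl_tmp; apply: cvg_expr; rewrite ger0_norm ?ltW.
  have : \forall k \near \oo, b * a ^+ k < 1 / 2.
    apply: (cvgr_lt _ lim); rewrite mulr0; lra.
  by move=> [k _ h]; exists k; rewrite ltW // h /=.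
pose S l := \sum_(i <- iota 0 k) Lyapunov_iter A i l.
have bS : ebmx mu S by exact: (Eop_sum (iota 0 k) point bI).1.
exists S; split => //.
- have : {ae mu, forall l, forall i, psdmx (Lyapunov_iter A i l)} by apply/ae_foralln.
  apply: filterS => l h; split.
    by rewrite /S; elim: (iota 0 k) => [|i s IH];
      rewrite ?big_nil ?trmx0 // big_cons linearD /= IH (h i).1.
  by move=> x; rewrite -/(bf _ x x) bf_sum sumr_ge0 // => i _; exact: psdmx_ge0.
apply: filterS (Ik k) => l h x.
rewrite (Eop_sum (iota 0 k) l bI).2 !bf_sum.
have := h x; set y := b * a ^+ k * sqn x => hx.
(* Applying [T] shifts the sum by one: the term of [I] leaves and that of [T^k(I)] enters. *)
have -> : \sum_(i <- iota 0 k) bf (E (Lyapunov_iter A i) l) (A l *m x) (A l *m x) =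
    \sum_(i <- iota 0 k) bf (Lyapunov_iter A i l) x x - sqn x +
      bf (Lyapunov_iter A k l) x x.
  elim: (k) => [|m IH]; first by rewrite !big_nil /= bf1 add0r addNr.
  rewrite -addn1 iotaD !big_cat /= !big_cons !big_nil IH add0n addn1 /= bf_mulm.
  lra.
have : y <= 1 / 2 * sqn x by rewrite /y ler_wpM2r ?sqn_ge0.
lra.
Qed.

End Processes.

(** * The input-output norm *)

Section BoundedReal.
Context {R : realType} {d : measure_display} {T : measurableType d}.
Variables (mu : {sigma_finite_measure set T -> \bar R}) (G : R.-pker T ~> T).
Variable (g : T -> T -> R).
Hypothesis g_measurable : measurable_fun setT (fun p : T * T => g p.1 p.2).
Hypothesis g_ge0 : forall l t, 0 <= g l t.
Hypothesis G_density : forall l L, measurable L ->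
  G l L = (\int[mu]_(t in L) (g l t)%:E)%E.
Context {d' : measure_display} {Omega : measurableType d'}.
Variable M : markov_chain mu G Omega.
Local Notation E := (Eop mu g).
Local Notation th := (chain M).
Let chain_aeM nu (nuP : initial_density mu nu) := chain_ae g_measurable G_density
  M nuP.

Lemma state_eq n r (A : T -> 'M[R]_n) (B : T -> 'M[R]_(n, r)) x0 v v' k w :
  (forall j, (j < k)%N -> v j w = v' j w) ->
  state M A B x0 v k w = state M A B x0 v' k w.
Proof.
elim: k => //= k IH vv'; rewrite IH ?vv' // => j jk.
by apply: vv'; exact: ltnW.
Qed.

Lemma stateD n r (A : T -> 'M[R]_n) (B : T -> 'M[R]_(n, r)) x0 v k w :
  state M A B x0 v k w = state M A B x0 (fun _ _ => 0) k w + state M A B 0 v k w.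
Proof.
elim: k => [|k IH] /=; first by rewrite addr0.
by rewrite IH mulmxDr mulmx0 addr0 addrA.
Qed.

Lemma ge0_mean_sqn nu m (x : Omega -> 'cV[R]_m) : 0 <= \int[law M nu]_w sqn (x w).
Proof. by apply: Rintegral_ge0 => w _; exact: sqn_ge0. Qed.

(** Telescoping [lyapunov_forced], with weight [xi / 2] on the state and [- c] on the input, bounds
    the energy of the state uniformly in the horizon and in the initial density. *)
Lemma forced_state_bound n r (A S : T -> 'M[R]_n) (B : T -> 'M[R]_(n, r)) xi :
  ebmx mu A -> ebmx mu B -> lyapunov mu g A S xi ->
  exists2 c, 0 < c & forall nu, initial_density mu nu -> forall x0 v,
    (forall k, sqint M nu k (v k)) -> forall N,
    \sum_(k < N) \int[law M nu]_w sqn (state M A B x0 v k w) <=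
    c * (sqn x0 + \sum_(k < N) \int[law M nu]_w sqn (v k w)).
Proof.
move=> bA bB LS; have [bS pS xi0 _] := LS.
have [c c0 hc] := lyapunov_forced g_measurable g_ge0 G_density LS bB.
have [s s0 Ss] := ebmx_bf_bound bS.
exists (2 / xi * (s + c)); first by rewrite mulr_gt0 ?divr_gt0 ?addr_gt0.
move=> nu nuP x0 v sv N.
have sx k := sqint_state g_measurable G_density nuP bA bB x0 sv k.
have h := dissipation_sum g_measurable g_ge0 G_density nuP bA bB x0 sv N bS
  (ebmx_cst mu (xi / 2)%:M) (ebmx_cst mu (- c)%:M).
move: h.
have -> : \sum_(k < N) (\int[law M nu]_w bf (xi / 2)%:M (state M A B x0 v k w)
  (state M A B x0 v k w) +
     \int[law M nu]_w bf (- c)%:M (v k w) (v k w)) =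
   xi / 2 * \sum_(k < N) \int[law M nu]_w sqn (state M A B x0 v k w)
   - c * \sum_(k < N) \int[law M nu]_w sqn (v k w).
  rewrite !mulr_sumr -sumrB; apply: eq_bigr => k _.
  by rewrite (Rintegral_bf_scalar g_measurable G_density nuP _ (sx k))
    (Rintegral_bf_scalar g_measurable G_density nuP _ (sv k)) mulNr.
set X := \sum_(k < N) \int[_]_w sqn (state _ _ _ _ _ _ _).
set V := \sum_(k < N) \int[_]_w sqn (v _ _).
have V0 : 0 <= V by apply: sumr_ge0 => k _; exact: ge0_mean_sqn.
have hN := expectation_bf_ge0 g_measurable G_density nuP N bS (sx N) pS.
have h0 : \int[law M nu]_w bf (S (th 0%N w)) x0 x0 <= s * sqn x0.
  have := expectation_bf_le g_measurable G_density nuP 0 bS (ebmx_cst mu s%:M)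
    (sqint_cst M nu 0 x0).
  rewrite (Rintegral_bf_scalar g_measurable G_density nuP s (sqint_cst M nu 0
    x0)) Rintegral_probability; apply.
  by apply: filterS Ss => l h y; rewrite bf_scalar.
move=> h.
have {h} : \int[law M nu]_w bf (S (th N w)) (state M A B x0 v N w) (state M A B
  x0 v N w) +
   (xi / 2 * X - c * V) <= \int[law M nu]_w bf (S (th 0%N w)) x0 x0.
  apply: h; apply: filterS hc => l h y u; have := h y u.
  rewrite !bf_scalar; lra.
move=> h.
have h2 : xi / 2 * X <= s * sqn x0 + c * V by lra.
have -> : 2 / xi * (s + c) * (sqn x0 + V) = (xi / 2)^-1 * ((s + c) * (sqn x0 + V)).
  by field; rewrite gt_eqF.
rewrite -ler_pdivrMl ?invr_gt0 ?divr_gt0 // invrK; apply: le_trans h2 _.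
have := mulr_ge0 (ltW s0) V0; have := mulr_ge0 (ltW c0) (sqn_ge0 x0).
lra.
Qed.

(** * Square-summable inputs *)

Section L2.
Variable nu : T -> R.
Hypothesis nuP : initial_density mu nu.

Lemma mean_sqn_ereal m (v : nat -> Omega -> 'cV[R]_m) k : sqint M nu k (v k) ->
  ('E_(law M nu)[(fun w => enorm (v k w) ^+ 2)%R] =
   (\int[law M nu]_w sqn (v k w))%:E)%E.
Proof. move=> sv; exact: (expectation_enorm g_measurable G_density nuP sv). Qed.

Lemma l2_sqnormE m (v : nat -> Omega -> 'cV[R]_m) : (forall k, sqint M nu k (v k)) ->
  l2_sqnorm M nu v = (\sum_(0 <= k <oo) (\int[law M nu]_w sqn (v k w))%:E)%E.
Proof. by move=> sv; apply: eq_eseriesr => k _; rewrite mean_sqn_ereal. Qed.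

Lemma l2_sqnorm_partial m (v : nat -> Omega -> 'cV[R]_m) N :
  (forall k, sqint M nu k (v k)) ->
  ((\sum_(k < N) \int[law M nu]_w sqn (v k w))%:E <= l2_sqnorm M nu v)%E.
Proof.
move=> sv; rewrite l2_sqnormE // -sumEFin -(big_mkord xpredT
  (fun k => (\int[law M nu]_w sqn (v k w))%:E)).
by apply: nneseries_lim_ge => k _ _; rewrite lee_fin ge0_mean_sqn.
Qed.

Lemma l2_sqnorm_finite m (v : nat -> Omega -> 'cV[R]_m) N :
  (forall k, sqint M nu k (v k)) -> (forall k w, (N <= k)%N -> v k w = 0) ->
  l2_sqnorm M nu v = (\sum_(k < N) \int[law M nu]_w sqn (v k w))%:E.
Proof.
move=> sv v0; rewrite l2_sqnormE // (nneseries_split 0 N); last first.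
  by move=> k _; rewrite lee_fin ge0_mean_sqn.
rewrite add0n eseries0 ?adde0; first by rewrite big_mkord sumEFin.
move=> k Nk _; rewrite (_ : \int[_]_w _ = 0) //.
under eq_Rintegral do rewrite v0 // sqn0.
by rewrite Rintegral_cst // mul0r.
Qed.

Lemma l2_sqnorm_le m p (z : nat -> Omega -> 'cV[R]_m) (v : nat -> Omega ->
  'cV[R]_p) c :
  0 <= c -> (forall k, sqint M nu k (z k)) -> (forall k, sqint M nu k (v k)) ->
  (forall N, \sum_(k < N) \int[law M nu]_w sqn (z k w) <=
     c * \sum_(k < N) \int[law M nu]_w sqn (v k w)) ->
  (l2_sqnorm M nu z <= c%:E * l2_sqnorm M nu v)%E.
Proof.
move=> c0 sz sv h; rewrite l2_sqnormE //; apply: lime_le.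
  by apply: is_cvg_nneseries => k _ _; rewrite lee_fin ge0_mean_sqn.
apply: nearW => N; rewrite big_mkord sumEFin.
apply: (@le_trans _ _ (c * \sum_(k < N) \int[law M nu]_w sqn (v k w))%:E).
  by rewrite lee_fin.
by rewrite EFinM; apply: lee_wpmul2l; [rewrite lee_fin|exact: l2_sqnorm_partial].
Qed.

Lemma l2_seq_sqint m (v : nat -> Omega -> 'cV[R]_m) k : l2_seq M nu v ->
  sqint M nu k (v k).
Proof.
move=> [mv fin]; split=> [|i]; first exact: mv.
have mvi j : measurable_fun setT (fun w => v k w j 0).
  exact: (measurable_fun_history (M := M) (mv k j 0)).
have me : measurable_fun setT (fun w => sqn (v k w)).
  by apply: measurable_sum => j; exact: measurable_funX.
have ie : (law M nu).-integrable setT (EFin \o (fun w => sqn (v k w))).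
  apply/integrableP; split; first exact/measurable_EFinP.
  apply: le_lt_trans fin.
  have -> : (\int[law M nu]_w `|(EFin \o (fun w => sqn (v k w))) w| =
     'E_(law M nu)[(fun w => enorm (v k w) ^+ 2)%R])%E.
    rewrite unlock; apply: eq_integral => w _.
    by rewrite /= ger0_norm ?sqn_ge0 // enorm_sqr.
  have pos j : (0 <= 'E_(law M nu)[(fun w => enorm (v j w) ^+ 2)%R])%E.
    by rewrite unlock; apply: integral_ge0 => w _; rewrite lee_fin sqr_ge0.
  rewrite /l2_sqnorm (nneseriesD1 (n := k)) // leeDl //.
  by apply: nneseries_ge0.
apply: (@integrable_ae_le _ _ _ _ _ (fun w => sqn (v k w))) => //.
  exact: measurable_funX.
apply: nearW => w; rewrite !ger0_norm ?sqr_ge0 ?sqn_ge0 //; exact: entry_sqn.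
Qed.

End L2.

Context (n r : nat) (A : T -> 'M[R]_n) (B : T -> 'M[R]_(n, r)).
Context (C : T -> 'M[R]_(r, n)) (D : T -> 'M[R]_r).
Hypothesis bA : ebmx mu A.
Hypothesis bB : ebmx mu B.
Hypothesis bC : ebmx mu C.
Hypothesis bD : ebmx mu D.
Hypothesis CD0 : {ae mu, forall l, (C l)^T *m D l = 0}.

Lemma sqn_output l x v : (C l)^T *m D l = 0 ->
  sqn (C l *m x + D l *m v) = sqn (C l *m x) + sqn (D l *m v).
Proof.
move=> CD; rewrite -bf1 !bfDl !bfDr !bf1 (bf_sym (C l *m x) (D l *m v) (trmx1 _ _)).
have -> : bf 1%:M (C l *m x) (D l *m v) = 0.
  by rewrite -bf_mulm mulmx1 CD bf0m.
lra.
Qed.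

Lemma sqint_output nu x0 v k : initial_density mu nu ->
  (forall k, sqint M nu k (v k)) ->
  sqint M nu k (fun w => C (th k w) *m state M A B x0 v k w + D (th k w) *m v k w).
Proof.
move=> nuP sv; have sx := sqint_state g_measurable G_density nuP bA bB x0 sv k.
by apply: sqintD; exact: (sqint_mulmx g_measurable G_density nuP).
Qed.

Definition input_weight gamma l : 'M[R]_r := (D l)^T *m D l - gamma%:M.

Lemma ebmx_input_weight gamma : ebmx mu (input_weight gamma).
Proof.
apply: ebmxB; last exact: ebmx_cst.
by apply: ebmxM => //; exact: ebmx_tr.
Qed.

Lemma bf_input_weight gamma l v :
  bf (input_weight gamma l) v v = sqn (D l *m v) - gamma * sqn v.
Proof. by rewrite bf_subm bf_gram bf_scalar. Qed.

Definition state_weight eps l : 'M[R]_n := (C l)^T *m C l + eps%:M.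

Lemma ebmx_state_weight eps : ebmx mu (state_weight eps).
Proof.
apply: ebmxD; last exact: ebmx_cst.
by apply: ebmxM => //; exact: ebmx_tr.
Qed.

Lemma bf_state_weight eps l x :
  bf (state_weight eps l) x x = sqn (C l *m x) + eps * sqn x.
Proof. by rewrite bf_addm bf_gram bf_scalar. Qed.

Lemma psd_state_weight eps l : 0 <= eps -> psdmx (state_weight eps l).
Proof.
move=> e0; split; first by rewrite linearD /= trmx_mul trmxK tr_scalar_mx.
move=> x; rewrite -/(bf _ x x) bf_state_weight.
by rewrite addr_ge0 ?sqn_ge0 // mulr_ge0 ?sqn_ge0.
Qed.

(** [C^T D = 0] holds almost surely along the chain, so the output energy splits into a form in [x]
    and a form in [v]. *)
Lemma mean_cost nu x0 v k eps gamma : initial_density mu nu ->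
  (forall k, sqint M nu k (v k)) ->
  \int[law M nu]_w bf (state_weight eps (th k w)) (state M A B x0 v k w) (state M
    A B x0 v k w) +
  \int[law M nu]_w bf (input_weight gamma (th k w)) (v k w) (v k w) =
  \int[law M nu]_w sqn (C (th k w) *m state M A B x0 v k w + D (th k w) *m v k w)
  + eps * \int[law M nu]_w sqn (state M A B x0 v k w)
  - gamma * \int[law M nu]_w sqn (v k w).
Proof.
move=> nuP sv; have sx := sqint_state g_measurable G_density nuP bA bB x0 sv k.
have so := sqint_output x0 k nuP sv.
have io := integrable_sqn g_measurable G_density nuP so.
have ix := integrable_sqn g_measurable G_density nuP sx.
have iv := integrable_sqn g_measurable G_density nuP (sv k).
have i1 := integrable_chain_bf g_measurable G_density nuP k (ebmx_state_weight
  eps) sx sx.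
have i2 := integrable_chain_bf g_measurable G_density nuP k (ebmx_input_weight
  gamma) (sv k) (sv k).
rewrite -RintegralD // -!RintegralZl // -RintegralD //; last exact: integrable_scaler.
rewrite -RintegralB //; last 2 first.
- by apply: integrable_addr => //; exact: integrable_scaler.
- exact: integrable_scaler.
apply: ae_eq_Rintegral.
- by apply/measurable_EFinP; exact: measurable_int (integrable_addr i1 i2).
- apply: measurable_funB; first apply: measurable_funD;
  try apply: measurable_funM => //; apply/measurable_EFinP.
  + exact: measurable_int io.
  + exact: measurable_int ix.
  + exact: measurable_int iv.
have := chain_aeM nuP k CD0; apply: filterS => w CD.
rewrite bf_state_weight bf_input_weight sqn_output //; lra.
Qed.

Lemma dissipative_io_norm P eta gamma : 0 < gamma ->
  dissipative mu g A B D gamma (state_weight 0) P eta ->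
  (io_norm M A B C D < (Num.sqrt gamma)%:E)%E.
Proof.
move=> gamma0 [bP pP eta0 h].
(* Telescoping gives the gain [gamma - eta], which may be negative; [gamma / 2] keeps [c] positive.
   The midpoint [e] turns the non-strict bound by [c] into the strict one required in [io_norm]. *)
pose c := Num.max (gamma - eta) (gamma / 2).
have c0 : 0 < c by rewrite lt_max divr_gt0 ?orbT.
have cg : c < gamma by rewrite gt_max; apply/andP; split; lra.
pose e := (c + gamma) / 2.
have ce : c < e by rewrite /e; lra.
have eg : e < gamma by rewrite /e; lra.
have e0 : 0 < e by exact: lt_trans ce.
apply: (@le_lt_trans _ _ (Num.sqrt e)%:E); last by rewrite lte_fin ltr_sqrt.
apply: ereal_inf_lbound; exists e => //; split => // nu nuP v vl2 v0.
have sv k := l2_seq_sqint k vl2.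
have sz k := sqint_output 0 k nuP sv.
have key N : \sum_(k < N) \int[law M nu]_w sqn (io_operator M A B C D v k w) <=
    c * \sum_(k < N) \int[law M nu]_w sqn (v k w).
  (* The margin [eta |v|^2] is moved into the input weight, which becomes
     [D^T D - (gamma - eta) I]. *)
  have := dissipation_sum g_measurable g_ge0 G_density nuP bA bB 0 sv N bP
    (ebmx_state_weight 0) (ebmx_input_weight (gamma - eta)).
  rewrite (eq_bigr (fun k : 'I_N =>
    \int[law M nu]_w sqn (io_operator M A B C D v k w) -
     (gamma - eta) * \int[law M nu]_w sqn (v k w))); last first.
    by move=> k _; rewrite mean_cost // mul0r addr0.
  rewrite sumrB -mulr_sumr.
  have -> : \int[law M nu]_w bf (P (th 0 w)) 0 0 = 0.
    under eq_Rintegral do rewrite -(scale0r 0) bfZl mul0r.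
    by rewrite Rintegral_cst // mul0r.
  have hN := expectation_bf_ge0 g_measurable G_density nuP N bP
    (sqint_state g_measurable G_density nuP bA bB 0 sv N) pP.
  set Z := \sum_(k < N) \int[_]_w sqn (io_operator _ _ _ _ _ _ _ _).
  set V := \sum_(k < N) \int[_]_w sqn (v _ _).
  have V0 : 0 <= V by apply: sumr_ge0 => k _; exact: ge0_mean_sqn.
  move=> hh.
  have cV : (gamma - eta) * V <= c * V by rewrite ler_wpM2r // le_max lexx.
  have : Z <= (gamma - eta) * V; last by lra.
  suff : \int[law M nu]_w bf (P (th N w)) (state M A B 0 v N w) (state M A B 0 v
    N w) + (Z - (gamma - eta) * V) <= 0 by lra.
  apply: hh; apply: filterS h => l h y u; have := h y u.
  rewrite /stage_cost bf_input_weight.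
  have := mulr_ge0 (ltW eta0) (sqn_ge0 y); lra.
have lez := l2_sqnorm_le nuP (ltW c0) sz sv key.
have v_fin : l2_sqnorm M nu v \is a fin_num.
  rewrite ge0_fin_numE; first by case: vl2.
  by rewrite l2_sqnormE //; apply: nneseries_ge0 => k _ _;
    rewrite lee_fin ge0_mean_sqn.
have v_gt0 : (0 < l2_sqnorm M nu v)%E.
  rewrite lt0e v0 l2_sqnormE //.
  by apply: nneseries_ge0 => k _ _; rewrite lee_fin ge0_mean_sqn.
rewrite sube_lt0; last by rewrite fin_numM // orbT.
apply: le_lt_trans lez _.
rewrite -(fineK v_fin) -!EFinM lte_fin ltr_pM2r //.
by rewrite -lte_fin fineK.
Qed.

(** The form of the norm bound that reaches the Riccati iterates: [kappa] will bound the iterates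
    and [eta] their [Psi3] from below, both independently of the horizon. *)
Definition cost_bound eps eta kappa gamma : Prop :=
  forall nu, initial_density mu nu -> forall x0 v,
  (forall k, sqint M nu k (v k)) -> forall N,
  \sum_(k < N) (\int[law M nu]_w bf (state_weight eps (th k w))
      (state M A B x0 v k w) (state M A B x0 v k w) +
    \int[law M nu]_w bf (input_weight gamma (th k w)) (v k w) (v k w))
  <= kappa * sqn x0 - eta * \sum_(k < N) \int[law M nu]_w sqn (v k w).

Lemma io_norm_bound gamma : EMSS M A -> mu setT != 0%E ->
  (io_norm M A B C D < (Num.sqrt gamma)%:E)%E -> 0 < gamma ->
  exists2 e, 0 < e < gamma & forall nu, initial_density mu nu -> forall v,
    (forall k, sqint M nu k (v k)) -> forall N,
    \sum_(k < N) \int[law M nu]_w sqn (io_operator M A B C D v k w) <=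
    e * \sum_(k < N) \int[law M nu]_w sqn (v k w).
Proof.
move=> sA mu0 /ereal_inf_lt[_ [e [e0 He] <-]] eg gamma0.
have {}eg : e < gamma by move: eg; rewrite lte_fin ltr_sqrt.
exists e; first by rewrite e0.
move=> nu nuP v sv N.
(* The norm concerns inputs in [l^2], so the input is cut at the horizon; by causality the outputs
   before [N] do not change. *)
pose u k w := if (k < N)%N then v k w else 0.
have su k : sqint M nu k (u k).
  by rewrite /u; case: (k < N)%N; [exact: sv|exact: sqint_cst].
have u0 k w : (N <= k)%N -> u k w = 0 by rewrite /u leqNgt => /negbTE ->.
have suE : \sum_(k < N) \int[law M nu]_w sqn (u k w) =
    \sum_(k < N) \int[law M nu]_w sqn (v k w).
  by apply: eq_bigr => k _; rewrite /u ltn_ord.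
have zE : \sum_(k < N) \int[law M nu]_w sqn (io_operator M A B C D u k w) =
    \sum_(k < N) \int[law M nu]_w sqn (io_operator M A B C D v k w).
  apply: eq_bigr => k _; apply: eq_Rintegral => w _; rewrite /io_operator.
  rewrite {2}/u ltn_ord (@state_eq _ _ A B 0 u v) // => j jk.
  by rewrite /u (ltn_trans jk).
have l2u := l2_sqnorm_finite nuP su u0.
have sz k := sqint_output 0 k nuP su.
rewrite -suE -zE.
(* [io_norm] excludes inputs of norm zero; for these the stability estimate shows that the output
   energy vanishes. *)
have [V0|V0] := eqVneq (l2_sqnorm M nu u) 0%E; last first.
  have ul2 : l2_seq M nu u by split=> [k|]; [case: (su k)|rewrite l2u ltry].
  have := He nu nuP u ul2 V0; rewrite l2u -EFinM sube_lt0; last by rewrite orbT.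
  move=> h; rewrite -lee_fin; apply: le_trans (ltW h).
  exact: l2_sqnorm_partial.
have {}V0 : \sum_(k < N) \int[law M nu]_w sqn (u k w) = 0.
  by move: V0; rewrite l2u => -[].
have [S LS] := EMSS_lyapunov g_measurable g_ge0 G_density mu0 bA sA.
have [c c0 /(_ nu nuP 0 u su N)] := forced_state_bound bA bB LS.
rewrite V0 sqn0 addr0 !mulr0 => X0.
have [cC cC0 hC] := ebmx_sqn_bound bC; have [cD cD0 hD] := ebmx_sqn_bound bD.
have sx k := sqint_state g_measurable G_density nuP bA bB 0 su k.
apply: (@le_trans _ _ (\sum_(k < N) (2 * cC * \int[law M nu]_w sqn (state M A B 0
  u k w)
   + 2 * cD * \int[law M nu]_w sqn (u k w)))); last first.
  by rewrite big_split /= -!mulr_sumr V0 mulr0 addr0 mulr_ge0_le0 // mulr_ge0 // ltW.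
apply: ler_sum => k _.
have ix := integrable_sqn g_measurable G_density nuP (sx k).
have iu := integrable_sqn g_measurable G_density nuP (su k).
rewrite -!RintegralZl // -RintegralD //; try exact: integrable_scaler.
apply: le_ae_Rintegral.
- exact: (integrable_sqn g_measurable G_density nuP (sz k)).
- by apply: integrable_addr; exact: integrable_scaler.
have := ae_and hC hD => /(chain_aeM nuP k); apply: filterS => w [hCw hDw].
rewrite /io_operator; apply: le_trans (sqnD_le _ _) _.
have := hCw (state M A B 0 u k w); have := hDw (u k w); lra.
Qed.

(* Split the output into free and forced response; the gap between the norm and
   [sqrt gamma] absorbs the cross term, the extra weight [eps] and leaves [eta]. *)
Lemma io_norm_cost_bound gamma : EMSS M A -> mu setT != 0%E ->
  (io_norm M A B C D < (Num.sqrt gamma)%:E)%E -> 0 < gamma ->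
  exists eps eta kappa, [/\ 0 < eps, 0 < eta & cost_bound eps eta kappa gamma].
Proof.
move=> sA mu0 ion gamma0.
have [e /andP[e0 eg] He] := io_norm_bound sA mu0 ion gamma0.
have [S LS] := EMSS_lyapunov g_measurable g_ge0 G_density mu0 bA sA.
have [c c0 hc] := forced_state_bound bA bB LS.
have [cC cC0 hC] := ebmx_sqn_bound bC.
(* [del] and [eps] each spend a quarter of the gap [gamma - e], through [del * e] and [eps * c]; the
   remaining half is the margin on the input. *)
pose del := (gamma - e) / (4 * e).
have ge0 : 0 < gamma - e by rewrite subr_gt0.
have del0 : 0 < del by rewrite divr_gt0 // mulr_gt0.
pose eps := (gamma - e) / (4 * c).
have eps0 : 0 < eps by rewrite divr_gt0 // mulr_gt0.
exists eps, ((gamma - e) / 2), ((1 + del^-1) * cC * c + eps * c).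
split=> //; first by rewrite divr_gt0.
move=> nu nuP x0 v sv N.
rewrite (eq_bigr _ (fun (k : 'I_N) _ => mean_cost x0 k eps gamma nuP sv)).
have s0 k := sqint_cst M nu k (0 : 'cV[R]_r).
have hx := hc nu nuP x0 v sv N.
have hy := hc nu nuP x0 (fun _ _ => 0) s0 N.
have hz := He nu nuP v sv N.
rewrite sumrB big_split /= -!mulr_sumr.
set X := \sum_(k < N) \int[_]_w sqn (state _ _ _ x0 v _ _) in hx *.
set V := \sum_(k < N) \int[_]_w sqn (v _ _) in hx hz *.
set Y := \sum_(k < N) \int[_]_w sqn (state _ _ _ x0 _ _ _) in hy *.
set Z := \sum_(k < N) \int[_]_w sqn (io_operator _ _ _ _ _ _ _ _) in hz *.
have {}hy : Y <= c * sqn x0.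
  move: hy; rewrite [X in _ + X]big1 ?addr0 // => k _.
  under eq_Rintegral do rewrite sqn0.
  by rewrite Rintegral_cst // mul0r.
have hO : \sum_(k < N) \int[law M nu]_w sqn (C (th k w) *m state M A B x0 v k w +
  D (th k w) *m v k w)
    <= (1 + del) * Z + (1 + del^-1) * cC * Y.
  rewrite /Z /Y !mulr_sumr -big_split /=; apply: ler_sum => k _.
  have iz := integrable_sqn g_measurable G_density nuP (sqint_output 0 k nuP sv).
  have iy := integrable_sqn g_measurable G_density nuP
    (sqint_state g_measurable G_density nuP bA bB x0 s0 k).
  rewrite -!RintegralZl // -RintegralD //; try exact: integrable_scaler.
  apply: le_ae_Rintegral.
  - exact: (integrable_sqn g_measurable G_density nuP (sqint_output x0 k nuP sv)).
  - by apply: integrable_addr; exact: integrable_scaler.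
  have := chain_aeM nuP k hC; apply: filterS => w hCw.
  rewrite stateD mulmxDr -addrA addrC -/(io_operator M A B C D v k w) -bf1.
  apply: le_trans (young _ _ (psdmx1 r) del0) _; rewrite !bf1 lerD2l -mulrA.
  by rewrite ler_wpM2l ?addr_ge0 ?invr_ge0 ?(ltW del0).
have del_e : del * e = (gamma - e) / 4 by rewrite /del; field; rewrite gt_eqF.
have eps_c : eps * c = (gamma - e) / 4 by rewrite /eps; field; rewrite gt_eqF.
have V0 : 0 <= V by apply: sumr_ge0 => k _; exact: ge0_mean_sqn.
have k1 : 0 <= (1 + del^-1) * cC.
  by rewrite mulr_ge0 ?(ltW cC0) // addr_ge0 ?invr_ge0 ?(ltW del0).
have k2 : 0 <= 1 + del by rewrite addr_ge0 ?(ltW del0).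
have h1 := ler_wpM2l k1 hy; have h2 := ler_wpM2l k2 hz;
  have h3 := ler_wpM2l (ltW eps0) hx.
have h4 : del * (e * V) = (gamma - e) / 4 * V by rewrite mulrA del_e.
have h5 : eps * (c * V) = (gamma - e) / 4 * V by rewrite mulrA eps_c.
lra.
Qed.

(** * Dynamic programming *)

Section CostToGo.
Variables (Q : T -> 'M[R]_n) (gamma eta : R).
Hypothesis bQ : ebmx mu Q.
Hypothesis pQ : {ae mu, forall l, psdmx (Q l)}.
Hypothesis eta0 : 0 < eta.
Local Notation iter := (riccati_iter mu g A B D gamma Q).
Local Notation Psi3 := (Psi3 mu g B D gamma).
Local Notation gain := (gain mu g A B D gamma).

(** The index of the iterate counts the stages left, so gains are used in reverse order, and each
    attains the Riccati maximum. The starting time [m] is free both for the induction and to allow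
    an arbitrary input before it. *)
Lemma cost_to_go nu x0 v N m : initial_density mu nu ->
  (forall k, sqint M nu k (v k)) ->
  (forall i, (i < N)%N -> {ae mu, forall l, psdmx (Psi3 (iter i) l - eta%:M)}) ->
  (forall i, (i < N)%N -> forall w, v (m + i)%N w =
     gain (iter (N - i.+1)) (th (m + i) w) *m state M A B x0 v (m + i) w) ->
  \int[law M nu]_w bf (iter N (th m w)) (state M A B x0 v m w) (state M A B x0 v m w)
  <= \sum_(i < N) (\int[law M nu]_w bf (Q (th (m + i) w))
        (state M A B x0 v (m + i) w) (state M A B x0 v (m + i) w) +
      \int[law M nu]_w bf (input_weight gamma (th (m + i) w)) (v (m +
        i)%N w) (v (m + i)%N w)).
Proof.
move=> nuP sv; have sx k := sqint_state g_measurable G_density nuP bA bB x0 sv k.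
elim: N m => [|N IH] m P3 vE.
  rewrite big_ord0 /=; under eq_Rintegral do rewrite bf0m.
  by rewrite Rintegral_cst // mul0r.
have P3' i : (i < N)%N -> {ae mu, forall l, psdmx (Psi3 (iter i) l - eta%:M)}.
  by move=> iN; apply: P3; exact: ltnW.
have [bP pP] := riccati_iter_psd g_measurable g_ge0 G_density bA bB bD bQ pQ eta0 P3'.
have [bP1 pP1] := riccati_iter_psd g_measurable g_ge0 G_density bA bB bD bQ pQ
  eta0 P3.
have vE' i : (i < N)%N -> forall w, v (m.+1 + i)%N w =
    gain (iter (N - i.+1)) (th (m.+1 + i) w) *m state M A B x0 v (m.+1 + i) w.
  by move=> iN w; rewrite addSnnS vE // subSS.
have tail := IH m.+1 P3' vE'.
rewrite big_ord_recl addn0.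
rewrite (eq_bigr (fun i : 'I_N => \int[law M nu]_w bf (Q (th (m.+1 + i) w))
        (state M A B x0 v (m.+1 + i) w) (state M A B x0 v (m.+1 + i) w) +
      \int[law M nu]_w bf (input_weight gamma (th (m.+1 + i) w)) (v (m.+1 +
        i)%N w) (v (m.+1 + i)%N w))); last first.
  by move=> i _; rewrite lift0 addSnnS.
apply: le_trans (lerD (lexx _) tail); rewrite addrC.
apply: (expectation_next_ge g_measurable g_ge0 G_density nuP bA bB bP bP1 bQ
   (ebmx_input_weight gamma) (sx m) (sv m)).
have := chain_aeM nuP m (P3 N (ltnSn N)); apply: filterS => w P3w.
have [sE _] := Eop_psd g_measurable g_ge0 G_density (th m w) bP pP.
have := vE 0%N isT w; rewrite addn0 subn1 /= => ->.
rewrite -(riccati_attained A Q _ sE eta0 P3w) /stage_cost bf_input_weight.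
by rewrite !addrA lexx.
Qed.

(** The closed-loop recursion does not mention an input sequence; reading the input off from it
    breaks the circularity between [v] and [state]. *)
Fixpoint feedback_state (K : nat -> T -> 'M[R]_(r, n)) (u : nat -> 'cV[R]_r) x0 k w :=
  if k is k'.+1 then
    A (th k' w) *m feedback_state K u x0 k' w
      + B (th k' w) *m (K k' (th k' w) *m feedback_state K u x0 k' w + u k')
  else x0.

Lemma feedback_input nu (K : nat -> T -> 'M[R]_(r, n)) u x0 : initial_density mu nu ->
  (forall k, ebmx mu (K k)) ->
  exists v, (forall k, sqint M nu k (v k)) /\
    forall k w, v k w = K k (th k w) *m state M A B x0 v k w + u k.
Proof.
move=> nuP bK; pose v k w := K k (th k w) *m feedback_state K u x0 k w + u k.
have stE k w : state M A B x0 v k w = feedback_state K u x0 k w.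
  by elim: k => //= k ->.
have sf k : sqint M nu k (feedback_state K u x0 k).
  elim: k => [|k IH]; first exact: sqint_cst.
  apply: sqintS; apply: (sqint_next g_measurable G_density nuP bA bB IH).
  apply: sqintD; last exact: sqint_cst.
  exact: (sqint_mulmx g_measurable G_density nuP).
exists v; split=> [k|k w]; last by rewrite stE.
apply: sqintD; last exact: sqint_cst.
exact: (sqint_mulmx g_measurable G_density nuP).
Qed.

End CostToGo.

(* The [N]-stage cost of the optimal feedback is [x0^T P_N x0], which bounds [P_N];
   spending a constant input at time 0 and the optimal feedback afterwards,
   starting from [x0 = 0], bounds [Psi3 P_N] from below. *)
Lemma cost_bound_iter eps eta kappa gamma : mu setT != 0%E -> 0 <= eps -> 0 < eta ->
  cost_bound eps eta kappa gamma ->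
    let iter := riccati_iter mu g A B D gamma (state_weight eps) in
  forall N, {ae mu, forall l, psdmx (Psi3 mu g B D gamma (iter N) l - eta%:M)} /\
    {ae mu, forall l, forall x, bf (iter N l) x x <= kappa * sqn x}.
Proof.
move=> mu0 eps0 eta0 cb iter N.
have bQ := ebmx_state_weight eps.
have pQ : {ae mu, forall l, psdmx (state_weight eps l)}.
  by apply: nearW => l; exact: psd_state_weight.
(* Strong induction: both bounds at [N] rest on the coercivity of [Psi3] at all earlier iterates,
   which controls the gains. *)
have [m] := ubnP N; elim: m N => // m IHm N Nm.
have P3 i : (i < N)%N ->
  {ae mu, forall l, psdmx (Psi3 mu g B D gamma (iter i) l - eta%:M)}.
  by move=> iN; have [] := IHm i (leq_trans iN Nm).
have [bP pP] := riccati_iter_psd g_measurable g_ge0 G_density bA bB bD bQ pQ eta0 P3.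
have bK i : (i < N)%N -> ebmx mu (gain mu g A B D gamma (iter i)).
  move=> iN; apply: (ebmx_gain g_measurable g_ge0 G_density bA bB bD);
    last by exists eta => //; exact: P3.
  have P3i j : (j < i)%N ->
    {ae mu, forall l, psdmx (Psi3 mu g B D gamma (iter j) l - eta%:M)}.
    by move=> ji; apply: P3; exact: ltn_trans iN.
  exact: (riccati_iter_psd g_measurable g_ge0 G_density bA bB bD bQ pQ eta0 P3i).1.
split.
  have b3 := ebmx_Psi3 g_measurable g_ge0 G_density gamma bB bD bP.
  have b3' : ebmx mu (fun l => Psi3 mu g B D gamma (iter N) l - eta%:M).
    by apply: ebmxB => //; exact: ebmx_cst.
  suff h : {ae mu, forall l, forall x, 0 <= bf (Psi3 mu g B D gamma (iter N) l -
    eta%:M) x x}.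
    apply: filterS h => l h; split=> // .
    have [sE _] := Eop_psd g_measurable g_ge0 G_density l bP pP.
    by rewrite linearB /= tr_scalar_mx Psi3_sym.
  apply: law_bf_ge0 => // nu nuP c.
  (* The horizon has [N + 1] stages: the input [c] at time 0, then at time [k] the gain of the
     iterate with the [N - k] stages that follow. *)
  pose K k := if (0 < k <= N)%N then gain mu g A B D gamma (iter (N - k)%N) else
    fun=> 0.
  have bKk k : ebmx mu (K k).
    rewrite /K; case: ifP => [/andP[k0 kN]|_]; last exact: ebmx_cst.
    by apply: bK; rewrite ltn_subrL k0 (leq_trans k0).
  pose u k : 'cV[R]_r := if k is 0%N then c else 0.
  have [v [sv vE]] := feedback_input u 0 nuP bKk.
  have ctg := @cost_to_go (state_weight eps) gamma eta bQ pQ eta0 nu 0 v N 1 nuP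
    sv P3.
  have v0 w : v 0%N w = c by rewrite vE /K /= mul0mx add0r.
  have x1 w : state M A B 0 v 1 w = B (th 0%N w) *m c by rewrite /= mulmx0 add0r v0.
  have {}ctg := ctg _; have {ctg} : \int[law M nu]_w bf (iter N (th 1%N w))
      (state M A B 0 v 1 w) (state M A B 0 v 1 w) <=
      \sum_(i < N) (\int[law M nu]_w bf (state_weight eps (th (1 + i)%N w))
        (state M A B 0 v (1 + i) w) (state M A B 0 v (1 + i) w) +
      \int[law M nu]_w bf (input_weight gamma (th (1 + i)%N w)) (v (1 +
        i)%N w) (v (1 + i)%N w)).
    apply: ctg => i iN w; rewrite vE /K /u add1n /= iN addr0.
    by [].
  have sBc : sqint M nu 0 (fun w => B (th 0%N w) *m c).
    by apply: (sqint_mulmx g_measurable G_density nuP bB); exact: sqint_cst.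
  under [X in X <= _ -> _]eq_Rintegral do rewrite x1.
  rewrite (expectation_step g_measurable g_ge0 G_density nuP bP sBc) => ctg.
  (* From [x0 = 0] the whole cost is at most [- eta] times the input energy, which is at least
     [|c|^2]; by [ctg] the stages after the first cost at least the mean of the form of [E (iter N)]
     at [B c]. *)
  have := cb nu nuP 0 v sv N.+1; rewrite sqn0 mulr0 sub0r !big_ord_recl.
  rewrite [X in _ + X <= _](_ : _ = \sum_(i < N) (\int[law M nu]_w bf
    (state_weight eps (th (1 + i)%N w))
        (state M A B 0 v (1 + i) w) (state M A B 0 v (1 + i) w) +
      \int[law M nu]_w bf (input_weight gamma (th (1 + i)%N w)) (v (1 +
        i)%N w) (v (1 + i)%N w))); last first.
    by apply: eq_bigr => i _; rewrite lift0 add1n.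
  move: ctg; set Cs := (X in _ <= X -> _) => ctg.
  set Vs := \sum_(i < N) \int[_]_w sqn _.
  have Vs0 : 0 <= Vs by apply: sumr_ge0 => i _; exact: ge0_mean_sqn.
  have -> : \int[law M nu]_w bf (state_weight eps (th 0%N w)) (state M A B 0 v 0%N w)
      (state M A B 0 v 0%N w) = 0.
    under eq_Rintegral do rewrite /= -(scale0r 0) bfZl mul0r.
    by rewrite Rintegral_cst // mul0r.
  have -> : \int[law M nu]_w sqn (v 0%N w) = sqn c.
    by under eq_Rintegral do rewrite v0; exact: Rintegral_probability.
  under [X in 0 + X]eq_Rintegral do rewrite v0.
  have i1 := integrable_chain_bf g_measurable G_density nuP 0 (ebmx_input_weight
    gamma)
    (sqint_cst M nu 0 c) (sqint_cst M nu 0 c).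
  have i2 := integrable_chain_bf g_measurable G_density nuP 0
    (ebmx_Eop g_measurable g_ge0 G_density bP) sBc sBc.
  have IE : \int[law M nu]_w bf (Psi3 mu g B D gamma (iter N) (th 0%N w) -
    eta%:M) c c =
    - (eta * sqn c) - (\int[law M nu]_w bf (input_weight gamma (th 0%N w)) c c +
      \int[law M nu]_w bf (E (iter N) (th 0%N w)) (B (th 0%N w) *m c) (B (th 0%N
        w) *m c)).
    rewrite -RintegralD // -[X in X - _](Rintegral_probability M nu) -RintegralB
      //; last 2 first.
    - exact: integrable_constant.
    - exact: integrable_addr.
    apply: eq_Rintegral => w _.
    by rewrite bf_subm bf_scalar bf_Psi3E bf_input_weight; lra.
  move=> h; suff : 0 <= \int[law M nu]_w bf (Psi3 mu g B D gamma (iter N) (th 0%N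
    w) - eta%:M) c c.
    exact.
  have {}h : \int[law M nu]_w bf (input_weight gamma (th 0%N w)) c c +
      \int[law M nu]_w bf (E (iter N) (th 0%N w)) (B (th 0%N w) *m c) (B (th 0%N
        w) *m c)
      <= - (eta * (sqn c + Vs)).
    by apply: le_trans h; rewrite add0r; apply: lerD; [exact: lexx|exact: ctg].
  by rewrite IE subr_ge0; apply: le_trans h _;
    rewrite lerN2 ler_wpM2l ?(ltW eta0) // lerDl.
(* Optimal feedback from time 0 on: after time [k] there remain [N - k - 1] stages. *)
pose K k := if (k < N)%N then gain mu g A B D gamma (iter (N - k.+1)%N) else fun=> 0.
have bKk k : ebmx mu (K k).
  rewrite /K; case: ifP => [kN|_]; last exact: ebmx_cst.
  by apply: bK; rewrite ltn_subrL (leq_ltn_trans _ kN).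
have h : {ae mu, forall l, forall x, 0 <= bf (kappa%:M - iter N l) x x}.
  apply: law_bf_ge0 => //; first by apply: ebmxB => //; exact: ebmx_cst.
  move=> nu nuP x0.
  have [v [sv vE]] := feedback_input (fun=> 0) x0 nuP bKk.
  have ctg : \int[law M nu]_w bf (iter N (th 0%N w)) x0 x0 <= kappa * sqn x0.
    apply: (@le_trans _ _ (kappa * sqn x0 - eta * \sum_(k < N) \int[law M nu]_w
      sqn (v k w))); last first.
      rewrite gerBl mulr_ge0 ?(ltW eta0) //.
      by apply: sumr_ge0 => k _; exact: ge0_mean_sqn.
    apply: le_trans (cb nu nuP x0 v sv N).
    apply: (@cost_to_go (state_weight eps) gamma eta bQ pQ eta0 nu x0 v N 0 nuP
      sv P3).
    by move=> i iN w; rewrite add0n vE /K iN addr0.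
  have i0 := integrable_chain_bf g_measurable G_density nuP 0 bP (sqint_cst M nu
    0 x0) (sqint_cst M nu 0 x0).
  under eq_Rintegral do rewrite bf_subm bf_scalar.
  rewrite RintegralB; [|exact: measurableT|exact: integrable_constant|exact: i0].
  by rewrite Rintegral_probability subr_ge0.
by apply: filterS h => l h x; have := h x; rewrite bf_subm bf_scalar subr_ge0.
Qed.

End BoundedReal.

(** * The bounded real lemma *)

Section BoundedRealLemma.
Context {R : realType} {d : measure_display} {T : measurableType d}.
Variables (mu : {sigma_finite_measure set T -> \bar R}) (G : R.-pker T ~> T).
Variable (g : T -> T -> R).
Hypothesis g_measurable : measurable_fun setT (fun p : T * T => g p.1 p.2).
Hypothesis g_ge0 : forall l t, 0 <= g l t.
Hypothesis G_density : forall l L, measurable L ->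
  G l L = (\int[mu]_(t in L) (g l t)%:E)%E.
Context {d' : measure_display} {Omega : measurableType d'}.
Variable M : markov_chain mu G Omega.
Context (n r : nat) (A : T -> 'M[R]_n) (B : T -> 'M[R]_(n, r)).
Context (C : T -> 'M[R]_(r, n)) (D : T -> 'M[R]_r).
Hypothesis HA : Hinf mu A.
Hypothesis HB : Hinf mu B.
Hypothesis HC : Hinf mu C.
Hypothesis HD : Hinf mu D.
Hypothesis CD0 : {ae mu, forall l, (C l)^T *m D l = 0}.
Variable gamma : R.
Hypothesis gamma_gt0 : 0 < gamma.

Let bA : ebmx mu A. Proof. exact/HinfP. Qed.
Let bB : ebmx mu B. Proof. exact/HinfP. Qed.
Let bC : ebmx mu C. Proof. exact/HinfP. Qed.
Let bD : ebmx mu D. Proof. exact/HinfP. Qed.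
Local Notation Q := (state_weight C 0).
Local Notation Psi1 := (Psi1 mu g A C).
Local Notation Psi2 := (Psi2 mu g A B).
Local Notation Psi3 := (Psi3 mu g B D gamma).
Local Notation ric eps := (riccati mu g A B D gamma (state_weight C eps)).
Local Notation cl := (closed_loop mu g A B D gamma).
Local Notation dissip := (dissipative mu g A B D gamma Q).
Local Notation riccati_eq := (stabilizing_riccati_solution g A B C D M gamma).
Local Notation riccati_ineq := (strict_riccati_solution mu g A B C D gamma).
Let bQ : ebmx mu Q. Proof. exact: ebmx_state_weight. Qed.
Let pQ : {ae mu, forall l, psdmx (Q l)}.
Proof. by apply: nearW => l; exact: psd_state_weight. Qed.

(** [G] has mass 1 and a density with respect to [mu]. A null [mu] would admit no initial density,
    and statements quantified over these would be vacuous. *)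
Lemma mu_neq0 : mu setT != 0%E.
Proof.
apply/eqP => mu0; have := @prob_kernel _ _ _ _ _ G (point : T); rewrite G_density //.
rewrite null_set_integral //; first by move=> /eqP; rewrite eq_sym onee_eq0.
by apply/measurable_EFinP; exact: (measurable_density g_measurable).
Qed.

Lemma riccatiE eps P l : ric eps P l =
  Psi1 P l + Psi2 P l *m invmx (Psi3 P l) *m (Psi2 P l)^T + eps%:M.
Proof. rewrite /riccati /state_weight /Defs.Psi1 !addrA; exact: addrAC. Qed.

Lemma psdmx_weaken m (P : 'M[R]_m) xi : 0 < xi -> psdmx (P - xi%:M) -> psdmx P.
Proof.
move=> xi0 h; split; first exact: psdmx_sym h.
move=> x; apply: le_trans (psdmx_subs_le x h).
by rewrite mulr_ge0 ?sqn_ge0 // ltW.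
Qed.

Lemma scalar_mx0 m : (0%:M : 'M[R]_m) = 0.
Proof. by apply/matrixP => i j; rewrite !mxE mul0rn. Qed.

Lemma sub_riccati P l : P l - ric 0 P l =
  P l - Psi1 P l - Psi2 P l *m invmx (Psi3 P l) *m (Psi2 P l)^T.
Proof.
have subDA (a b c : 'M[R]_n) : a - (b + c) = a - b - c by rewrite opprD addrA.
by rewrite riccatiE scalar_mx0 addr0 subDA.
Qed.

Lemma riccati_ineq_dissipative P : riccati_ineq P -> exists eta, dissip P eta.
Proof.
move=> [[[/HinfP bP _] [xi xi0 Pxi]] [e e0 Pe] P3].
apply: (strict_dissipative g_measurable g_ge0 G_density bA bB bD bP _ _ P3).
  by apply: filterS Pxi => l; exact: psdmx_weaken.
exists e => //; apply: filterS Pe => l.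
by rewrite sub_riccati.
Qed.

Lemma dissipative_riccati_ineq P eta : dissip P eta -> riccati_ineq P.
Proof.
move=> dP; have [bP pP eta0 _] := dP.
have sP : SHinf mu P by split; [apply/HinfP; exact: bP|apply: filterS pP => l []].
split.
- split=> //; exists eta => //.
  (* Uniform positivity of [P] is the coercivity of a Lyapunov function for [A]. *)
  have LP := dissipative_lyapunov pQ dP.
  have := lyapunov_coercive g_measurable g_ge0 G_density LP.
  apply: filterS2 pP => l [sPl _] h; exact: psdmx_subsP.
- exists eta => //.
  have := dissipative_strict g_measurable g_ge0 G_density pQ dP.
  by apply: filterS => l; rewrite sub_riccati.
- by exists eta => //; exact: (dissipative_Psi3 g_measurable g_ge0 G_density pQ dP).
Qed.

Lemma riccati_eqP P : riccati_eq P ->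
  [/\ ebmx mu P, {ae mu, forall l, psdmx (P l)},
    exists2 eta, 0 < eta & {ae mu, forall l, psdmx (Psi3 P l - eta%:M)},
    {ae mu, forall l, P l = ric 0 P l} &
    exists S, lyapunov mu g (cl P) S (1 / 2)].
Proof.
move=> [[[/HinfP bP _] pP] PR st P3]; have [eta eta0 P3e] := P3; split=> //.
- apply: filterS2 PR P3e => l PRl P3l; rewrite [LHS]PRl riccatiE scalar_mx0 addr0.
  by rewrite invmxN ?(pd_unitmx eta0 P3l) // mulmxN mulNmx opprK.
- apply: (EMSS_lyapunov g_measurable g_ge0 G_density mu_neq0 _ st).
  apply: ebmxD => //; apply: ebmxM => //.
  exact: (ebmx_gain g_measurable g_ge0 G_density bA bB bD).
Qed.

Lemma riccati_eq_intro P S xi eta : ebmx mu P -> {ae mu, forall l, psdmx (P l)} ->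
  0 < eta -> {ae mu, forall l, psdmx (Psi3 P l - eta%:M)} ->
  {ae mu, forall l, P l = ric 0 P l} -> lyapunov mu g (cl P) S xi -> riccati_eq P.
Proof.
move=> bP pP eta0 P3 PR LS; split.
- split; last exact: pP.
  by split; [apply/HinfP; exact: bP|apply: filterS pP => l []].
- apply: filterS2 PR P3 => l PRl P3l; rewrite [LHS]PRl riccatiE scalar_mx0 addr0.
  by rewrite invmxN ?(pd_unitmx eta0 P3l) // mulmxN mulNmx opprK.
- apply: (lyapunov_EMSS g_measurable g_ge0 G_density M _ LS).
  apply: ebmxD => //; apply: ebmxM => //.
  by apply: (ebmx_gain g_measurable g_ge0 G_density bA bB bD) => //; exists eta.
- by exists eta.
Qed.

(** Each of the two stabilizing solutions is below the other by [stabilizing_maximal]. *)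
Lemma riccati_eq_unique P P' : riccati_eq P -> riccati_eq P' ->
  {ae mu, forall l, P' l = P l}.
Proof.
move=> /riccati_eqP[bP pP [eta eta0 P3] PR [S LS]].
move=> /riccati_eqP[bP' pP' [eta' eta'0 P3'] PR' [S' LS']].
have h := stabilizing_maximal g_measurable g_ge0 G_density bP bP' pP pP'
  eta0 eta'0 P3 P3' PR PR' LS'.
have h' := stabilizing_maximal g_measurable g_ge0 G_density bP' bP pP' pP
  eta'0 eta0 P3' P3 PR' PR LS.
have hh := ae_and h h'.
apply: filterS3 hh pP pP' => l [hl hl'] [sP _] [sP' _].
by apply: bf_inj => // x; apply/eqP; rewrite eq_le hl hl'.
Qed.

Lemma dissipative_riccati_eq P eta : dissip P eta -> exists Pbar, riccati_eq Pbar.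
Proof.
move=> dP.
have [Pbar [S [bP pP P3 PR LS]]] :=
  dissipative_stabilizing g_measurable g_ge0 G_density bA bB bD bQ pQ dP.
have [_ _ eta0 _] := dP.
by exists Pbar; exact: riccati_eq_intro bP pP eta0 P3 PR LS.
Qed.

Lemma riccati_eq_dissipative P : riccati_eq P -> exists Phat eta, dissip Phat eta.
Proof.
move=> /riccati_eqP[bP pP [eta eta0 P3] PR [S LS]].
exact: (stabilizing_dissipative g_measurable g_ge0 G_density bA bB bD bP pP eta0
  P3 PR LS).
Qed.

Lemma dissipative_bounded_real P eta : dissip P eta ->
  EMSS M A /\ (io_norm M A B C D < (Num.sqrt gamma)%:E)%E.
Proof.
move=> dP; split.
  exact: (lyapunov_EMSS g_measurable g_ge0 G_density M bA (dissipative_lyapunov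
    pQ dP)).
exact: (dissipative_io_norm g_measurable g_ge0 G_density M bA bB bC bD CD0
  gamma_gt0 dP).
Qed.

Lemma bounded_real_dissipative :
  EMSS M A /\ (io_norm M A B C D < (Num.sqrt gamma)%:E)%E ->
  exists P eta, dissip P eta.
Proof.
move=> [sA ion].
have [eps [eta [kappa [eps0 eta0 cb]]]] :=
  io_norm_cost_bound g_measurable g_ge0 G_density bA bB bC bD CD0 sA mu_neq0 ion
    gamma_gt0.
have it := cost_bound_iter g_measurable g_ge0 G_density bA bB bC bD mu_neq0
  (ltW eps0) eta0 cb.
have bQe := ebmx_state_weight bC eps.
have pQe : {ae mu, forall l, psdmx (state_weight C eps l)}.
  by apply: nearW => l; apply: psd_state_weight; exact: ltW.
have [P [bP pP _ P3 PR]] := riccati_iter_limit g_measurable g_ge0 G_density bA bB bD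
  bQe pQe eta0 (fun k => (it k).1) (fun k => (it k).2).
exists P; apply: (strict_dissipative g_measurable g_ge0 G_density bA bB bD bP pP).
  exists eps => //; apply: filterS2 PR pP => l PRl [sP _].
  (* [P] solves the equation with the larger weight, hence exceeds [ric 0 P] by exactly [eps I]. *)
  suff -> : P l - ric 0 P l - eps%:M = 0.
    by split=> [|x]; rewrite ?trmx0 // -/(bf _ x x) bf0m.
  by rewrite [X in X - _ - _]PRl !riccatiE scalar_mx0 addr0 addrAC addrK subrr.
by exists eta.
Qed.

Lemma riccati_gap Phat Pbar : riccati_ineq Phat -> riccati_eq Pbar ->
  Hinf_plus_star mu (fun l => Phat l - Pbar l).
Proof.
move=> /riccati_ineq_dissipative[e dH] /riccati_eqP[bP pP [eta eta0 P3] PR [S LS]].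
have [bH pH e0 _] := dH.
have gap := dissipative_gap g_measurable g_ge0 G_density dH bP pP eta0 P3 PR LS.
split; last by exists e.
split; first exact/HinfP/ebmxB.
by apply: filterS gap => l; exact: psdmx_sym.
Qed.

Lemma bounded_real_lemma :
  let bounded_real := EMSS M A /\ (io_norm M A B C D < (Num.sqrt gamma)%:E)%E in
  [/\ bounded_real <->
        (exists P, riccati_eq P /\
           forall Q, riccati_eq Q -> {ae mu, forall l, Q l = P l}),
      bounded_real <-> (exists P, riccati_ineq P)
    & forall Phat Pbar, riccati_ineq Phat -> riccati_eq Pbar ->
        Hinf_plus_star mu (fun l => Phat l - Pbar l)].
Proof.
move=> bounded_real; split; last exact: riccati_gap.
- split=> [/bounded_real_dissipative[P [eta /dissipative_riccati_eq[Pbar hP]]]|].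
    by exists Pbar; split=> // P'; exact: riccati_eq_unique.
  by move=> [P [/riccati_eq_dissipative[Phat [eta dP]] _]];
    exact: dissipative_bounded_real dP.
- split=> [/bounded_real_dissipative[P [eta dP]]|
  [P /riccati_ineq_dissipative[eta dP]]].
    by exists P; exact: dissipative_riccati_ineq dP.
  exact: dissipative_bounded_real dP.
Qed.

End BoundedRealLemma.

Theorem lemma1 (R : realType)
  (X : completeMetricType R) (X_separable : separable X)
  (Theta : set X) (Theta_borel : <<s @open X >> Theta) (t0 : Theta)
  (mu : {sigma_finite_measure set (borel_subset t0) -> \bar R})
  (G : R.-pker (borel_subset t0) ~> (borel_subset t0))
  (g : borel_subset t0 -> borel_subset t0 -> R)
  (g_measurable : measurable_fun setT
     (fun p : borel_subset t0 * borel_subset t0 => g p.1 p.2))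
  (g_ge0 : forall l t, 0 <= g l t)
  (G_density : forall l L, measurable L ->
     G l L = (\int[mu]_(t in L) (g l t)%:E)%E)
  (g_pos : {ae mu, forall l, (0 < \int[mu]_t (g t l)%:E)%E})
  (d : measure_display) (Omega : measurableType d)
  (M : markov_chain mu G Omega)
  (n r : nat)
  (A : borel_subset t0 -> 'M[R]_n) (B : borel_subset t0 -> 'M[R]_(n, r))
  (C : borel_subset t0 -> 'M[R]_(r, n)) (D : borel_subset t0 -> 'M[R]_r)
  (HA : Hinf mu A) (HB : Hinf mu B) (HC : Hinf mu C) (HD : Hinf mu D)
  (CD0 : {ae mu, forall l, (C l)^T *m D l = 0})
  (gamma : R) (gamma_gt0 : 0 < gamma) :
  let bounded_real :=
    EMSS M A /\ (io_norm M A B C D < (Num.sqrt gamma)%:E)%E in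
  let riccati_eq P := stabilizing_riccati_solution g A B C D M gamma P in
  let riccati_ineq P := strict_riccati_solution mu g A B C D gamma P in
  [/\ bounded_real <->
        (exists P, riccati_eq P /\
           forall Q, riccati_eq Q -> {ae mu, forall l, Q l = P l}),
      bounded_real <-> (exists P, riccati_ineq P)
    & forall Phat Pbar, riccati_ineq Phat -> riccati_eq Pbar ->
        Hinf_plus_star mu (fun l => Phat l - Pbar l)].
Proof.
exact: (bounded_real_lemma g_measurable g_ge0 G_density M HA HB HC HD CD0).
Qed.
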